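(* Let $(H,R)$ be a semisimple quasi-triangular Hopf algebra over a field $k$ of characteristic zero, and let $A$ be a strongly separable quantum commutative left $H$-module algebra with symmetric separability idempotent $x=x^1\otimes x^2$. Let $B=A\otimes H\otimes A^*$ with R-matrix $R_B$ as described in the context, and let $$\varphi:A\#H\to B,\qquad \varphi(a\#h)=S(h_{(1)})\cdot (x^1a)\otimes h_{(2)}\otimes (x^2\rightharpoonup\alpha_A).$$ Then $R_B\in\operatorname{Im}\varphi\otimes\operatorname{Im}\varphi$ if and only if $A$ is in the M\''uger center of ${}_H\mathcal M$, i.e. $(R_2^2R_1^1)\cdot a\otimes R_2^1R_1^2=a\otimes1_H$ for all $a\in A$. Moreover, if $A$ is in the M\''uger center of ${}_H\mathcal M$, then $\varphi:A\#H\to B$ is a map of quasi-triangular weak Hopf algebras from $(A\#H,\mathcal R)$ to $(B,R_B)$.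
   Context: All algebras and coalgebras are over $k$; Sweedler notation is used and $S$ is the antipode of $H$. A quasi-triangular Hopf algebra is a pair $(H,R)$, $R=R^1\otimes R^2\in H\otimes H$ invertible, with $R^1h_{(1)}\otimes R^2h_{(2)}=h_{(2)}R^1\otimes h_{(1)}R^2$ for all $h\in H$, $(\Delta\otimes id)(R)=R_1^1\otimes R_2^1\otimes R_1^2R_2^2$, $(id\otimes\Delta)(R)=R_1^1R_2^1\otimes R_2^2\otimes R_1^2$. Here $R_i=R_i^1\otimes R_i^2$ are copies of $R$ and $x_i=x_i^1\otimes x_i^2$ copies of $x$ (lower index: copy; upper index: tensor leg). A left $H$-module algebra $A$ is quantum commutative if $ab=(R^2\cdot b)(R^1\cdot a)$ for all $a,b\in A$. $A$ is strongly separable if it has a symmetric separability idempotent $x=x^1\otimes x^2\in A\otimes A$, i.e. $ax^1\otimes x^2=x^1\otimes x^2a$, $x^1x^2=1_A$, $x^1\otimes x^2=x^2\otimes x^1$. $\alpha_A\in A^*$ is determined by $\langle\alpha_A,x^1\rangle x^2=1_A$. For $a,b\in A$, $a^*\in A^*$, $h\in H$: $\langle a\rightharpoonup a^*,b\rangle=\langle a^*,ba\rangle$, $\langle a^*\leftharpoonup a,b\rangle=\langle a^*,ab\rangle$, $\langle a^*\vartriangleleft h,b\rangle=\langle a^*,h\cdot b\rangle$, and $\langle a^*_{(1)},a\rangle\langle a^*_{(2)},b\rangle=\langle a^*,ab\rangle$. Structure of $A\#H$: $(a\#h)(b\#g)=a(h_{(1)}\cdot b)\#h_{(2)}g$, unit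 $1_A\#1_H$, $\tilde\Delta(a\#h)=a(R^2\cdot x^1)\#R^1h_{(1)}\otimes x^2\#h_{(2)}$, $\tilde\varepsilon(a\#h)=\langle\alpha_A,a\rangle\varepsilon(h)$, $\tilde S(a\#h)=(1_A\#S(h))(R^2\cdot a\#R^1)$, $\mathcal R=\tilde1_{(2)}(1_A\#R^1)\tilde1_{(1')}\otimes\tilde1_{(1)}(1_A\#R^2)\tilde1_{(2')}$, where $\tilde1_{(1)}\otimes\tilde1_{(2)}=\tilde1_{(1')}\otimes\tilde1_{(2')}=\tilde\Delta(1_A\#1_H)$. Structure of $B=A\otimes H\otimes A^*$: product $(a\otimes h\otimes a^* )(b\otimes g\otimes b^* )=\langle b^*,a\rangle b\otimes hg\otimes a^*$, unit $x^1\otimes1_H\otimes(x^2\rightharpoonup\alpha_A)$, $\Delta_B(a\otimes h\otimes a^* )=((R_1^2\cdot x^1)a\otimes R_2^1h_{(1)}R_1^1\otimes a^*_{(2)})\otimes(x^2\otimes h_{(2)}\otimes a^*_{(1)}\vartriangleleft R_2^2)$, $\varepsilon_B(a\otimes h\otimes a^* )=\langle\alpha_A,a\rangle\varepsilon(h)\langle a^*,1_A\rangle$, $S_B(a\otimes h\otimes a^* )=\langle a^*\vartriangleleft R_2^2,x^1\rangle x^2\otimes R_1^1S(R_2^1h)\otimes\alpha_A\leftharpoonup(R_1^2\cdot a)$, $R_B=((R_3^2\cdot x_2^1)x_1^1\otimes R_2^1R_3^1\otimes\alpha_{A(1)}\vartriangleleft R_1^2)\otimes(x_2^2\otimes R_1^1R_2^2\otimes(x_1^2\rightharpoonup\alpha_{A(2)}))$.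 A map of quasi-triangular weak Hopf algebras is a linear map compatible with products, units, coproducts, counits and antipodes and carrying the R-matrix of the source to that of the target: $(\varphi\otimes\varphi)(\mathcal R)=R_B$. *)

(* Defs.v *)
From HB Require Import structures.
From mathcomp Require Import all_boot all_algebra all_field.

Set Implicit Arguments.
Unset Strict Implicit.
Unset Printing Implicit Defensive.

Import GRing.Theory.
Local Open Scope ring_scope.

(* Tensor products of finite-dimensional spaces are modelled by coordinate
   matrices with respect to the library bases [vbasis].  The model is hidden
   behind a new constant, so that the matrix product (available when the two
   dimensions agree) cannot be confused with a tensor operation. *)

Section Tensor.
Variables (k : fieldType) (U V : vectType k).

Definition tensor := 'M[k]_(\dim {:U}, \dim {:V}).

HB.instance Definition _ := Vector.copy tensor 'M[k]_(\dim {:U}, \dim {:V}).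

Definition tens (u : U) (v : V) : tensor :=
  \matrix_(i, j) (coord (vbasis {:U}) i u * coord (vbasis {:V}) j v).

(* The linear map induced by [f] when [f] is bilinear (see [tliftE]); when it is
   not, [tlift f] only remembers the values of [f] on basis vectors. *)
Definition tlift (W : lmodType k) (f : U -> V -> W) (t : tensor) : W :=
  \sum_i \sum_j t i j *: f (vbasis {:U})`_i (vbasis {:V})`_j.

Lemma tlift_is_linear (W : lmodType k) (f : U -> V -> W) : linear (tlift f).
Proof.
move=> c s t; rewrite /tlift scaler_sumr -big_split; apply: eq_bigr => i _ /=.
rewrite scaler_sumr -big_split; apply: eq_bigr => j _ /=.
by rewrite !mxE scalerDl scalerA.
Qed.

HB.instance Definition _ (W : lmodType k) (f : U -> V -> W) :=
  GRing.isLinear.Build k tensor W *:%R (tlift f) (tlift_is_linear f).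

Lemma tens_linearl v : linear (tens^~ v).
Proof.
by move=> c u u'; apply/matrixP => i j; rewrite !mxE linearP /= mulrDl mulrA.
Qed.

Lemma tens_linearr u : linear (tens u).
Proof.
move=> c v v'; apply/matrixP => i j; rewrite !mxE linearP /= mulrDr.
by rewrite !mulrA [_ * c]mulrC.
Qed.

Lemma tliftE (W : lmodType k) (f : U -> V -> W) (u : U) (v : V) :
  (forall v, linear (f^~ v)) -> (forall u, linear (f u)) ->
  tlift f (tens u v) = f u v.
Proof.
move=> fl fr.
pose fl' v0 := GRing.isLinear.Build k U W *:%R (f^~ v0) (fl v0).
pose fr' u0 := GRing.isLinear.Build k V W *:%R (f u0) (fr u0).
pose L v0 : {linear U -> W} := HB.pack (f^~ v0) (fl' v0).
pose M u0 : {linear V -> W} := HB.pack (f u0) (fr' u0).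
have eL v0 u0 : f u0 v0 = L v0 u0 by [].
have eM v0 u0 : f u0 v0 = M u0 v0 by [].
rewrite [in RHS](coord_vbasis (memvf u)) eL linear_sum.
apply: eq_bigr => i _; rewrite linearZ -eL.
have -> : f (vbasis {:U})`_i v = \sum_j coord (vbasis {:V}) j v *:
    f (vbasis {:U})`_i (vbasis {:V})`_j.
  rewrite {1}(coord_vbasis (memvf v)) eM linear_sum.
  by apply: eq_bigr => j _; rewrite linearZ.
rewrite /= scaler_sumr.
by apply: eq_bigr => j _; rewrite mxE scalerA.
Qed.

Lemma tensor_basis (t : tensor) :
  t = \sum_i \sum_j t i j *: tens (vbasis {:U})`_i (vbasis {:V})`_j.
Proof.
have cE (X : vectType k) (i j : 'I_(\dim {:X})) :
    coord (vbasis {:X}) i (vbasis {:X})`_j = (i == j)%:R.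
  by rewrite coord_free ?(basis_free (vbasisP _)) // eq_sym.
apply/matrixP => i j; rewrite summxE (bigD1 i) //= summxE (bigD1 j) //=.
rewrite !mxE !cE !eqxx !mulr1 !big1 ?addr0 // => [i' ne|j' ne].
  rewrite summxE big1 // => j' _.
  by rewrite !mxE !cE [i == i']eq_sym (negbTE ne) mul0r mulr0.
by rewrite !mxE !cE [j == j']eq_sym (negbTE ne) !mulr0.
Qed.

End Tensor.

Notation "u \ox v" := (tens u v)
  (at level 45, right associativity) : ring_scope.

(* Sweedler-style evaluation: [\sw_(a, b <- t) E] is the value at [t] of the
   linear map induced by the bilinear expression E in a and b. *)
Notation "\sw_ ( a , b <- t ) E" := (tlift (fun a b => E) t)
  (at level 41, a name, b name, t at level 50, E at level 41,
   format "\sw_ ( a ,  b  <-  t )  E") : ring_scope.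

Section TensorOps.
Variable k : fieldType.

Definition tswap (U V : vectType k) (t : tensor U V) : tensor V U :=
  \sw_(u, v <- t) (v \ox u).

Definition tmap (U V U' V' : vectType k) (f : U -> U') (g : V -> V')
    (t : tensor U V) : tensor U' V' :=
  \sw_(u, v <- t) (f u \ox g v).

Definition tmul (A B : falgType k) (s t : tensor A B) : tensor A B :=
  \sw_(a, b <- s) \sw_(c, d <- t) (a * c \ox b * d).

(* X (x) Y as a subspace of U (x) V. *)
Definition tensv (U V : vectType k) (X : {vspace U}) (Y : {vspace V}) :
    {vspace tensor U V} :=
  <<[seq (u : U) \ox (v : V) | u <- vbasis X, v <- vbasis Y]>>%VS.

End TensorOps.

Section Hopf.
Variable k : fieldType.

(* Semisimple Hopf algebras and strongly separable algebras are automatically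
   finite-dimensional, so algebras are taken in [falgType]. *)
Record hopf_algebra (H : falgType k) := HopfAlgebra {
  comul : 'Hom(H, tensor H H);
  counit : 'Hom(H, k^o);
  antipode : 'End(H);
  comulA : forall h,
    \sw_(h1, h2 <- comul h) \sw_(h11, h12 <- comul h1) (h11 \ox h12 \ox h2) =
    \sw_(h1, h2 <- comul h) \sw_(h21, h22 <- comul h2) (h1 \ox h21 \ox h22);
  counitl : forall h, \sw_(h1, h2 <- comul h) (counit h1 *: h2) = h;
  counitr : forall h, \sw_(h1, h2 <- comul h) (counit h2 *: h1) = h;
  comulM : forall h g, comul (h * g) = tmul (comul h) (comul g);
  comul1 : comul 1 = 1 \ox 1;
  counitM : forall h g, counit (h * g) = (counit h : k) * counit g;
  counit1 : counit 1 = 1;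
  antipodel : forall h,
    \sw_(h1, h2 <- comul h) (antipode h1 * h2) = counit h *: 1;
  antipoder : forall h,
    \sw_(h1, h2 <- comul h) (h1 * antipode h2) = counit h *: 1
}.

Definition left_ideal (H : falgType k) (I : {vspace H}) : Prop :=
  forall h a, a \in I -> h * a \in I.

(* The left regular module is semisimple: every submodule is a direct summand. *)
Definition semisimple (H : falgType k) : Prop :=
  forall I : {vspace H}, left_ideal I ->
  exists J : {vspace H},
    [/\ left_ideal J, (I + J)%VS = {:H}%VS & (I :&: J)%VS = 0%VS].

Record quasitriangular (H : falgType k) (HH : hopf_algebra H) (R : tensor H H) :
    Prop := Quasitriangular {
  qt_inv : exists R', tmul R R' = 1 \ox 1 /\ tmul R' R = 1 \ox 1;
  qt_comm : forall h,
    \sw_(r1, r2 <- R) \sw_(h1, h2 <- comul HH h) (r1 * h1 \ox r2 * h2) =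
    \sw_(r1, r2 <- R) \sw_(h1, h2 <- comul HH h) (h2 * r1 \ox h1 * r2);
  qt_comull :
    \sw_(r1, r2 <- R) \sw_(r11, r12 <- comul HH r1) (r11 \ox r12 \ox r2) =
    \sw_(r1, r2 <- R) \sw_(s1, s2 <- R) (r1 \ox s1 \ox r2 * s2);
  qt_comulr :
    \sw_(r1, r2 <- R) \sw_(r21, r22 <- comul HH r2) (r1 \ox r21 \ox r22) =
    \sw_(r1, r2 <- R) \sw_(s1, s2 <- R) (r1 * s1 \ox s2 \ox r2)
}.

Record module_algebra (H : falgType k) (HH : hopf_algebra H) (A : falgType k) :=
    ModuleAlgebra {
  act : 'Hom(H, 'End(A));
  act1 : forall a, act 1 a = a;
  actM : forall h g a, act (h * g) a = act h (act g a);
  act_mul : forall h a b,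
    act h (a * b) = \sw_(h1, h2 <- comul HH h) (act h1 a * act h2 b);
  act_one : forall h, act h 1 = counit HH h *: 1
}.

Definition quantum_commutative (H : falgType k) (HH : hopf_algebra H)
    (R : tensor H H) (A : falgType k) (MA : module_algebra HH A) : Prop :=
  forall a b : A, a * b = \sw_(r1, r2 <- R) (act MA r2 b * act MA r1 a).

Record symmetric_separability_idempotent (A : falgType k) (x : tensor A A) :
    Prop := SymmetricSeparabilityIdempotent {
  sepA : forall a,
    \sw_(x1, x2 <- x) (a * x1 \ox x2) = \sw_(x1, x2 <- x) (x1 \ox x2 * a);
  sep1 : \sw_(x1, x2 <- x) (x1 * x2) = 1;
  sepC : tswap x = x
}.

Definition in_mueger_center (H : falgType k) (HH : hopf_algebra H)
    (R : tensor H H) (A : falgType k) (MA : module_algebra HH A) : Prop :=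
  forall a : A,
    \sw_(r11, r12 <- R) \sw_(r21, r22 <- R)
      (act MA (r22 * r11) a \ox r21 * r12) = a \ox (1 : H).

(* Structure maps of a quasi-triangular weak Hopf algebra. *)
Record qtwh_data (V : vectType k) := QtwhData {
  wmul : V -> V -> V;
  wone : V;
  wcomul : V -> tensor V V;
  wcounit : V -> k;
  wanti : V -> V;
  wR : tensor V V
}.

Record qtwh_map (V W : vectType k) (DV : qtwh_data V) (DW : qtwh_data W)
    (f : 'Hom(V, W)) : Prop := QtwhMap {
  qtwh_mapM : forall u v, f (wmul DV u v) = wmul DW (f u) (f v);
  qtwh_map1 : f (wone DV) = wone DW;
  qtwh_map_comul : forall u, wcomul DW (f u) = tmap f f (wcomul DV u);
  qtwh_map_counit : forall u, wcounit DW (f u) = wcounit DV u;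
  qtwh_map_anti : forall u, f (wanti DV u) = wanti DW (f u);
  qtwh_mapR : tmap f f (wR DV) = wR DW
}.

End Hopf.

Section Dual.
Variables (k : fieldType) (A : falgType k).

Local Notation dualA := 'Hom(A, k^o).
Local Notation "⟨ f , a ⟩" := ((f : 'Hom(A, k^o)) (a : A) : k).

(* <a -> f, b> = <f, ba> *)
Definition hitl (a : A) (f : dualA) : dualA := (f \o amulr a)%VF.

(* <f <- a, b> = <f, ab> *)
Definition hitr (f : dualA) (a : A) : dualA := (f \o amull a)%VF.

Definition dual_vbasis (i : 'I_(\dim {:A})) : dualA :=
  linfun (coord (vbasis {:A}) i : A -> k^o).

(* Coordinates of the coproduct of A^* dual to the product of A; it is
   characterised by [dcomulP]. *)
Definition dcomul (f : dualA) : tensor dualA dualA :=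
  \sum_(i < \dim {:A}) \sum_(j < \dim {:A}) f ((vbasis {:A})`_i * (vbasis {:A})`_j) *:
    (dual_vbasis i \ox dual_vbasis j).

Lemma dcomulP (f : dualA) (a b : A) :
  \sw_(f1, f2 <- dcomul f) (⟨f1, a⟩ * ⟨f2, b⟩ : k^o) = ⟨f, a * b⟩.
Proof.
rewrite /dcomul [LHS]linear_sum /=.
rewrite {2}(coord_vbasis (memvf a)) mulr_suml linear_sum.
apply: eq_bigr => i _ /=; rewrite -scalerAl linearZ linear_sum /=.
rewrite {2}(coord_vbasis (memvf b)) mulr_sumr linear_sum scaler_sumr.
apply: eq_bigr => j _ /=; rewrite -scalerAr !linearZ /= tliftE.
- by rewrite !lfunE /= [LHS]mulrC -mulrA [RHS]mulrCA.
- by move=> v c u u' /=; rewrite !lfunE /= !lfunE /= mulrDl -mulrA.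
- by move=> v c u u' /=; rewrite !lfunE /= !lfunE /= mulrDr mulrCA.
Qed.

Lemma hitlE a f b : hitl a f b = f (b * a).
Proof. by rewrite /hitl comp_lfunE lfunE. Qed.

Lemma hitrE a f b : hitr f a b = f (a * b).
Proof. by rewrite /hitr comp_lfunE lfunE. Qed.

(* <f <| h, b> = <f, h . b> *)
Definition dact (H : falgType k) (HH : hopf_algebra H) (MA : module_algebra HH A)
    (f : dualA) (h : H) : dualA := (f \o act MA h)%VF.

End Dual.

Section Constructions.
Variables (k : fieldType) (H : falgType k) (HH : hopf_algebra H) (R : tensor H H).
Variables (A : falgType k) (MA : module_algebra HH A).
Variables (x : tensor A A) (alpha : 'Hom(A, k^o)).

Local Notation "h · a" := (act MA h a) (at level 38, right associativity).
Local Notation S := (antipode HH).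
Local Notation D := (comul HH).
Local Notation "f ◁ h" := (dact MA f h) (at level 39, left associativity).

Local Notation "⟨ f , a ⟩" := ((f : 'Hom(A, k^o)) (a : A) : k).

Definition smash_space := tensor A H.

Definition smash_mul (u v : smash_space) : smash_space :=
  \sw_(a, h <- u) \sw_(b, g <- v) \sw_(h1, h2 <- D h)
    (a * (h1 · b) \ox h2 * g).

Definition smash_one : smash_space := 1 \ox 1.

Definition smash_comul (u : smash_space) : tensor smash_space smash_space :=
  \sw_(a, h <- u) \sw_(h1, h2 <- D h) \sw_(r1, r2 <- R) \sw_(x1, x2 <- x)
    ((a * (r2 · x1) \ox r1 * h1) \ox (x2 \ox h2)).

Definition smash_counit (u : smash_space) : k^o :=
  \sw_(a, h <- u) (⟨alpha, a⟩ * counit HH h : k^o).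

Definition smash_antipode (u : smash_space) : smash_space :=
  \sw_(a, h <- u) \sw_(r1, r2 <- R) smash_mul (1 \ox S h) (r2 · a \ox r1).

Definition smash_R : tensor smash_space smash_space :=
  \sw_(e1, e2 <- smash_comul smash_one) \sw_(e1', e2' <- smash_comul smash_one)
  \sw_(r1, r2 <- R)
    (smash_mul (smash_mul e2 (1 \ox r1)) e1' \ox
     smash_mul (smash_mul e1 (1 \ox r2)) e2').

Definition smash : qtwh_data smash_space :=
  QtwhData smash_mul smash_one smash_comul smash_counit smash_antipode smash_R.

Definition B_space := tensor A (tensor H 'Hom(A, k^o)).

Definition B_mul (u v : B_space) : B_space :=
  \sw_(a, t <- u) \sw_(h, f <- t) \sw_(b, s <- v) \sw_(g, f' <- s)
    (⟨f', a⟩ *: (b \ox h * g \ox f)).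

Definition B_one : B_space :=
  \sw_(x1, x2 <- x) (x1 \ox 1 \ox hitl x2 alpha).

Definition B_comul (u : B_space) : tensor B_space B_space :=
  \sw_(a, t <- u) \sw_(h, f <- t)
  \sw_(h1, h2 <- D h) \sw_(f1, f2 <- dcomul f) \sw_(x1, x2 <- x)
  \sw_(r11, r12 <- R) \sw_(r21, r22 <- R)
    (((r12 · x1) * a \ox r21 * h1 * r11 \ox f2) \ox (x2 \ox h2 \ox f1 ◁ r22)).

Definition B_counit (u : B_space) : k^o :=
  \sw_(a, t <- u) \sw_(h, f <- t) (⟨alpha, a⟩ * counit HH h * ⟨f, 1⟩ : k^o).

Definition B_antipode (u : B_space) : B_space :=
  \sw_(a, t <- u) \sw_(h, f <- t) \sw_(x1, x2 <- x)
  \sw_(r11, r12 <- R) \sw_(r21, r22 <- R)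
    (⟨f ◁ r22, x1⟩ *: (x2 \ox r11 * S (r21 * h) \ox hitr alpha (r12 · a))).

Definition B_R : tensor B_space B_space :=
  \sw_(x11, x12 <- x) \sw_(x21, x22 <- x) \sw_(al1, al2 <- dcomul alpha)
  \sw_(r11, r12 <- R) \sw_(r21, r22 <- R) \sw_(r31, r32 <- R)
    (((r32 · x21) * x11 \ox r21 * r31 \ox al1 ◁ r12) \ox
     (x22 \ox r11 * r22 \ox hitl x12 al2)).

Definition B_algebra : qtwh_data B_space :=
  QtwhData B_mul B_one B_comul B_counit B_antipode B_R.

Definition phi : 'Hom(smash_space, B_space) :=
  linfun (tlift (fun a h => \sw_(h1, h2 <- D h) \sw_(x1, x2 <- x)
    (S h1 · (x1 * a) \ox h2 \ox hitl x2 alpha))).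

End Constructions.

(* Main.v *)
From HB Require Import structures.
Require Import Defs.
From mathcomp Require Import all_boot all_algebra all_field zify.

Set Implicit Arguments.
Unset Strict Implicit.
Unset Printing Implicit Defensive.

Import GRing.Theory.
Local Open Scope ring_scope.

(** An element a (x) h (x) f of B is read as the linear map c |-> f(c) (a (x) h)
from A to A (x) H, and a tensor in B (x) B as a map of two arguments. This
reading is faithful, so that every identity in B becomes an identity in A (x) H
with free parameters c, e in A. In these terms phi(a # h) is the map
c |-> S(h_1).(c a) (x) h_2, the product of B is composition in the A-leg and
multiplication in the H-leg, and R_B is the map
(c, e) |-> ((R3^2.x^1)(R1^2.c)e (x) R2^1 R3^1) (x) (x^2 (x) R1^1 R2^2).

The value of phi(u) at c is determined by its value at 1: it is obtained by
multiplying the A-leg by S(h_1).c, where h is the H-leg (lemma psi_1). If R_B lies in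
Im phi (x) Im phi, its first argument obeys this rule. Comparing
R_B(c, 1) with what the rule derives from R_B(1, 1), and contracting the legs that
do not matter with alpha and the counit, gives (R^2.c) (x) R^1 = (S(R^1).c) (x) R^2,
a form of the condition defining the Mueger center (mueger_of_mem).

For the converse it is enough that phi transports the R-matrix of A # H to R_B, and
this is part of the claim that phi is a map of quasi-triangular weak Hopf algebras.
All the compatibilities rest on two facts: S^2 acts as the identity on A, and
alpha is H-invariant (SS_act, alphaH). The form alpha is the trace of left
multiplication, so alpha(h.a) is the trace of b |-> a (S(h_2)h_1.b). If S(s_2)s_1 =
eps(s) for every s in the right leg H_r of R, then alpha(R^2.F(R^1)) = alpha(F(1)) for
linear F, and quantum commutativity alpha(ab) = alpha((R^2.b)(R^1.a)) turns into
alpha(ba) = alpha(b (u.a)) with u = S(R^2)R^1 the Drinfeld element. Hence u acts as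
the identity, and S^2(h)u = uh forces S^2 = 1 on A; invariance of alpha follows.

It remains to show that S^2 is the identity on H_r, the span of all f(R^1)R^2.
This is a Hopf subalgebra of H, and the Larson-Radford theorem gives S^2 = 1 in
characteristic zero as soon as a Hopf algebra has an integral L with eps(L) = 1 and an
integral of the dual with value 1 at 1 (antipode_involutive). Such an integral in the
dual of H_r is the pairing through R with an integral of the left leg H_l. So both
follow once every Hopf subalgebra K of a semisimple H has a normalised integral
(subhopf_integral). To see this, take a K-linear retraction of H onto K, and let 1 - F be
its composite with the inclusion, where F has rank < dim H. On the j-th tensor power of H
the map F (x) ... (x) F has relatively small rank, while it still differs from the identity by a
map that factors K-linearly through an induced module. For large j there is a vector
killed by F after averaging over an integral of H, and on that vector the averaging
factors through K and produces an integral of K.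

With S^2 = 1 on A at hand, the key identity is S(R^1).(p (R^2.b)) = b p (S_act_mul).
It reduces the product, coproduct, antipode and R-matrix of phi(a # h) to the
formulas of B by Sweedler calculus. The Mueger condition enters only in the
comparison of the R-matrices (phi_R). *)

(** * Linear maps on tensors and Sweedler sums *)

Section Lin.
Variable k : fieldType.

Lemma lin_comp (U V W : lmodType k) (f : V -> W) (g : U -> V) :
  linear f -> linear g -> linear (fun x => f (g x)).
Proof. by move=> lf lg c u v /=; rewrite lg lf. Qed.

Lemma lin_id (U : lmodType k) : linear (fun x : U => x).
Proof. by []. Qed.

Lemma lin_lfun (U V : vectType k) (f : 'Hom(U, V)) : linear f.
Proof. exact: linearP. Qed.

Lemma lin_tliftf (X : lmodType k) (U V : vectType k) (W : lmodType k) (F : X -> U -> V -> W) t :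
  (forall a b, linear (fun x => F x a b)) -> linear (fun x => tlift (F x) t).
Proof.
move=> lF c x y; rewrite /tlift scaler_sumr -big_split; apply: eq_bigr => i _ /=.
rewrite scaler_sumr -big_split; apply: eq_bigr => j _ /=.
by rewrite lF scalerDr !scalerA mulrC.
Qed.

Lemma lin_tlift (U V : vectType k) (W : lmodType k) (F : U -> V -> W) :
  linear (tlift F).
Proof. exact: linearP. Qed.

Lemma lin0 (U V : lmodType k) (f : U -> V) : linear f -> f 0 = 0.
Proof.
move=> lf; have := lf 0 0 0; rewrite !scale0r !add0r => e.
have := lf 1 0 0; rewrite !scale1r addr0 => /eqP.
by rewrite -subr_eq0 opprD addNKr oppr_eq0 => /eqP.
Qed.

Lemma linZ (U V : lmodType k) (f : U -> V) c x : linear f -> f (c *: x) = c *: f x.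
Proof. by move=> lf; rewrite -[c *: x]addr0 lf (lin0 lf) addr0. Qed.

Lemma linD (U V : lmodType k) (f : U -> V) x y : linear f -> f (x + y) = f x + f y.
Proof. by move=> lf; have := lf 1 x y; rewrite !scale1r. Qed.

Lemma linN (U V : lmodType k) (f : U -> V) x : linear f -> f (- x) = - f x.
Proof. by move=> lf; rewrite -scaleN1r linZ // scaleN1r. Qed.

Lemma linB (U V : lmodType k) (f : U -> V) x y : linear f -> f (x - y) = f x - f y.
Proof. by move=> lf; rewrite linD // linN. Qed.

Lemma linS (U V : lmodType k) (f : U -> V) (I : finType) (F : I -> U) :
  linear f -> f (\sum_i F i) = \sum_i f (F i).
Proof.
move=> lf; apply: (big_morph f) => [x y|]; [exact: linD | exact: lin0].
Qed.

Lemma lin_tens_l (U V : vectType k) (v : V) : linear (fun u : U => u \ox v).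
Proof. exact: tens_linearl. Qed.
Lemma lin_tens_r (U V : vectType k) (u : U) : linear (fun v : V => u \ox v).
Proof. exact: tens_linearr. Qed.

Lemma lin_mul_l (A : lalgType k) (a : A) : linear (fun x : A => x * a).
Proof. by move=> c u v; rewrite mulrDl scalerAl. Qed.
Lemma lin_mul_r (A : algType k) (a : A) : linear (fun x : A => a * x).
Proof. by move=> c u v; rewrite mulrDr scalerAr. Qed.

Lemma lin_smul_l (a : k) : linear (fun x : k^o => (x * a : k^o)).
Proof. by move=> c u v; rewrite mulrDl; congr (_ + _); rewrite /GRing.scale /= mulrA. Qed.
Lemma lin_smul_r (a : k) : linear (fun x : k^o => (a * x : k^o)).
Proof. by move=> c u v; rewrite mulrDr; congr (_ + _); rewrite /GRing.scale /= mulrCA. Qed.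

Lemma lin_scale_r (U : lmodType k) (c : k) : linear (fun x : U => c *: x).
Proof. by move=> d u v; rewrite scalerDr !scalerA mulrC. Qed.

Lemma lin_add (U V : lmodType k) (f g : U -> V) :
  linear f -> linear g -> linear (fun x => f x + g x).
Proof. by move=> lf lg c u v; rewrite lf lg scalerDr addrACA. Qed.
Lemma lin_opp (U V : lmodType k) (f : U -> V) :
  linear f -> linear (fun x => - f x).
Proof. by move=> lf c u v; rewrite lf opprD scalerN. Qed.

Lemma lin_sum (U V : lmodType k) (I : finType) (f : I -> U -> V) :
  (forall i, linear (f i)) -> linear (fun x => \sum_i f i x).
Proof.
move=> lf c u v; rewrite scaler_sumr -big_split.
by apply: eq_bigr => i _; rewrite lf.
Qed.

Lemma lin_app_l (V W : vectType k) (a : V) : linear (fun f : 'Hom(V, W) => f a).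
Proof. by move=> c f g; rewrite add_lfunE scale_lfunE. Qed.

Lemma lin_scale_comp (X U : lmodType k) (t : X -> k^o) (b : U) :
  linear t -> linear (fun x => (t x : k) *: b).
Proof. by move=> lt c u v; rewrite lt scalerDl -scalerA. Qed.
Lemma lin_smul_compl (X : lmodType k) (t : X -> k^o) (b : k) :
  linear t -> linear (fun x => (t x * b : k^o)).
Proof. by move=> lt; apply: (lin_comp (lin_smul_l b) lt). Qed.
Lemma lin_smul_compr (X : lmodType k) (t : X -> k^o) (b : k) :
  linear t -> linear (fun x => (b * t x : k^o)).
Proof. by move=> lt; apply: (lin_comp (lin_smul_r b) lt). Qed.

End Lin.

Create HintDb lin.
Ltac lin_hyp := cbv beta; solve [assumption | match goal with L : _ |- _ => apply L end | auto 1 with lin nocore].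
Ltac lin_var :=
  lazymatch goal with
  | |- linear (fun x => ?F (@?a x) (@?b x) (@?c x) (@?d x)) => is_var F;
      first
      [ lazymatch b with (fun _ => ?b0) => lazymatch c with (fun _ => ?c0) =>
        lazymatch d with (fun _ => ?d0) =>
          refine (@lin_comp _ _ _ _ (fun z => F z b0 c0 d0) a _ _); [lin_hyp | ] end end end
      | lazymatch a with (fun _ => ?a0) => lazymatch c with (fun _ => ?c0) =>
        lazymatch d with (fun _ => ?d0) =>
          refine (@lin_comp _ _ _ _ (fun z => F a0 z c0 d0) b _ _); [lin_hyp | ] end end end
      | lazymatch a with (fun _ => ?a0) => lazymatch b with (fun _ => ?b0) =>
        lazymatch d with (fun _ => ?d0) =>
          refine (@lin_comp _ _ _ _ (fun z => F a0 b0 z d0) c _ _); [lin_hyp | ] end end end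
      | lazymatch a with (fun _ => ?a0) => lazymatch b with (fun _ => ?b0) =>
        lazymatch c with (fun _ => ?c0) =>
          refine (@lin_comp _ _ _ _ (fun z => F a0 b0 c0 z) d _ _); [lin_hyp | ] end end end ]
  | |- linear (fun x => ?F (@?a x) (@?b x) (@?c x)) => is_var F;
      first
      [ lazymatch b with (fun _ => ?b0) => lazymatch c with (fun _ => ?c0) =>
          refine (@lin_comp _ _ _ _ (fun z => F z b0 c0) a _ _); [lin_hyp | ] end end
      | lazymatch a with (fun _ => ?a0) => lazymatch c with (fun _ => ?c0) =>
          refine (@lin_comp _ _ _ _ (fun z => F a0 z c0) b _ _); [lin_hyp | ] end end
      | lazymatch a with (fun _ => ?a0) => lazymatch b with (fun _ => ?b0) =>
          refine (@lin_comp _ _ _ _ (fun z => F a0 b0 z) c _ _); [lin_hyp | ] end end ]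
  | |- linear (fun x => ?F (@?a x) (@?b x)) => is_var F;
      first
      [ lazymatch b with (fun _ => ?b0) =>
          refine (@lin_comp _ _ _ _ (fun z => F z b0) a _ _); [lin_hyp | ] end
      | lazymatch a with (fun _ => ?a0) =>
          refine (@lin_comp _ _ _ _ (fun z => F a0 z) b _ _); [lin_hyp | ] end ]
  | |- linear (fun x => ?F (@?a x)) => is_var F;
      refine (@lin_comp _ _ _ _ (fun z => F z) a _ _); [lin_hyp | ]
  end.

Ltac lin_gen :=
  lazymatch goal with
  | |- linear (fun x => ?F (@?a x) (@?b x)) =>
      first
      [ lazymatch b with (fun _ => ?b0) =>
          refine (@lin_comp _ _ _ _ (fun z => F z b0) a _ _); [lin_hyp | ] end
      | lazymatch a with (fun _ => ?a0) =>
          refine (@lin_comp _ _ _ _ (fun z => F a0 z) b _ _); [lin_hyp | ] end ]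
  end.

Ltac lin1 :=
  lazymatch goal with
  | |- forall _, _ => intro; cbv beta
  | |- linear _ => cbv beta;
    first
    [ apply lin_id
    | lazymatch goal with |- linear (fun x => x) => intros ? ? ?; reflexivity end
    | assumption
    | apply lin_tlift | apply lin_lfun | apply lin_tens_r
    | lazymatch goal with
      | |- linear (fun x => tlift (@?F x) (@?t x)) =>
          first
          [ lazymatch t with (fun _ => ?t0) =>
              refine (@lin_tliftf _ _ _ _ _ F t0 _) end
          | lazymatch F with (fun _ => ?F0) =>
              refine (@lin_comp _ _ _ _ (tlift F0) t (@lin_tlift _ _ _ _ F0) _) end ]
      | |- linear (fun x => @tens ?k ?U ?V (@?t x) (@?s x)) =>
          first
          [ lazymatch s with (fun _ => ?b) =>
              refine (@lin_comp _ _ _ _ _ t (@lin_tens_l k U V b) _) end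
          | lazymatch t with (fun _ => ?a) =>
              refine (@lin_comp _ _ _ _ _ s (@lin_tens_r k U V a) _) end ]
      | |- linear (fun x => (@?t x) + (@?s x)) => refine (@lin_add _ _ _ t s _ _)
      | |- linear (fun x => - (@?t x)) => refine (@lin_opp _ _ _ t _)
      | |- linear (fun x => @GRing.mul _ (@?t x) (@?s x)) =>
          first
          [ lazymatch s with (fun _ => ?b) =>
            first [ refine (@lin_smul_compl _ _ t b _)
                  | refine (@lin_comp _ _ _ _ _ t (@lin_mul_l _ _ b) _) ] end
          | lazymatch t with (fun _ => ?a) =>
            first [ refine (@lin_smul_compr _ _ s a _)
                  | refine (@lin_comp _ _ _ _ _ s (@lin_mul_r _ _ a) _) ] end ]
      | |- linear (fun x => @GRing.scale _ _ (@?t x) (@?s x)) =>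
          first
          [ lazymatch s with (fun _ => ?b) =>
              refine (@lin_scale_comp _ _ _ t b _) end
          | lazymatch t with (fun _ => ?a) =>
              refine (@lin_comp _ _ _ _ _ s (@lin_scale_r _ _ a) _) end ]
      | |- linear (fun x => fun_of_lfun (@?f x) (@?t x)) =>
          first
          [ lazymatch f with (fun _ => ?f0) =>
              refine (@lin_comp _ _ _ _ _ t (@lin_lfun _ _ _ f0) _) end
          | lazymatch t with (fun _ => ?a) =>
              refine (@lin_comp _ _ _ _ _ f (@lin_app_l _ _ _ a) _) end ]
      end
    | lin_var
    | lin_hyp
    | lin_gen
    | lazymatch goal with |- linear (fun x => \sum_i _) => apply: lin_sum end
    | solve [eauto with lin]
    | match goal with
      | |- linear (fun x => ?f (@?t x)) =>
          refine (@lin_comp _ _ _ _ f t _ _);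
            [solve [apply: linearP | eauto with lin | assumption] | ]
      end ]
  end.
(** Proves that a Sweedler expression is linear in each of its free variables, by
following its syntax and using the linearity hypotheses in the context. *)
Ltac lin := repeat lin1; try assumption.

Section Lhom.
Variables (k : fieldType) (U V : vectType k) (f : U -> V) (lf : linear f).
Definition lhom : 'Hom(U, V) :=
  linfun (HB.pack f (GRing.isLinear.Build k U V *:%R f lf) : {linear U -> V}).
Lemma lhomE x : lhom x = f x. Proof. exact: lfunE. Qed.
End Lhom.

Section Tensor.
Variable k : fieldType.
Implicit Types (U V : vectType k) (W : lmodType k).

Lemma eq_tlift U V W (f g : U -> V -> W) t :
  (forall a b, f a b = g a b) -> tlift f t = tlift g t.
Proof.
by move=> e; rewrite /tlift; apply: eq_bigr => i _; apply: eq_bigr => j _; rewrite e.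
Qed.

(** The same for equations typed in k rather than in the regular module of k, which
are not syntactically interchangeable. *)
Lemma eq_tlifts U V (f g : U -> V -> k^o) t :
  (forall a b, f a b = g a b) -> tlift f t = tlift g t :> k.
Proof. exact: eq_tlift. Qed.

(** Every rule that moves an operation through a Sweedler sum is an instance of this. *)
Lemma tlift_push U V W (W' : lmodType k) (L : W -> W') (f : U -> V -> W) t :
  linear L -> L (tlift f t) = tlift (fun a b => L (f a b)) t.
Proof.
move=> lL; pose m := GRing.isLinear.Build k W W' *:%R L lL.
pose M : {linear W -> W'} := HB.pack L m.
have -> : L = M by [].
rewrite /tlift linear_sum; apply: eq_bigr => i _; rewrite linear_sum.
by apply: eq_bigr => j _; rewrite linearZ.
Qed.

Lemma tliftZ U V W c (f : U -> V -> W) t :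
  c *: tlift f t = tlift (fun a b => c *: f a b) t.
Proof. by apply: (tlift_push (L := fun z => c *: z)); lin. Qed.
Lemma tlift_mull U V (A : falgType k) (f : U -> V -> A) t y :
  tlift f t * y = tlift (fun a b => f a b * y) t.
Proof. by apply: (tlift_push (L := fun z => z * y)); lin. Qed.
Lemma tlift_mulr U V (A : falgType k) (f : U -> V -> A) t y :
  y * tlift f t = tlift (fun a b => y * f a b) t.
Proof. by apply: (tlift_push (L := fun z => y * z)); lin. Qed.
Lemma tlift_tensl U V (U' V' : vectType k) (f : U -> V -> U') t (y : V') :
  tlift f t \ox y = tlift (fun a b => f a b \ox y) t.
Proof. by apply: (tlift_push (L := fun z => z \ox y)); lin. Qed.
Lemma tlift_tensr U V (U' V' : vectType k) (f : U -> V -> U') t (y : V') :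
  y \ox tlift f t = tlift (fun a b => y \ox f a b) t.
Proof. by apply: (tlift_push (L := fun z => y \ox z)); lin. Qed.
Lemma tlift_lfun U V (U' V' : vectType k) (f : U -> V -> U') t (g : 'Hom(U', V')) :
  g (tlift f t) = tlift (fun a b => g (f a b)) t.
Proof. by apply: (tlift_push (L := fun z => g z)); lin. Qed.
Lemma tlift_lfunl U V (U' V' : vectType k) (f : U -> V -> 'Hom(U', V')) t y :
  tlift f t y = tlift (fun a b => f a b y) t.
Proof. by apply: (tlift_push (L := fun z : 'Hom(U', V') => z y)); lin. Qed.
Lemma tlift_tlift U V (U' V' : vectType k) W (f : U -> V -> tensor U' V')
    (F : U' -> V' -> W) t :
  tlift F (tlift f t) = tlift (fun a b => tlift F (f a b)) t.
Proof. by apply: (tlift_push (L := tlift F)); lin. Qed.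

Lemma tlift_sum U V W (I : finType) (f : I -> U -> V -> W) t :
  \sum_i tlift (f i) t = tlift (fun a b => \sum_i f i a b) t.
Proof.
rewrite /tlift exchange_big; apply: eq_bigr => i _; rewrite exchange_big.
by apply: eq_bigr => j _; rewrite scaler_sumr.
Qed.

Lemma tlift_sub U V W (f g : U -> V -> W) t :
  tlift (fun a b => f a b - g a b) t = tlift f t - tlift g t.
Proof.
rewrite /tlift -sumrB; apply: eq_bigr => i _; rewrite -sumrB.
by apply: eq_bigr => j _; rewrite scalerBr.
Qed.

Lemma tlift_add U V W (f g : U -> V -> W) t :
  tlift (fun a b => f a b + g a b) t = tlift f t + tlift g t.
Proof.
rewrite /tlift -big_split; apply: eq_bigr => i _; rewrite -big_split.
by apply: eq_bigr => j _; rewrite scalerDr.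
Qed.

(** Sweedler sums over independent tensors may be exchanged. *)
Lemma tliftC U V (U' V' : vectType k) W (F : U -> V -> U' -> V' -> W) s t :
  tlift (fun a b => tlift (F a b) t) s =
  tlift (fun c d => tlift (fun a b => F a b c d) s) t.
Proof.
have E (X Y : vectType k) (f : X -> Y -> W) u : tlift f u =
    \sum_p u p.1 p.2 *: f (vbasis {:X})`_p.1 (vbasis {:Y})`_p.2.
  by rewrite /tlift pair_big.
rewrite !E; under eq_bigr => p _ do rewrite E scaler_sumr.
under [RHS]eq_bigr => p _ do rewrite E scaler_sumr.
rewrite exchange_big /=; apply: eq_bigr => p _; apply: eq_bigr => q _.
by rewrite !scalerA mulrC.
Qed.

Lemma tlift_tens U V (t : tensor U V) : tlift (fun a b => a \ox b) t = t.
Proof. by rewrite [RHS]tensor_basis. Qed.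

Lemma tliftB U V W (f : U -> V -> W) u v :
  (forall v, linear (fun u => f u v)) -> (forall u, linear (f u)) ->
  tlift f (u \ox v) = f u v.
Proof. exact: tliftE. Qed.

(** Used to reduce identities on A # H and on B to pure tensors. *)
Lemma lin_tens_eq U V W (f g : tensor U V -> W) :
  linear f -> linear g -> (forall u v, f (u \ox v) = g (u \ox v)) ->
  forall t, f t = g t.
Proof.
move=> lf lg e t; rewrite -[t]tlift_tens (tlift_push _ _ lf) (tlift_push _ _ lg).
exact: eq_tlift.
Qed.

End Tensor.

(** * Hopf algebras in Sweedler form *)

(** Rewriting below n nested Sweedler sums: the first argument counts the sums that are kept
in front, and swC exchanges the next two. A computation is a chain of such moves
that brings the sums concerned by an identity next to each other. *)
Tactic Notation "sw" integer(n) "by" tactic3(tac) :=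
  etransitivity;
  [ do n (apply: eq_tlift; let a := fresh "p" in let b := fresh "q" in
          intros a b; cbv beta); tac
  | cbv beta].
Tactic Notation "sw0" "by" tactic3(tac) :=
  etransitivity; [ tac | cbv beta].
Ltac swC := first [apply tliftC | refine (tliftC _ _ _)].

Section Hopf.
Variables (k : fieldType) (H : falgType k) (HH : hopf_algebra H).
Implicit Types (h g : H) (W : lmodType k).
Local Notation S := (antipode HH).
Local Notation D := (comul HH).
Local Notation eps h := (counit HH h : k).

Lemma swA h W (F : H -> H -> H -> W) :
  (forall b c, linear (fun a => F a b c)) -> (forall a c, linear (fun b => F a b c)) ->
  (forall a b, linear (fun c => F a b c)) ->
  \sw_(a, b <- D h) \sw_(c, d <- D a) F c d b =
  \sw_(a, b <- D h) \sw_(c, d <- D b) F a c d.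
Proof.
move=> l1 l2 l3.
have e := congr1 (tlift (fun a t => tlift (F a) t)) (comulA HH h).
rewrite !(tlift_push _ _ (@lin_tlift _ _ _ _ _)) in e.
etransitivity; last (etransitivity; first exact: e).
  apply: eq_tlift => a b; rewrite (tlift_push _ _ (@lin_tlift _ _ _ _ _)).
  apply: eq_tlift => c d; rewrite !tliftB //; lin.
apply: eq_tlift => a b; rewrite (tlift_push _ _ (@lin_tlift _ _ _ _ _)).
apply: eq_tlift => c d; rewrite !tliftB //; lin.
Qed.

Lemma swM h g W (F : H -> H -> W) :
  (forall b, linear (fun a => F a b)) -> (forall a, linear (F a)) ->
  \sw_(a, b <- D (h * g)) F a b =
  \sw_(a, b <- D h) \sw_(c, d <- D g) F (a * c) (b * d).
Proof.
move=> l1 l2; rewrite comulM /tmul (tlift_push _ _ (@lin_tlift _ _ _ _ _)).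
apply: eq_tlift => a b; rewrite (tlift_push _ _ (@lin_tlift _ _ _ _ _)).
by apply: eq_tlift => c d; rewrite tliftB //; lin.
Qed.

Lemma sw1 W (F : H -> H -> W) :
  (forall b, linear (fun a => F a b)) -> (forall a, linear (F a)) ->
  \sw_(a, b <- D 1) F a b = F 1 1.
Proof. by move=> l1 l2; rewrite comul1 tliftB. Qed.

(** The summand is given up to a pointwise equation, so that a counit may sit
anywhere in it. The next three lemmas follow the same pattern. *)
Lemma sw_counitl h W (F : H -> W) f : linear F ->
  (forall a b, f a b = eps a *: F b) -> tlift f (D h) = F h.
Proof.
move=> lF e; rewrite (eq_tlift _ e) -[in RHS](counitl HH h) (tlift_push _ _ lF).
by apply: eq_tlift => a b; rewrite linZ.
Qed.

Lemma sw_counitr h W (F : H -> W) f : linear F ->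
  (forall a b, f a b = eps b *: F a) -> tlift f (D h) = F h.
Proof.
move=> lF e; rewrite (eq_tlift _ e) -[in RHS](counitr HH h) (tlift_push _ _ lF).
by apply: eq_tlift => a b; rewrite linZ.
Qed.

Lemma sw_antil h W (F : H -> W) f : linear F ->
  (forall a b, f a b = F (S a * b)) -> tlift f (D h) = eps h *: F 1.
Proof.
move=> lF e; rewrite (eq_tlift _ e) -linZ // -antipodel (tlift_push _ _ lF) //.
Qed.

Lemma sw_antir h W (F : H -> W) f : linear F ->
  (forall a b, f a b = F (a * S b)) -> tlift f (D h) = eps h *: F 1.
Proof.
move=> lF e; rewrite (eq_tlift _ e) -linZ // -antipoder (tlift_push _ _ lF) //.
Qed.


Arguments swA {h W F}.
Arguments swM h g {W} F.
Arguments sw1 {W} F.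
Arguments sw_counitl {h W F f}.
Arguments sw_counitr {h W F f}.
Arguments sw_antil {h W F f}.
Arguments sw_antir {h W F f}.

Lemma antipode1 : S 1 = 1.
Proof.
have := antipoder HH 1; rewrite comul1 tliftB; try by lin.
by rewrite mul1r counit1 scale1r.
Qed.

Lemma counit_antipode h : eps (S h) = eps h.
Proof.
transitivity (\sw_(a, b <- D h) (eps (S a * b) : k^o)).
  symmetry; apply: (sw_counitr (F := fun a => eps (S a) : k^o)); first by lin.
  by move=> a b; rewrite counitM mulrC.
rewrite (sw_antil (F := fun z => eps z : k^o)) //; last by lin.
by rewrite counit1 /GRing.scale /= mulr1.
Qed.

(** Both sides are values of the sum of S(h_1 g_1) h_2 g_2 S(g_3) S(h_3), contracted
from the right or from the left. *)
Lemma antipodeM h g : S (h * g) = S g * S h.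
Proof.
transitivity (\sw_(a, b <- D h) \sw_(c, d <- D g) \sw_(a1, a2 <- D a) \sw_(c1, c2 <- D c) 
   (S (a1 * c1) * (a2 * c2) * (S d * S b))).
  symmetry.
  sw 1 by swC.
  sw0 by (refine (swA _ _ _); lin).
  sw 2 by (refine (swA _ _ _); lin).
  transitivity (\sw_(a, b <- D h) \sw_(a1, b1 <- D b) \sw_(c, d <- D g)
    (eps d *: (S (a * c) * (a1 * S b1)))).
    sw 3 by (refine (sw_antir (F := fun z => S (p * p1) * (p0 * z * S q0)) _ _);
      [lin | move=> c d; rewrite !mulrA //]).
    by do 3 (apply: eq_tlift => ? ?); rewrite mulr1.
  sw 2 by (refine (sw_counitr (F := fun c => S (p * c) * (p0 * S q0)) _ _); [lin|by []]).
  sw 1 by (refine (sw_antir (F := fun z => S (p * g) * z) _ _); [lin|by []]).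
  refine (sw_counitr (F := fun z => S (z * g)) _ _); [lin|].
  by move=> a b; rewrite mulr1.
transitivity (\sw_(a, b <- D h) \sw_(c, d <- D g) (eps (a * c) *: (S d * S b))).
  apply: eq_tlift => a b; apply: eq_tlift => c d.
  rewrite -(swM a c (fun z w => S z * w * (S d * S b))); try by lin.
  rewrite (sw_antil (F := fun z => z * (S d * S b))) ?mul1r //; lin.
sw 1 by (refine (sw_counitl (F := fun d => eps p *: (S d * S q)) _ _); [lin|]).
  by move=> c d; rewrite counitM scalerA mulrC.
by refine (sw_counitl (F := fun b => S g * S b) _ _); [lin|].
Qed.

Lemma tmulE (A B : falgType k) (a c : A) (b d : B) :
  tmul (a \ox b) (c \ox d) = (a * c) \ox (b * d).
Proof. by rewrite /tmul !tliftB //; lin. Qed.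

Lemma lin_tmul_r (A B : falgType k) (s : tensor A B) : linear (tmul s).
Proof. rewrite /tmul; lin. Qed.

Lemma tmulA (A B : falgType k) (s t u : tensor A B) :
  tmul s (tmul t u) = tmul (tmul s t) u.
Proof.
move: u; apply: lin_tens_eq; first by rewrite /tmul; lin.
  by rewrite /tmul; lin.
move=> a b; move: t; apply: lin_tens_eq; first by rewrite /tmul; lin.
  by rewrite /tmul; lin.
move=> c d; move: s; apply: lin_tens_eq; first by rewrite /tmul; lin.
  by rewrite /tmul; lin.
by move=> e f; rewrite !tmulE !mulrA.
Qed.

Lemma tmul1l (A B : falgType k) (s : tensor A B) : tmul (1 \ox 1) s = s.
Proof.
move: s; apply: lin_tens_eq; [by rewrite /tmul; lin|by lin|].
by move=> e f; rewrite !tmulE !mul1r.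
Qed.
Lemma tmul1r (A B : falgType k) (s : tensor A B) : tmul s (1 \ox 1) = s.
Proof.
move: s; apply: lin_tens_eq; [by rewrite /tmul; lin|by lin|].
by move=> e f; rewrite !tmulE !mulr1.
Qed.

(** Uniqueness of convolution inverses: Delta o S and the flip of (S (x) S) o Delta
are both inverse to Delta. The auxiliary X is the convolution of the three. *)
Lemma swS h W (F : H -> H -> W) :
  (forall b, linear (fun a => F a b)) -> (forall a, linear (F a)) ->
  \sw_(a, b <- D (S h)) F a b = \sw_(a, b <- D h) F (S b) (S a).
Proof.
move=> l1 l2.
suff -> : D (S h) = \sw_(a, b <- D h) (S b \ox S a).
  rewrite (tlift_push _ _ (@lin_tlift _ _ _ _ _)); apply: eq_tlift => a b.
  by rewrite tliftB //; lin.
pose X := \sw_(a, b <- D h) \sw_(b1, b2 <- D b)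
  tmul (tmul (D (S a)) (D b1)) (\sw_(c, d <- D b2) (S d \ox S c)).
transitivity X; rewrite /X.
  transitivity (\sw_(a, b <- D h) (eps b *: D (S a))); last first.
    apply: eq_tlift => a b.
    transitivity (tmul (D (S a)) ((eps b : k) *: ((1 : H) \ox (1 : H)))).
      by rewrite linZ ?tmul1r //; rewrite /tmul; lin.
    suff e : (eps b : k) *: ((1 : H) \ox (1 : H)) = \sw_(b1, b2 <- D b)
       tmul (D b1) (\sw_(c, d <- D b2) (S d \ox S c)).
      rewrite e (tlift_push _ _ (@lin_tmul_r _ _ _)); apply: eq_tlift => b1 b2.
      by rewrite tmulA.
    symmetry.
    transitivity (\sw_(b1, b2 <- D b) \sw_(c, d <- D b2) \sw_(b3, b4 <- D b1)
      ((b3 * S d) \ox (b4 * S c))).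
      apply: eq_tlift => b1 b2.
      rewrite (tlift_push _ _ (@lin_tmul_r _ _ _)); apply: eq_tlift => c d.
      rewrite /tmul; apply: eq_tlift => b3 b4; rewrite tliftB //; lin.
    sw 1 by swC.
    sw0 by (refine (swA _ _ _); lin).
    sw 1 by (symmetry; refine (swA _ _ _); lin).
    sw 2 by (refine (sw_antir (F := fun z => (p * S q0) \ox z) _ _); [lin|by []]).
    sw 1 by (refine (sw_counitl (F := fun z => (p * S z) \ox 1) _ _); [lin|by []]).
    by refine (sw_antir (F := fun z => z \ox 1) _ _); [lin|].
  by symmetry; refine (sw_counitr (F := fun z => D (S z)) _ _); [lin|].
sw0 by (symmetry; refine (swA _ _ _); rewrite /tmul; lin).
transitivity (\sw_(a, b <- D h) (eps a *: \sw_(c, d <- D b) (S d \ox S c))).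
  apply: eq_tlift => a b.
  transitivity (\sw_(a1, a2 <- D a) tmul (D (S a1 * a2)) (\sw_(c, d <- D b) (S d \ox S c))).
    by apply: eq_tlift => a1 a2; rewrite comulM.
  rewrite (sw_antil (F := fun z => tmul (D z) (\sw_(c, d <- D b) (S d \ox S c)))) //.
    by rewrite comul1 tmul1l.
  by rewrite /tmul; lin.
by refine (sw_counitl (F := fun b => \sw_(c, d <- D b) (S d \ox S c)) _ _); [lin|].
Qed.
End Hopf.
Arguments swA {k H HH h W F}.
Arguments swM {k H} HH h g {W} F.
Arguments sw1 {k H} HH {W} F.
Arguments swS {k H} HH h {W} F.
Arguments sw_counitl {k H HH h W F f}.
Arguments sw_counitr {k H HH h W F f}.
Arguments sw_antil {k H HH h W F f}.
Arguments sw_antir {k H HH h W F f}.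

(** * Quasi-triangular structures and the Drinfeld element *)

Section QT.
Variables (k : fieldType) (H : falgType k) (HH : hopf_algebra H).
Variables (R : tensor H H) (qtR : quasitriangular HH R).
Implicit Types (h g : H) (W : lmodType k).
Local Notation S := (antipode HH).
Local Notation D := (comul HH).
Local Notation eps h := (counit HH h : k).

Lemma swR_comm h W (F : H -> H -> W) :
  (forall b, linear (fun a => F a b)) -> (forall a, linear (F a)) ->
  \sw_(r, s <- R) \sw_(a, b <- D h) F (r * a) (s * b) =
  \sw_(r, s <- R) \sw_(a, b <- D h) F (b * r) (a * s).
Proof.
move=> l1 l2; have e := congr1 (tlift F) (qt_comm qtR h).
rewrite !(tlift_push _ _ (@lin_tlift _ _ _ _ _)) in e.
etransitivity; last (etransitivity; first exact: e).
  apply: eq_tlift => a b; rewrite (tlift_push _ _ (@lin_tlift _ _ _ _ _)).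
  apply: eq_tlift => c d; rewrite !tliftB //; lin.
apply: eq_tlift => a b; rewrite (tlift_push _ _ (@lin_tlift _ _ _ _ _)).
apply: eq_tlift => c d; rewrite !tliftB //; lin.
Qed.

Lemma swRl W (F : H -> H -> H -> W) :
  (forall b c, linear (fun a => F a b c)) -> (forall a c, linear (fun b => F a b c)) ->
  (forall a b, linear (fun c => F a b c)) ->
  \sw_(r, s <- R) \sw_(a, b <- D r) F a b s =
  \sw_(r1, s1 <- R) \sw_(r2, s2 <- R) F r1 r2 (s1 * s2).
Proof.
move=> l1 l2 l3.
have e := congr1 (tlift (fun a t => tlift (F a) t)) (qt_comull qtR).
rewrite !(tlift_push _ _ (@lin_tlift _ _ _ _ _)) in e.
etransitivity; last (etransitivity; first exact: e).
  apply: eq_tlift => a b; rewrite (tlift_push _ _ (@lin_tlift _ _ _ _ _)).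
  apply: eq_tlift => c d; rewrite !tliftB //; lin.
apply: eq_tlift => a b; rewrite (tlift_push _ _ (@lin_tlift _ _ _ _ _)).
apply: eq_tlift => c d; rewrite !tliftB //; lin.
Qed.

Lemma swRr W (F : H -> H -> H -> W) :
  (forall b c, linear (fun a => F a b c)) -> (forall a c, linear (fun b => F a b c)) ->
  (forall a b, linear (fun c => F a b c)) ->
  \sw_(r, s <- R) \sw_(a, b <- D s) F r a b =
  \sw_(r1, s1 <- R) \sw_(r2, s2 <- R) F (r1 * r2) s2 s1.
Proof.
move=> l1 l2 l3.
have e := congr1 (tlift (fun a t => tlift (F a) t)) (qt_comulr qtR).
rewrite !(tlift_push _ _ (@lin_tlift _ _ _ _ _)) in e.
etransitivity; last (etransitivity; first exact: e).
  apply: eq_tlift => a b; rewrite (tlift_push _ _ (@lin_tlift _ _ _ _ _)).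
  apply: eq_tlift => c d; rewrite !tliftB //; lin.
apply: eq_tlift => a b; rewrite (tlift_push _ _ (@lin_tlift _ _ _ _ _)).
apply: eq_tlift => c d; rewrite !tliftB //; lin.
Qed.

(** The hexagon axioms only show that (eps (x) id)(R) and (id (x) eps)(R) fix R under
multiplication; invertibility of R makes them equal to 1. *)
Lemma Rcancel (t : tensor H H) : tmul t R = R -> t = 1 \ox 1.
Proof.
have [R' [RR' _]] := qt_inv qtR.
by move/(congr1 (fun z => tmul z R')); rewrite -tmulA RR' tmul1r.
Qed.

Lemma counitR_l : \sw_(r, s <- R) (eps r *: s) = 1.
Proof.
set e := tlift _ _.
have : tmul (1 \ox e) R = R.
  rewrite /e; transitivity (\sw_(r1, s1 <- R) \sw_(r2, s2 <- R) (eps r1 *: (r2 \ox (s1 * s2)))).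
    rewrite (tlift_push (L := fun z => tmul (1 \ox z) R)); last by rewrite /tmul; lin.
    apply: eq_tlift => r s; rewrite [LHS](linZ (f := fun z => tmul (1 \ox z) R)); last by rewrite /tmul; lin.
    rewrite /tmul tliftB; try lin.
    rewrite tliftZ.
    by apply: eq_tlift => a b; rewrite mul1r.
  rewrite -(swRl (F := fun r1 r2 s => eps r1 *: (r2 \ox s))); try lin.
  sw 1 by (refine (sw_counitl (F := fun a => a \ox q) _ _); [lin|by []]).
  exact: tlift_tens.
move=> /Rcancel/(congr1 (tlift (fun a b => eps a *: b))) e1; rewrite !tliftB in e1; try lin.
by move: e1; rewrite counit1 !scale1r.
Qed.

Lemma counitR_r : \sw_(r, s <- R) (eps s *: r) = 1.
Proof.
set e := tlift _ _.
have : tmul (e \ox 1) R = R.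
  rewrite /e; transitivity (\sw_(r1, s1 <- R) \sw_(r2, s2 <- R) (eps s1 *: ((r1 * r2) \ox s2))).
    rewrite (tlift_push (L := fun z => tmul (z \ox 1) R)); last by rewrite /tmul; lin.
    apply: eq_tlift => r s; rewrite [LHS](linZ (f := fun z => tmul (z \ox 1) R)); last by rewrite /tmul; lin.
    rewrite /tmul tliftB; try lin.
    rewrite tliftZ.
    by apply: eq_tlift => a b; rewrite mul1r.
  rewrite -(swRr (F := fun r s2 s1 => eps s1 *: (r \ox s2))); try lin.
  sw 1 by (refine (sw_counitr (F := fun a => p \ox a) _ _); [lin|by []]).
  exact: tlift_tens.
move=> /Rcancel/(congr1 (tlift (fun a b => eps b *: a))) e1; rewrite !tliftB in e1; try lin.
by move: e1; rewrite counit1 !scale1r.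
Qed.

(** As for the counit of the coproduct, a factor eps(R^1) may occur anywhere in
the summand. *)
Lemma swR_el W (F : H -> W) f : linear F ->
  (forall a b, f a b = eps a *: F b) -> tlift f R = F 1.
Proof.
move=> lF e; rewrite (eq_tlift _ e) -counitR_l (tlift_push _ _ lF).
by apply: eq_tlift => a b; rewrite linZ.
Qed.

Lemma swR_er W (F : H -> W) f : linear F ->
  (forall a b, f a b = eps b *: F a) -> tlift f R = F 1.
Proof.
move=> lF e; rewrite (eq_tlift _ e) -counitR_r (tlift_push _ _ lF).
by apply: eq_tlift => a b; rewrite linZ.
Qed.

(** The inverse of R is (S (x) id)(R): contract S(R^1_1) R^1_2. *)
Lemma swR_invl W (F : H -> H -> W) :
  (forall b, linear (fun a => F a b)) -> (forall a, linear (F a)) ->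
  \sw_(r1, s1 <- R) \sw_(r2, s2 <- R) F (S r1 * r2) (s1 * s2) = F 1 1.
Proof.
move=> l1 l2; rewrite -(swRl (F := fun a b c => F (S a * b) c)); try lin.
refine (swR_el (F := fun s => F 1 s) _ _); first by lin.
by move=> r s; refine (sw_antil (F := fun z => F z s) _ _).
Qed.

Lemma swR_invr W (F : H -> H -> W) :
  (forall b, linear (fun a => F a b)) -> (forall a, linear (F a)) ->
  \sw_(r1, s1 <- R) \sw_(r2, s2 <- R) F (r1 * S r2) (s1 * s2) = F 1 1.
Proof.
move=> l1 l2; pose X := \sw_(r, s <- R) (S r \ox s).
have [R' [RR' R'R]] := qt_inv qtR.
have XR : tmul X R = 1 \ox 1.
  rewrite -(@swR_invl _ (fun a b => a \ox b)); try lin.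
  rewrite /X (tlift_push (L := fun z => tmul z R)); last by rewrite /tmul; lin.
  apply: eq_tlift => r s; rewrite /tmul tliftB; try lin.
  by [].
have {}XR : X = R' by rewrite -[X]tmul1r -RR' tmulA XR tmul1l.
have e := congr1 (tlift F) RR'; rewrite tliftB // -XR in e.
rewrite -e /tmul tlift_tlift; apply: eq_tlift => r s.
rewrite /X tlift_tlift tlift_tlift; apply: eq_tlift => a b.
by rewrite !tliftB //; lin.
Qed.

(** The companion of the previous two lemmas for the second leg. It says that
(id (x) S)(R) is a left inverse of R for the product of H with the opposite of H. *)
Lemma swR_id_anti W (F : H -> H -> W) :
  (forall b, linear (fun a => F a b)) -> (forall a, linear (F a)) ->
  \sw_(r1, s1 <- R) \sw_(r2, s2 <- R) F (r1 * r2) (s2 * S s1) = F 1 1.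
Proof.
move=> l1 l2; rewrite -(swRr (F := fun a b c => F a (b * S c))); try lin.
refine (swR_er (F := fun r => F r 1) _ _); first by lin.
by move=> r s; refine (sw_antir (F := fun z => F r z) _ _).
Qed.

(** (S (x) S)(R) and R are both inverse to (S (x) id)(R). *)
Lemma swR_SS W (F : H -> H -> W) :
  (forall b, linear (fun a => F a b)) -> (forall a, linear (F a)) ->
  \sw_(r, s <- R) F (S r) (S s) = \sw_(r, s <- R) F r s.
Proof.
move=> l1 l2.
transitivity (\sw_(r, s <- R) \sw_(r1, s1 <- R) \sw_(r2, s2 <- R)
    F (r * S r1 * S r2) (s * s1 * S s2)).
  symmetry; sw 1 by swC.
  sw0 by swC.
  sw 1 by (refine (swR_invr (F := fun a b => F (a * S p) (b * S q)) _ _); lin).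
  by apply: eq_tlift => a b; rewrite !mul1r.
apply: eq_tlift => r s.
transitivity (\sw_(r1, s1 <- R) \sw_(r2, s2 <- R) F (r * S (r2 * r1)) (s * (s1 * S s2))).
  by do 2 (apply: eq_tlift => ? ?); rewrite antipodeM !mulrA.
rewrite tliftC (@swR_id_anti _ (fun a b => F (r * S a) (s * b))); try lin.
by rewrite antipode1 !mulr1.
Qed.

Definition drinfeld : H := \sw_(r, s <- R) (S s * r).
Local Notation u := drinfeld.

(** Both sides equal the sum of S(S(h_3)) S(R^2 h_2) R^1 h_1, where R is moved past
the coproduct by quasi-cocommutativity. *)
Lemma drinfeldE h : S (S h) * u = u * h.
Proof.
transitivity (\sw_(a, b <- D h) \sw_(r, s <- R) \sw_(c, d <- D a)
   (S (S b) * S (s * d) * (r * c))).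
  symmetry.
  sw 1 by (refine (@swR_comm _ _ (fun x y => S (S q) * S y * x) _ _); lin).
  transitivity (\sw_(a, b <- D h) (eps a *: (S (S b) * u))); last first.
    by refine (sw_counitl (F := fun b => S (S b) * u) _ _); [lin|].
  apply: eq_tlift => a b; rewrite /u tlift_mulr tliftZ; apply: eq_tlift => r s.
  refine (etrans (sw_antil (F := fun z => S (S b) * S s * z * r) _ _) _); first by lin.
    by move=> c d; rewrite antipodeM !mulrA.
  by rewrite mulr1 mulrA.
sw 1 by swC.
sw0 by (refine (swA _ _ _); lin).
transitivity (\sw_(a, b <- D h) (eps b *: (u * a))); last first.
  by refine (sw_counitr (F := fun a => u * a) _ _); [lin|].
apply: eq_tlift => a b; rewrite tliftC /u tlift_mull tliftZ; apply: eq_tlift => r s.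
refine (etrans (sw_antir (F := fun z => S z * S s * (r * a)) _ _) _); first by lin.
  by move=> c d; rewrite !antipodeM !mulrA.
by rewrite antipode1 mul1r mulrA.
Qed.

Lemma drinfeld_linv : exists v, v * u = 1.
Proof.
exists (\sw_(r, s <- R) (S s * S (S (S r)))).
transitivity (\sw_(r, s <- R) \sw_(r1, s1 <- R) (S s * S s1 * r1 * S r)).
  rewrite tlift_mull; apply: eq_tlift => r s.
  rewrite -mulrA drinfeldE /u tlift_mull tlift_mulr.
  by apply: eq_tlift => r1 s1; rewrite !mulrA.
transitivity (S 1 * (1 : H)); last by rewrite antipode1 mul1r.
rewrite tliftC -[RHS](@swR_invr _ (fun x y => S y * x)); try lin.
by do 2 (apply: eq_tlift => ? ?); rewrite antipodeM !mulrA.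
Qed.

(** S(S(x)) u = u x with u left invertible recovers x from S(x). *)
Lemma antipode_inj : injective S.
Proof.
have [v vu] := drinfeld_linv.
move=> x y e; have : S (S x) * u = S (S y) * u by rewrite e.
by rewrite !drinfeldE => /(congr1 (fun z => v * z)); rewrite !mulrA vu !mul1r.
Qed.
End QT.
Arguments swR_comm {k H HH R} qtR h {W} F.
Arguments swRl {k H HH R} qtR {W} F.
Arguments swRr {k H HH R} qtR {W} F.
Arguments swR_el {k H HH R} qtR {W F f}.
Arguments swR_er {k H HH R} qtR {W F f}.
Arguments swR_invl {k H HH R} qtR {W} F.
Arguments swR_invr {k H HH R} qtR {W} F.
Arguments swR_id_anti {k H HH R} qtR {W} F.
Arguments swR_SS {k H HH R} qtR {W} F.

(** * Traces *)

Section Trace.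
Variable k : fieldType.
Implicit Types U V : vectType k.

Definition co V (i : 'I_(\dim {:V})) (v : V) : k^o := coord (vbasis {:V}) i v.
Definition bv V (i : 'I_(\dim {:V})) : V := (vbasis {:V})`_i.

Lemma lin_co V i : linear (@co V i).
Proof. by move=> c u v; rewrite /co linearP. Qed.

Lemma co_sum V (v : V) : \sum_i (co i v : k) *: bv i = v.
Proof. by rewrite [RHS](coord_vbasis (memvf v)). Qed.

Lemma co_bv V (i j : 'I_(\dim {:V})) : co i (bv j) = (i == j)%:R.
Proof. by rewrite /co /bv coord_free ?(basis_free (vbasisP _)) // eq_sym. Qed.

Lemma lin_expand V (W : lmodType k) (f : V -> W) v :
  linear f -> f v = \sum_i (co i v : k) *: f (bv i).
Proof.
move=> lf; rewrite -[in LHS](co_sum v) linS //.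
by apply: eq_bigr => i _; rewrite linZ.
Qed.

(** Defined for arbitrary maps, so that a trace can be taken of an explicit
expression; it is the trace when the map is linear. *)
Definition Tr V (f : V -> V) : k := \sum_i (co i (f (bv i)) : k).

Lemma eq_Tr V (f g : V -> V) : f =1 g -> Tr f = Tr g.
Proof. by move=> e; apply: eq_bigr => i _; rewrite e. Qed.

Lemma eq_Trs V (f g : V -> V) : f =1 g -> Tr f = Tr g :> k^o.
Proof. exact: eq_Tr. Qed.

Lemma TrC U V (f : U -> V) (g : V -> U) : linear f -> linear g ->
  Tr (fun x => g (f x)) = Tr (fun y => f (g y)).
Proof.
move=> lf lg; rewrite /Tr.
transitivity (\sum_i \sum_j (co j (f (bv i)) : k) * (co i (g (bv j)) : k)).
  apply: eq_bigr => i _; rewrite (lin_expand (f (bv i)) lg).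
  by rewrite (linS _ (@lin_co _ _)); apply: eq_bigr => j _; rewrite linZ //; apply: lin_co.
rewrite exchange_big; apply: eq_bigr => j _.
rewrite (lin_expand (g (bv j)) lf) (linS _ (@lin_co _ _)).
apply: eq_bigr => i _; rewrite linZ; last exact: lin_co.
by rewrite mulrC.
Qed.

Lemma TrD V (f g : V -> V) : Tr (fun x => f x + g x) = Tr f + Tr g.
Proof.
rewrite /Tr -big_split; apply: eq_bigr => i _; exact: (linD _ _ (@lin_co _ _)).
Qed.
Lemma TrZ V c (f : V -> V) : Tr (fun x => c *: f x) = c * Tr f.
Proof.
rewrite /Tr mulr_sumr; apply: eq_bigr => i _; exact: (linZ _ _ (@lin_co _ _)).
Qed.

Lemma Tr_id V : Tr (fun x : V => x) = (\dim {:V})%:R.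
Proof.
rewrite /Tr (eq_bigr (fun _ => 1)); last by move=> i _; rewrite co_bv eqxx.
by rewrite sumr_const card_ord.
Qed.

Lemma Tr_tlift V (U1 U2 : vectType k) (t : tensor U1 U2) (F : U1 -> U2 -> V -> V) :
  Tr (fun y => \sw_(a, b <- t) F a b y) = \sw_(a, b <- t) (Tr (F a b) : k^o).
Proof.
rewrite /Tr.
transitivity (\sum_i \sw_(a, b <- t) (co i (F a b (bv i)) : k^o)).
  by apply: eq_bigr => i _; rewrite (tlift_push _ _ (@lin_co _ _)).
by rewrite tlift_sum.
Qed.

Lemma Tr_rank1 V (f : V -> k^o) (w : V) : linear f ->
  Tr (fun y => (f y : k) *: w) = f w.
Proof.
move=> lf; rewrite /Tr (lin_expand w lf); apply: eq_bigr => i _.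
rewrite (linZ (f := co i) (f (bv i)) w (@lin_co _ _)).
exact: mulrC.
Qed.

(** Split the projection through its image and use cyclicity. *)
Lemma Tr_idem V (f : 'End(V)) : (forall v, f (f v) = f v) ->
  Tr f = (\dim (limg f))%:R.
Proof.
move=> ff.
pose p v : subvs_of (limg f) := vsproj (limg f) (f v).
have ip v : vsval (p v) = f v by rewrite /p vsprojK // memv_img // memvf.
have pi w : p (vsval w) = w.
  apply: val_inj; rewrite /= ip; have /memv_imgP[v _ ->] := subvsP w.
  by rewrite ff.
rewrite (eq_Tr (g := fun v => vsval (p v))) //.
rewrite TrC.
- rewrite (eq_Tr (g := fun v => v)) // Tr_id.
  by rewrite dimvf.
- by move=> c u v; rewrite /p !linearP.
- exact: linearP.
Qed.

End Trace.
#[export] Hint Resolve lin_co : lin.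

(** * The Larson-Radford theorem on the square of the antipode *)

Lemma inj_surj (k : fieldType) (V : vectType k) (f : 'End(V)) :
  injective f -> forall v, exists w, v = f w.
Proof.
move=> fi v; have f0 : lker f == 0%VS by apply/lker0P.
by exists ((f^-1)%VF v); rewrite lker0_lfunVK.
Qed.

Section LR.
Variables (k : fieldType) (char0 : [pchar k] =i pred0).
Variables (K : falgType k) (HK : hopf_algebra K).
Local Notation S := (antipode HK).
Local Notation D := (comul HK).
Local Notation eps h := (counit HK h : k).
Hypothesis Sinj : injective S.
(** A normalised integral L of K and a normalised integral lam of its dual. *)
Variables (L : K) (lam : 'Hom(K, k^o)).
Hypothesis Ll : forall h, h * L = eps h *: L.
Hypothesis L1 : eps L = 1.
Hypothesis laml : forall h, \sw_(a, b <- D h) ((lam a : k) *: b) = (lam h : k) *: 1.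
Hypothesis lam1 : lam 1 = 1.
Implicit Types (h x y w : K) (W : lmodType k).

(** S(L) is a right integral, so S(L)L can be evaluated in two ways. *)
Lemma antipode_integral : S L = L.
Proof.
have r h : S L * h = eps h *: S L.
  have [g ->] := inj_surj Sinj h.
  by rewrite -antipodeM Ll linearZ counit_antipode.
have e1 : S L * L = L by rewrite Ll counit_antipode L1 scale1r.
by rewrite -[RHS]e1 r L1 scale1r.
Qed.

Lemma integral_right h : L * h = eps h *: L.
Proof.
have [g ->] := inj_surj Sinj h.
by rewrite -[in LHS]antipode_integral -antipodeM Ll linearZ counit_antipode /= antipode_integral.
Qed.

Lemma lamZ (d : k) x : lam (d *: x) = d * lam x :> k.
Proof. by rewrite linearZ. Qed.

Lemma lam_antipode h : lam (S h) = lam h.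
Proof.
have r : \sw_(a, b <- D h) ((lam (S b) : k) *: a) = (lam (S h) : k) *: 1.
  apply: Sinj; rewrite linearZ /= antipode1 -laml swS; try by lin.
  by rewrite tlift_lfun; apply: eq_tlift => a b; rewrite linearZ.
transitivity (\sw_(a, b <- D h) ((lam a : k) * (lam (S b) : k) : k^o)).
  transitivity (lam ((lam (S h) : k) *: 1)).
    by rewrite lamZ lam1 mulr1.
  rewrite -r tlift_lfun; apply: eq_tlift => a b; rewrite lamZ; exact: mulrC.
transitivity (lam (S (\sw_(a, b <- D h) ((lam a : k) *: b)))).
  by rewrite !tlift_lfun; apply: eq_tlift => a b; rewrite linearZ /= lamZ.
by rewrite laml linearZ /= antipode1 lamZ lam1 mulr1.
Qed.

Lemma lam_right h : \sw_(a, b <- D h) ((lam b : k) *: a) = (lam h : k) *: 1.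
Proof.
apply: Sinj; rewrite linearZ /= antipode1 -lam_antipode -laml swS; try by lin.
rewrite tlift_lfun; apply: eq_tlift => a b.
by rewrite linearZ /= lam_antipode.
Qed.

(** The element L_1 (x) S(L_2) is a Casimir element: h L_1 (x) S(L_2) equals
h_1 L_1 (x) S(h_2 L_2) h_3, where h_1 is absorbed by L. *)
Lemma casimir_l h W (F : K -> K -> W) :
  (forall b, linear (fun a => F a b)) -> (forall a, linear (F a)) ->
  \sw_(a, b <- D L) F (h * a) (S b) = \sw_(a, b <- D L) F a (S b * h).
Proof.
move=> l1 l2.
transitivity (\sw_(p, q <- D h) \sw_(a, b <- D (p * L)) F a (S b * q)).
  symmetry.
  sw 1 by (refine (swM _ p L (fun a b => F a (S b * q)) _ _); lin).
  sw0 by (refine (swA _ _ _); lin).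
  transitivity (\sw_(a, b <- D h) (eps b *: \sw_(c, d <- D L) F (a * c) (S d))).
    apply: eq_tlift => a b; rewrite tliftC.
    rewrite tliftZ; sw 1 by (refine (sw_antil (F := fun z => F (a * p) (S q * z)) _ _);
      [lin | by move=> c d; rewrite antipodeM mulrA]).
    by apply: eq_tlift => c d; rewrite mulr1.
  by refine (sw_counitr (F := fun h => \sw_(c, d <- D L) F (h * c) (S d)) _ _); [lin|].
transitivity (\sw_(p, q <- D h) (eps p *: \sw_(a, b <- D L) F a (S b * q))).
  apply: eq_tlift => p q; rewrite Ll linearZ /=.
  by rewrite (linZ _ _ (@lin_tlift _ _ _ _ _)).
by refine (sw_counitl (F := fun q => \sw_(a, b <- D L) F a (S b * q)) _ _); [lin|].
Qed.

Lemma casimir_r h W (F : K -> K -> W) :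
  (forall b, linear (fun a => F a b)) -> (forall a, linear (F a)) ->
  \sw_(a, b <- D L) F (a * h) (S b) = \sw_(a, b <- D L) F a (S (S h) * S b).
Proof.
move=> l1 l2.
transitivity (\sw_(p, q <- D h) \sw_(a, b <- D (L * p)) F a (S (S q) * S b)).
  symmetry.
  sw 1 by (refine (swM _ L p (fun a b => F a (S (S q) * S b)) _ _); lin).
  sw 1 by swC.
  sw0 by (refine (swA _ _ _); lin).
  transitivity (\sw_(a, b <- D h) (eps b *: \sw_(c, d <- D L) F (c * a) (S d))).
    apply: eq_tlift => a b; rewrite tliftC.
    rewrite tliftZ; sw 1 by (refine (sw_antir (F := fun z => F (p * a) (S z * S q)) _ _);
      [lin | by move=> c d; rewrite !antipodeM mulrA]).
    by apply: eq_tlift => c d; rewrite antipode1 mul1r.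
  by refine (sw_counitr (F := fun h => \sw_(c, d <- D L) F (c * h) (S d)) _ _); [lin|].
transitivity (\sw_(p, q <- D h) (eps p *: \sw_(a, b <- D L) F a (S (S q) * S b))).
  apply: eq_tlift => p q; rewrite integral_right linearZ /=.
  by rewrite (linZ _ _ (@lin_tlift _ _ _ _ _)).
by refine (sw_counitl (F := fun q => \sw_(a, b <- D L) F a (S (S q) * S b)) _ _); [lin|].
Qed.

Local Notation c := (lam L : k).

(** Thus L_1 and S(L_2) are dual bases, up to the factor lam(L), for the form
(x, y) |-> lam(xy). *)
Lemma dual_bases y : \sw_(a, b <- D L) ((lam (S b * y) : k) *: a) = c *: y.
Proof.
rewrite -(@casimir_l y _ (fun a b => (lam b : k) *: a)); try lin.
transitivity (y * \sw_(a, b <- D L) ((lam b : k) *: a)).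
  by rewrite tlift_mulr; apply: eq_tlift => a b; rewrite lam_antipode scalerAr.
by rewrite lam_right -scalerAr mulr1.
Qed.

(** The Larson-Radford trace formula. *)
Lemma trace_formula (f : K -> K) : linear f ->
  c * Tr f = \sw_(a, b <- D L) lam (S b * f a).
Proof.
move=> lf; rewrite -TrZ.
rewrite (eq_Tr (g := fun y => \sw_(a, b <- D L) ((lam (S b * y) : k) *: f a))).
  rewrite Tr_tlift; apply: eq_tlifts => a b.
  by rewrite (Tr_rank1 (f := fun y => lam (S b * y))) //; lin.
move=> y; rewrite -linZ // -dual_bases (tlift_push _ _ lf).
by apply: eq_tlift => a b; rewrite linZ.
Qed.

Lemma trace_antipode2 : c * Tr (fun x => S (S x)) = 1.
Proof.
rewrite trace_formula; last by lin.
transitivity (\sw_(a, b <- D L) lam (S (S a * b))).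
  by apply: eq_tlifts => a b; rewrite antipodeM.
rewrite (sw_antil (F := fun z => lam (S z))) //; last by lin.
by rewrite L1 scale1r antipode1 lam1.
Qed.

Lemma lam_integral_neq0 : c != 0.
Proof. by apply: contra_eq_neq trace_antipode2 => ->; rewrite mul0r eq_sym oner_neq0. Qed.

(** The functional mu measures the failure of the identity. Pairing it with
the dual bases of lam gives 0, so mu vanishes because lam(L) is invertible. *)
Lemma nakayama1 w y : lam (w * y) = lam (S (S y) * w).
Proof.
pose mu (t : K) : k^o := lam (S (S y) * t) - lam (t * y).
have lmu : linear mu by rewrite /mu; lin.
suff : mu w = 0 by move/eqP; rewrite subr_eq0 => /eqP.
have mu0 : \sw_(a, b <- D L) ((mu (S b) : k) *: a) = 0.
  transitivity (\sw_(a, b <- D L) ((lam (S (S y) * S b) : k) *: a) -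
                \sw_(a, b <- D L) ((lam (S b * y) : k) *: a)).
    by rewrite -tlift_sub; apply: eq_tlift => a b; rewrite scalerBl.
  rewrite dual_bases -(@casimir_r y _ (fun a b => (lam b : k) *: a)); try lin.
  apply/eqP; rewrite subr_eq0; apply/eqP.
  transitivity ((\sw_(a, b <- D L) ((lam (S b * 1) : k) *: a)) * y).
    by rewrite tlift_mull; apply: eq_tlift => a b; rewrite mulr1 scalerAl.
  by rewrite dual_bases -scalerAl mul1r.
have e : c * (mu w : k) = 0.
  transitivity (\sw_(a, b <- D L) ((mu (S b * w) : k) * (lam a : k) : k^o)).
    transitivity (mu (S (c *: 1) * w)).
      by rewrite linearZ /= antipode1 -scalerAl mul1r linZ.
    rewrite -laml tlift_lfun tlift_mull (tlift_push _ _ lmu); apply: eq_tlifts => a b.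
    by rewrite linearZ /= -scalerAl linZ //; apply: mulrC.
  transitivity (lam (\sw_(a, b <- D L) ((mu (S b * w) : k) *: a))).
    by rewrite tlift_lfun; apply: eq_tlifts => a b; rewrite lamZ.
  rewrite -(@casimir_l w _ (fun a b => (mu b : k) *: a)); try lin.
  transitivity (lam (w * \sw_(a, b <- D L) ((mu (S b) : k) *: a))).
    by rewrite tlift_mulr; congr (lam _); apply: eq_tlift => a b; rewrite scalerAr.
  by rewrite mu0 mulr0 linear0.
by move/eqP: e; rewrite mulf_eq0 (negbTE lam_integral_neq0) => /eqP.
Qed.

Lemma nakayama2 w y : lam (w * y) = lam (y * S (S w)).
Proof.
have [w' ->] := inj_surj Sinj w; have [y' ->] := inj_surj Sinj y.
by rewrite -antipodeM lam_antipode nakayama1 -lam_antipode antipodeM.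
Qed.

(** By nakayama1 and nakayama2 the Nakayama automorphism of lam is both S^2 and the
inverse of S^2. *)
Lemma antipode4 y : S (S (S (S y))) = y.
Proof.
apply: (scalerI lam_integral_neq0); rewrite -!dual_bases; apply: eq_tlift => a b.
by congr (_ *: _); rewrite [in RHS]nakayama1 [in RHS]nakayama2.
Qed.

(** Here S^4 = 1 is needed to bring S(S(h)) out of the trace. *)
Lemma trace_antipode2_mul h : c * Tr (fun x => S (S (h * x))) = lam h.
Proof.
rewrite trace_formula; last by lin.
transitivity (\sw_(a, b <- D L) lam (a * S b * S (S h))).
  apply: eq_tlifts => a b.
  by rewrite !antipodeM [in LHS]mulrA [in LHS]nakayama1 antipode4 mulrA.
rewrite (sw_antir (F := fun z => lam (z * S (S h)))) //; last by lin.
by rewrite L1 scale1r mul1r !lam_antipode.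
Qed.

(** Partial trace over K of a map K -> W (x) K. *)
Definition ptr (W : vectType k) (N : K -> tensor W K) : W :=
  \sum_i \sw_(w, b <- N (bv i)) ((co i b : k) *: w).

Lemma eq_ptr (W : vectType k) (N N' : K -> tensor W K) : N =1 N' -> ptr N = ptr N'.
Proof. by move=> e; apply: eq_bigr => i _; rewrite e. Qed.

Lemma lin_ptr (X W : vectType k) (N : X -> K -> tensor W K) :
  (forall e, linear (fun z => N z e)) -> linear (fun z => ptr (N z)).
Proof. by move=> lN; rewrite /ptr; lin. Qed.

(** Cyclicity of the trace, with coefficients in W. *)
Lemma ptr_cyc (W : vectType k) (N : K -> tensor W K) (M : K -> K) :
  linear N -> linear M ->
  ptr (fun y => N (M y)) = ptr (fun y => \sw_(w, b <- N y) (w \ox M b)).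
Proof.
move=> lN lM; rewrite /ptr.
transitivity (\sum_i \sum_j \sw_(w, b <- N (bv j)) (((co j (M (bv i)) : k) * (co i b : k)) *: w)).
  apply: eq_bigr => i _; rewrite (lin_expand (M (bv i)) lN).
  rewrite (linS _ (@lin_tlift _ _ _ _ _)); apply: eq_bigr => j _.
  rewrite (linZ _ _ (@lin_tlift _ _ _ _ _)) tliftZ.
  by apply: eq_tlift => w b; rewrite scalerA.
rewrite exchange_big; apply: eq_bigr => j _; rewrite tlift_tlift tlift_sum.
apply: eq_tlift => w b; rewrite tliftB; try lin.
rewrite (lin_expand b lM) (linS _ (@lin_co _ _ _)) scaler_suml.
by apply: eq_bigr => i _; rewrite (linZ _ _ (@lin_co _ _ _)) mulrC.
Qed.

(** The character of the regular representation of the dual algebra, viewed as an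
element of K: the sum of e_{i(1)} e^i(e_{i(2)}) over dual bases. *)
Definition dual_char : K := ptr (fun y => D y).
Local Notation x := dual_char.

(** Multiplying the coproduct of the basis by y and moving the second leg around the
trace turns y into S(y_2) y_1, which the hypothesis evaluates. *)
Lemma dual_char_mul y : \sw_(a, b <- D y) (S b * a) = eps y *: 1 ->
  x * y = eps y *: x.
Proof.
move=> yc.
transitivity (\sw_(p, q <- D y) ptr (fun e => \sw_(a, b <- D (e * p)) (a \ox (b * S q)))).
  rewrite -tlift_sum /x /ptr mulr_suml; apply: eq_bigr => i _.
  rewrite tlift_mull; symmetry.
  sw 1 by (rewrite (swM _ (bv i) p (fun a b => a \ox (b * S q))); [|lin|lin];
           rewrite !tlift_tlift; refine (eq_tlift _ (fun a b => _)); rewrite tlift_tlift; reflexivity).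
  sw 1 by swC.
  sw 3 by (rewrite tliftB; [reflexivity|lin|lin]).
  sw0 by (refine (swA _ _ _); lin).
  sw 1 by swC.
  sw 2 by (refine (sw_antir (F := fun z => (co i (q0 * z) : k) *: (p0 * p)) _ _);
    [lin|by move=> ? ?; rewrite mulrA]).
  sw0 by swC.
  apply: eq_tlift => a b.
  refine (etrans (sw_counitr (F := fun z => (co i (b * 1) : k) *: (a * z)) _ _) _);
    [lin|by []|by rewrite mulr1 scalerAl].
transitivity (\sw_(p, q <- D y) ptr (fun e => \sw_(a, b <- D e) (a \ox (b * (S q * p))))).
  apply: eq_tlift => p q.
  rewrite (@ptr_cyc _ (fun e => \sw_(a, b <- D e) (a \ox (b * S q))) (fun e => e * p)); try lin.
  apply: eq_ptr => e; rewrite tlift_tlift; apply: eq_tlift => a b.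
  rewrite tliftB; [by rewrite mulrA|lin|lin].
transitivity (ptr (fun e => \sw_(a, b <- D e) (a \ox (b * \sw_(p, q <- D y) (S q * p))))).
  symmetry; apply: (tlift_push (L := fun z => ptr (fun e => \sw_(a, b <- D e) (a \ox (b * z))))).
  by apply: lin_ptr => e; lin.
rewrite yc /x /ptr scaler_sumr; apply: eq_bigr => i _.
rewrite tlift_tlift tliftZ; apply: eq_tlift => a b; rewrite tliftB; try lin.
by rewrite -scalerAr mulr1 scalerA (linZ _ _ (@lin_co _ _ _)).
Qed.

(** Being a character, dual_char is cocommutative, so the order of the two legs in the
antipode axiom may be exchanged. *)
Lemma dual_char_cocomm : \sw_(a, b <- D x) (S b * a) = eps x *: 1.
Proof.
have Dx (G : K -> K -> K) : (forall b, linear (fun a => G a b)) -> (forall a, linear (G a)) ->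
    \sw_(a, b <- D x) G a b = ptr (fun e => \sw_(a, b <- D e) \sw_(p, q <- D b) (G a p \ox q)).
  move=> l1 l2; rewrite /x /ptr linear_sum /= (linS _ (@lin_tlift _ _ _ _ _)).
  apply: eq_bigr => i _; rewrite tlift_lfun !tlift_tlift.
  transitivity (\sw_(a, b <- D (bv i)) \sw_(p, q <- D a) ((co i b : k) *: G p q)).
    apply: eq_tlift => a b; rewrite linearZ /= (linZ _ _ (@lin_tlift _ _ _ _ _)).
    by rewrite tliftZ.
  sw0 by (refine (swA _ _ _); lin).
  apply: eq_tlift => a b; rewrite tlift_tlift; apply: eq_tlift => p q.
  by rewrite tliftB; lin.
have cyc (G : K -> K -> K) : (forall b, linear (fun a => G a b)) -> (forall a, linear (G a)) ->
    ptr (fun e => \sw_(a, b <- D e) \sw_(p, q <- D b) (G a p \ox q)) =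
    ptr (fun e => \sw_(a, b <- D e) \sw_(p, q <- D b) (G p a \ox q)).
  move=> l1 l2.
  pose P j e := \sw_(a, b <- D e) ((co j a : k) *: b).
  have lP j : linear (P j) by rewrite /P; lin.
  pose N j e := \sw_(p, q <- D e) (G (bv j) p \ox q).
  have lN j : linear (N j) by rewrite /N; lin.
  transitivity (\sum_j ptr (fun e => N j (P j e))).
    rewrite /ptr [RHS]exchange_big; apply: eq_bigr => i _.
    rewrite -(@linS _ _ _ (tlift (fun w b => (co i b : k) *: w)) _ _ (@lin_tlift _ _ _ _ _)); congr (tlift _ _).
    under [RHS]eq_bigr => j _ do rewrite /P (tlift_push _ _ (lN j)).
    rewrite tlift_sum; apply: eq_tlift => a b.
    rewrite (lin_expand (f := fun a => \sw_(p, q <- D b) (G a p \ox q)) a); last by lin.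
    by apply: eq_bigr => j _; rewrite linZ.
  transitivity (\sum_j ptr (fun e => \sw_(w, b <- N j e) (w \ox P j b))).
    by apply: eq_bigr => j _; apply: ptr_cyc.
  rewrite /ptr [LHS]exchange_big; apply: eq_bigr => i _.
  rewrite -(@linS _ _ _ (tlift (fun w b => (co i b : k) *: w)) _ _ (@lin_tlift _ _ _ _ _)); congr (tlift _ _).
  transitivity (\sw_(c, d <- D (bv i)) \sum_j (G (bv j) c \ox P j d)).
    rewrite -tlift_sum; apply: eq_bigr => j _; rewrite /N tlift_tlift.
    by apply: eq_tlift => c d; rewrite tliftB; lin.
  apply: eq_tlift => c d.
  transitivity (\sum_j \sw_(a, b <- D d) ((co j a : k) *: (G (bv j) c \ox b))).
    apply: eq_bigr => j _; rewrite /P tlift_tensr; apply: eq_tlift => a b.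
    by rewrite linZ; lin.
  rewrite tlift_sum; apply: eq_tlift => a b.
  by rewrite (lin_expand (f := fun a => G a c \ox b) a); lin.
rewrite (Dx (fun a b => S b * a)); try lin.
rewrite (cyc (fun a b => S b * a)); try lin.
rewrite -(Dx (fun a b => S a * b)); try lin.
exact: antipodel.
Qed.

Lemma dual_char_S2 : S (S x) = x.
Proof.
rewrite /x.
have e1 : ptr (fun e => D e) = ptr (fun e => \sw_(a, b <- D (S (S (S (S e))))) (a \ox b)).
  by apply: eq_ptr => e; rewrite antipode4 tlift_tens.
rewrite [RHS]e1.
rewrite [RHS](@ptr_cyc _ (fun e => \sw_(a, b <- D (S (S e))) (a \ox b)) (fun e => S (S e))); try lin.
rewrite /ptr !linear_sum /=; apply: eq_bigr => i _.
rewrite !tlift_lfun tlift_tlift tlift_tlift swS; try lin.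
rewrite swS; try lin.
apply: eq_tlift => a b; rewrite !tliftB; try lin.
by rewrite antipode4 !linearZ.
Qed.

Lemma lam_dual_char : lam x = 1.
Proof.
rewrite /x /ptr linear_sum /=.
transitivity (\sum_i (co i (\sw_(a, b <- D (bv i)) ((lam a : k) *: b)) : k^o)).
  apply: eq_bigr => i _; rewrite tlift_lfun (tlift_push _ _ (@lin_co _ _ i)).
  apply: eq_tlift => a b; rewrite lamZ (linZ _ _ (@lin_co _ _ i)); exact: mulrC.
transitivity (\sum_i ((co i (1 : K) : k) * (lam (bv i) : k))).
  by apply: eq_bigr => i _; rewrite laml (linZ _ _ (@lin_co _ _ i)); apply: mulrC.
rewrite -[RHS]lam1 -[in RHS](co_sum 1) linear_sum /=.
by apply: eq_bigr => i _; rewrite lamZ.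
Qed.

Lemma eps_dual_char : eps x = (\dim {:K})%:R.
Proof.
rewrite -Tr_id /Tr /x /ptr linear_sum /=; apply: eq_bigr => i _.
rewrite -[in RHS](counitl HK (bv i)) tlift_lfun (tlift_push _ _ (@lin_co _ _ i)).
apply: eq_tlifts => a b; rewrite linearZ /= (linZ _ _ (@lin_co _ _ i)); exact: mulrC.
Qed.

Local Notation d := ((\dim {:K})%:R : k).

Lemma dim_gt0 : (0 < \dim {:K})%N.
Proof.
rewrite lt0n; apply/negP => /eqP e.
have := memvf (1 : K); move/eqP: e; rewrite dimv_eq0 => /eqP ->.
by rewrite memv0 oner_eq0.
Qed.

Lemma natr_neq0 n : (0 < n)%N -> n%:R != 0 :> k.
Proof. by move=> n0; have /pcharf0P -> := char0; rewrite -lt0n. Qed.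

Lemma natr_inj m n : m%:R = n%:R :> k -> m = n.
Proof.
wlog le : m n / (m <= n)%N => [th e|].
  by case/orP: (leq_total m n) => l; [apply: th|apply/esym/th].
move=> e; apply/eqP; rewrite eqn_leq le /= -subn_eq0.
by have /pcharf0P <- := char0; rewrite natrB // e subrr.
Qed.

(** Let s = S^2, an involution by antipode4, and d the dimension. E = (1 + s)/2 is the
projection onto the fixed points of s, and P = x/d, with x = dual_char, is another
projection that commutes with it. Let t be the trace of s. The ranks of E, P and EP
are traces, 2 p = d + t and 2 r1 = r2 + t/d, because the trace of s composed with
multiplication by x is again t. Eliminating t shows that d divides 2 p, where
0 < p <= d; the value 2 p = d is excluded by t <> 0. Hence p = d and s = 1. *)
Theorem antipode_involutive h : S (S h) = h.
Proof.
pose s : 'End(K) := (S \o S)%VF.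
have sE y : s y = S (S y) by rewrite /s comp_lfunE.
have ss y : s (s y) = y by rewrite !sE antipode4.
pose E : 'End(K) := 2%:R^-1 *: (\1%VF + s).
pose P : 'End(K) := d^-1 *: amull x.
have n2 : 2%:R != 0 :> k by exact: natr_neq0.
have nd : d != 0 by apply: natr_neq0; exact: dim_gt0.
have EE y : E y = 2%:R^-1 *: (y + s y).
  by rewrite /E scale_lfunE add_lfunE id_lfunE.
have PE y : P y = d^-1 *: (x * y) by rewrite /P scale_lfunE lfunE.
have Eid y : E (E y) = E y.
  have -> : E (E y) = 2%:R^-1 *: (2%:R^-1 *: (y + s y) + 2%:R^-1 *: (s y + y)).
    by rewrite !EE; congr (_ *: (_ + _)); rewrite linearZ /= linearD /= ss.
  rewrite EE [s y + y]addrC -scalerDr -mulr2n.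
  by rewrite -scaler_nat !scalerA -mulrA mulVf // mulr1.
have Pid y : P (P y) = P y.
  have xx : x * x = d *: x by rewrite dual_char_mul ?dual_char_cocomm // eps_dual_char.
  by rewrite !PE -scalerAr mulrA xx -scalerAl !scalerA mulfVK.
have EP y : E (P y) = P (E y).
  rewrite !EE !PE sE !linearZ /= !antipodeM dual_char_S2 -sE.
  by rewrite -scalerAr mulrDr -!scalerDr !scalerA mulrC.
pose Q : 'End(K) := (E \o P)%VF.
have QE y : Q y = E (P y) by rewrite /Q comp_lfunE.
have Qid y : Q (Q y) = Q y by rewrite !QE -EP Pid Eid.
pose t : k := Tr s.
have ct : c * t = 1 by rewrite -trace_antipode2 /t; congr (_ * _); apply: eq_Tr => y; rewrite sE.
have tx : Tr (fun y => s (x * y)) = t.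
  apply: (mulfI lam_integral_neq0); rewrite ct -lam_dual_char -[RHS]trace_antipode2_mul; congr (_ * _).
  by apply: eq_Tr => y; rewrite sE.
have TE : 2%:R * Tr E = d + t.
  rewrite (eq_Tr EE) TrZ TrD Tr_id mulrA mulfV // mul1r; congr (_ + _).
have TQ : 2%:R * Tr Q = Tr P + d^-1 * t.
  rewrite (eq_Tr (g := fun y => 2%:R^-1 *: (P y + d^-1 *: s (x * y)))); last first.
    by move=> y; rewrite QE EE; congr (_ *: (_ + _)); rewrite PE linearZ.
  by rewrite TrZ TrD TrZ tx mulrA mulfV // mul1r.
move: TE TQ; rewrite !Tr_idem //.
set p := \dim (limg E); set r1 := \dim (limg Q); set r2 := \dim (limg P) => TE TQ.
have eqN : (2 * p + \dim {:K} * r2 = \dim {:K} + \dim {:K} * (2 * r1))%N.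
  apply: natr_inj; rewrite [in LHS]natrD [in RHS]natrD !natrM TE -addrA; congr (_ + _).
  by rewrite TQ mulrDr mulVKf // addrC.
have p_le : (p <= \dim {:K})%N by apply: dimvS; apply: subvf.
have p_gt0 : (0 < p)%N.
  rewrite lt0n /p dimv_eq0; apply/negP => /eqP e0.
  have : E 1 \in limg E by rewrite memv_img // memvf.
  rewrite e0 memv0 EE sE !antipode1 -mulr2n -scaler_nat scalerA mulVf // scale1r.
  by rewrite oner_eq0.
have t_neq0 : t != 0 by apply: contra_eq_neq ct => ->; rewrite mulr0 eq_sym oner_neq0.
have p_ne : (2 * p <> \dim {:K})%N.
  move=> e; have : (2 * p)%:R = d by rewrite e.
  rewrite natrM TE => /eqP; rewrite -subr_eq0 addrC addKr.
  by rewrite (negbTE t_neq0).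
have pd : p = \dim {:K}.
  clear -eqN p_le p_gt0 p_ne; move: (\dim {:K}) eqN p_le p_ne => n eqN p_le p_ne.
  have lt : (r2 < 1 + 2 * r1)%N.
    rewrite ltnNge; apply/negP => le.
    have : (n * (1 + 2 * r1) <= n * r2)%N by rewrite leq_mul2l le orbT.
    by rewrite mulnDr muln1; lia.
  have e2 : (2 * p = n * (1 + 2 * r1 - r2))%N.
    by rewrite mulnBr mulnDr muln1; lia.
  move: e2; set m := (_ - _)%N; have : (0 < m)%N by rewrite subn_gt0.
  case: m => [|[|[|m]]] //= _; rewrite ?muln1; first by move/p_ne.
    by lia.
  by rewrite !mulnS; lia.
have Efull : limg E = fullv by apply/eqP; rewrite eqEdim subvf /= -pd.
have Eh : E h = h.
  have /memv_imgP[w _ ->] : h \in limg E by rewrite Efull memvf.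
  by rewrite Eid.
have : 2%:R *: h = h + S (S h).
  by rewrite -[in LHS]Eh EE scalerA mulfV // scale1r sE.
by rewrite scaler_nat mulr2n => /addrI/esym.
Qed.
End LR.

(** * Integrals in Hopf subalgebras *)

Section Tensv.
Variable k : fieldType.

Lemma dim_tensor (U V : vectType k) : \dim {: tensor U V} = (\dim {:U} * \dim {:V})%N.
Proof. by rewrite dimvf. Qed.

Lemma mem_tensv (U V : vectType k) (X : {vspace U}) (Y : {vspace V}) u v :
  u \in X -> v \in Y -> u \ox v \in tensv X Y.
Proof.
move=> uX vY; rewrite (coord_vbasis uX) (linS _ (@lin_tens_l _ _ _ v)).
apply: memv_suml => i _; rewrite (linZ _ _ (@lin_tens_l _ _ _ v)); apply: memvZ.
rewrite (coord_vbasis vY) (linS _ (@lin_tens_r _ _ _ _)).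
apply: memv_suml => j _; rewrite (linZ _ _ (@lin_tens_r _ _ _ _)); apply: memvZ.
by apply/memv_span/allpairsP; exists ((vbasis X)`_i, (vbasis Y)`_j); split=> //=;
  apply: mem_nth; rewrite size_tuple.
Qed.

Lemma dim_tensv (U V : vectType k) (X : {vspace U}) (Y : {vspace V}) :
  (\dim (tensv X Y) <= \dim X * \dim Y)%N.
Proof. by apply: leq_trans (dim_span _) _; rewrite size_allpairs !size_tuple. Qed.

Lemma tlift_mem (U V W : vectType k) (f : U -> V -> W) t (X : {vspace W}) :
  (forall a b, f a b \in X) -> tlift f t \in X.
Proof. by move=> fX; apply: memv_suml => i _; apply: memv_suml => j _; apply/memvZ/fX. Qed.

End Tensv.

(** An inclusion i of Hopf algebras, with an integral L of the larger one. Where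
the classical theory uses that H is free over K, a dimension estimate on tensor powers takes
its place. *)
Section SubHopf.
Variables (k : fieldType) (H : falgType k) (HH : hopf_algebra H).
Variables (K : falgType k) (HK : hopf_algebra K) (i : 'Hom(K, H)).
Local Notation S := (antipode HK).
Local Notation D := (comul HK).
Local Notation eps h := (counit HK h : k).
Local Notation SH := (antipode HH).
Local Notation DH := (comul HH).
Local Notation epsH h := (counit HH h : k).
Hypothesis iinj : injective i.
Hypothesis iM : forall x y, i (x * y) = i x * i y.
Hypothesis i1 : i 1 = 1.
Hypothesis iD : forall x, DH (i x) = \sw_(a, b <- D x) (i a \ox i b).
Hypothesis iS : forall x, i (S x) = SH (i x).
Hypothesis ieps : forall x, epsH (i x) = eps x.
Hypothesis SHinj : injective SH.
Variable L : H.
Hypothesis Ll : forall h, h * L = epsH h *: L.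
Hypothesis L1 : epsH L = 1.

Lemma swi x (W : lmodType k) (F : H -> H -> W) :
  (forall b, linear (fun a => F a b)) -> (forall a, linear (F a)) ->
  \sw_(a, b <- DH (i x)) F a b = \sw_(a, b <- D x) F (i a) (i b).
Proof.
by move=> l1 l2; rewrite iD tlift_tlift; apply: eq_tlift => a b; rewrite tliftB.
Qed.

Lemma Sinj : injective S.
Proof. by move=> x y e; apply/iinj/SHinj; rewrite -!iS e. Qed.

Definition Sinv : 'End(K) := (S^-1)%VF.
Lemma lker_antipode : lker S == 0%VS. Proof. by apply/lker0P; apply: Sinj. Qed.
Lemma antipodeKinv x : S (Sinv x) = x. Proof. by rewrite lker0_lfunVK // lker_antipode. Qed.
Lemma SinvK x : Sinv (S x) = x. Proof. by rewrite lker0_lfunK // lker_antipode. Qed.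
Lemma SinvM x y : Sinv (x * y) = Sinv y * Sinv x.
Proof. by apply: Sinj; rewrite antipodeM !antipodeKinv. Qed.
Lemma Sinv1 : Sinv 1 = 1. Proof. by rewrite -[in LHS](antipode1 HK) SinvK. Qed.

(** The antipode axioms for the inverse antipode, with the two legs exchanged. *)
Lemma sw_Sinvr h (W : lmodType k) (F : K -> W) f : linear F ->
  (forall a b, f a b = F (b * Sinv a)) -> tlift f (D h) = eps h *: F 1.
Proof.
move=> lF e; rewrite (eq_tlift _ e) -(tlift_push _ _ lF) -linZ //; congr (F _).
apply: Sinj; rewrite linearZ /= antipode1 -antipoder tlift_lfun.
by apply: eq_tlift => a b; rewrite antipodeM antipodeKinv.
Qed.

Lemma sw_Sinvl h (W : lmodType k) (F : K -> W) f : linear F ->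
  (forall a b, f a b = F (Sinv b * a)) -> tlift f (D h) = eps h *: F 1.
Proof.
move=> lF e; rewrite (eq_tlift _ e) -(tlift_push _ _ lF) -linZ //; congr (F _).
apply: Sinj; rewrite linearZ /= antipode1 -antipodel tlift_lfun.
by apply: eq_tlift => a b; rewrite antipodeM antipodeKinv.
Qed.

Arguments sw_Sinvr {h W F f}.
Arguments sw_Sinvl {h W F f}.

Definition lin_retr : 'Hom(H, K) := (i^-1)%VF.
Lemma lin_retrK x : lin_retr (i x) = x.
Proof. by rewrite lker0_lfunK //; apply/lker0P. Qed.

(** A linear retraction made K-linear by averaging: the trace over K plays the part of
an integral, which is not yet known to exist. On dual bases e_j, e^j of K the map
sends x to the sum of e_{j(3)} e^j(S^-2(e_{j(1)}) r(S^-1(e_{j(2)}) x)), where r is a linear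
retraction. *)
Definition klin_retr_family (x : H) (e : K) : tensor K K :=
  \sw_(a, r <- D e) \sw_(b, c <- D r) (c \ox (Sinv (Sinv a) * lin_retr (i (Sinv b) * x))).
Definition klin_retr (x : H) : K := ptr (klin_retr_family x).

Lemma lin_klin_retr : linear klin_retr.
Proof. by apply: lin_ptr => e; rewrite /klin_retr_family; lin. Qed.

Lemma klin_retr1 : klin_retr 1 = 1.
Proof.
transitivity (ptr (fun e : K => e \ox (1 : K))); last first.
  rewrite /ptr -[RHS]co_sum; by apply: eq_bigr => j _; rewrite tliftB //; lin.
rewrite /klin_retr; apply: eq_ptr => e; rewrite /klin_retr_family.
sw0 by (symmetry; refine (swA _ _ _); lin).
transitivity (\sw_(a, b <- D e) (eps a *: (b \ox (1 : K)))).
  apply: eq_tlift => a b.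
  refine (etrans (sw_Sinvr (F := fun z => b \ox Sinv z) _ _) _); [lin| |by rewrite Sinv1].
  by move=> c d; rewrite mulr1 lin_retrK SinvM.
by refine (sw_counitl (F := fun b => b \ox (1 : K)) _ _); [lin|].
Qed.

(** Write h = h_3 S^-1(h_2) h_1 and move the factors around the trace; the outer
ones then cancel against the arguments of the averaged map. *)
Lemma klin_retrM h x : klin_retr (i h * x) = h * klin_retr x.
Proof.
pose N c g e : tensor K K := 
  \sw_(a, r <- D e) \sw_(b, d <- D r) (d \ox (c * Sinv (Sinv a) * lin_retr (i (Sinv b * g) * x))).
have lN c g : linear (N c g) by rewrite /N; lin.
transitivity (\sw_(a, b <- D h) \sw_(c, d <- D b) ptr (N (d * Sinv c) a)).
  have -> : klin_retr (i h * x) = ptr (N 1 h).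
    rewrite /klin_retr; apply: eq_ptr => e; do 2 (apply: eq_tlift => ? ?).
    by rewrite mul1r iM mulrA.
  symmetry; transitivity (\sw_(a, b <- D h) (eps b *: ptr (N 1 a))).
    apply: eq_tlift => a b.
    refine (etrans (sw_Sinvr (F := fun z => ptr (N z a)) _ _) _); [|by []|by []].
    by apply: lin_ptr => e; rewrite /N; lin.
  refine (sw_counitr (F := fun z => ptr (N 1 z)) _ _); last by [].
  by apply: lin_ptr => e; rewrite /N; lin.
transitivity (\sw_(a, b <- D h) \sw_(c, d <- D b) ptr (fun e => 
   \sw_(e1, r <- D (d * e)) \sw_(e2, e3 <- D r) (e3 \ox (Sinv (Sinv (S c * e1)) * lin_retr (i (Sinv (S a * e2)) * x))))).
  apply: eq_tlift => a b; apply: eq_tlift => c d.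
  rewrite (@ptr_cyc _ _ _ (fun e => 
   \sw_(e1, r <- D e) \sw_(e2, e3 <- D r) (e3 \ox (Sinv (Sinv (S c * e1)) * lin_retr (i (Sinv (S a * e2)) * x)))) (fun e => d * e)); try lin.
  apply: eq_ptr => e; rewrite tlift_tlift; apply: eq_tlift => e1 r.
  rewrite tlift_tlift; apply: eq_tlift => e2 e3; rewrite tliftB; try lin.
  by rewrite !SinvM SinvK !mulrA SinvK.
rewrite [in RHS]/klin_retr /ptr mulr_sumr.
transitivity (\sum_j \sw_(a, b <- D h) \sw_(c, d <- D b) \sw_(e1, r <- D (d * bv j)) \sw_(e2, e3 <- D r) 
   ((co j (Sinv (Sinv (S c * e1)) * lin_retr (i (Sinv (S a * e2)) * x)) : k) *: e3)).
  rewrite tlift_sum; apply: eq_tlift => a b; rewrite tlift_sum; apply: eq_tlift => c d.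
  apply: eq_bigr => j _; rewrite tlift_tlift; apply: eq_tlift => e1 r.
  by rewrite tlift_tlift; apply: eq_tlift => e2 e3; rewrite tliftB //; lin.
apply: eq_bigr => j _; move: (bv j) => e.
rewrite tlift_mulr /klin_retr_family tlift_tlift.
pose G u v w : K := (co j (Sinv (Sinv u) * lin_retr (i (Sinv v) * x)) : k) *: w.
have G1 v w : linear (fun u => G u v w) by rewrite /G; lin.
have G2 u w : linear (fun v => G u v w) by rewrite /G; lin.
have G3 u v : linear (fun w => G u v w) by rewrite /G; lin.
transitivity (\sw_(e1, r <- D e) \sw_(e2, e3 <- D r) G e1 e2 (h * e3)); last first.
  apply: eq_tlift => e1 r; rewrite tlift_tlift; apply: eq_tlift => e2 e3.
  by rewrite tliftB; [rewrite /G -scalerAr|lin|lin].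
transitivity (\sw_(a, b <- D h) \sw_(c, d <- D b) \sw_(d1, d' <- D d) \sw_(d2, d3 <- D d')
   \sw_(e1, r <- D e) \sw_(e2, e3 <- D r) G (S c * (d1 * e1)) (S a * (d2 * e2)) (d3 * e3)).
  apply: eq_tlift => a b; apply: eq_tlift => c d.
  sw0 by (refine (swM _ d e (fun u r => \sw_(e2, e3 <- D r) G (S c * u) (S a * e2) e3) _ _); lin).
  apply: eq_tlift => d1 d'; rewrite [RHS]tliftC; apply: eq_tlift => e1 r.
  by refine (swM _ d' r (fun u v => G (S c * (d1 * e1)) (S a * u) v) _ _); lin.
sw 1 by (symmetry; refine (swA _ _ _); lin).
sw 2 by (refine (sw_antil (F := fun z => \sw_(d2, d3 <- D q0) \sw_(e1, r <- D e) \sw_(e2, e3 <- D r)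
   G (z * e1) (S p * (d2 * e2)) (d3 * e3)) _ _); [lin|move=> c d]).
  by do 3 (apply: eq_tlift => ? ?); rewrite !mulrA.
sw 1 by (refine (sw_counitl (F := fun z => \sw_(d2, d3 <- D z) \sw_(e1, r <- D e) \sw_(e2, e3 <- D r)
   G (1 * e1) (S p * (d2 * e2)) (d3 * e3)) _ _); [lin|by []]).
sw0 by (symmetry; refine (swA _ _ _); lin).
sw 1 by (refine (sw_antil (F := fun z => \sw_(e1, r <- D e) \sw_(e2, e3 <- D r)
   G (1 * e1) (z * e2) (q * e3)) _ _); [lin|move=> c d]).
  by do 2 (apply: eq_tlift => ? ?); rewrite !mulrA.
refine (sw_counitl (F := fun z => \sw_(e1, r <- D e) \sw_(e2, e3 <- D r)
   G e1 e2 (z * e3)) _ _); first by lin.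
by move=> a b; congr (_ *: _); do 2 (apply: eq_tlift => ? ?); rewrite !mul1r.
Qed.

Definition defect (x : H) : H := x - i (klin_retr x).
Local Notation n := (\dim {:H}).

Lemma lin_defect : linear defect.
Proof. by rewrite /defect; have := lin_klin_retr => ?; lin. Qed.

Lemma defectM x h : defect (i x * h) = i x * defect h.
Proof. by rewrite /defect klin_retrM iM mulrBr. Qed.

(** The rank drops because 1 lies in the kernel. *)
Lemma defect_rank : exists2 U : {vspace H}, (forall x, defect x \in U) & (\dim U < n)%N.
Proof.
pose f : 'End(H) := (\1 - (i \o linfun klin_retr))%VF.
have fE x : f x = defect x.
  pose m := GRing.isLinear.Build k H K *:%R klin_retr lin_klin_retr.
  pose M : {linear H -> K} := HB.pack klin_retr m.
  rewrite /f add_lfunE opp_lfunE id_lfunE comp_lfunE; congr (_ - i _).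
  exact: (lfunE M).
exists (limg f); first by move=> x; rewrite -fE memv_img // memvf.
rewrite -(limg_ker_dim f fullv) capfv -[ltnLHS]add0n ltn_add2r lt0n dimv_eq0.
apply/negP => /eqP e0; have : 1 \in lker f.
  by rewrite memv_ker fE /defect klin_retr1 i1 subrr.
by rewrite e0 memv0 oner_eq0.
Qed.

Record hmod (V : vectType k) (rho : H -> V -> V) : Prop := Hmod {
  hmod_l : forall v, linear (fun h => rho h v);
  hmod_r : forall h, linear (rho h);
  hmod1 : forall v, rho 1 v = v;
  hmodM : forall h g v, rho (h * g) v = rho h (rho g v)
}.

(** The identity of the H-module V differs from F by a map that factors K-linearly
through the induced module K (x) V, by way of the section G. For F = 0 this says that
V is relatively projective over K. *)
Record splits_upto (V : vectType k) (rho : H -> V -> V) (F : V -> V)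
    (G : V -> tensor K V) : Prop := SplitsUpto {
  st_linF : linear F;
  st_linG : linear G;
  st_lin : forall x v, G (rho (i x) v) = \sw_(y, w <- G v) ((x * y) \ox w);
  st_id : forall v, v - F v = \sw_(y, w <- G v) rho (i y) w
}.

Definition trho (V : vectType k) (rho : H -> V -> V) (h : H) (t : tensor H V) : tensor H V :=
  \sw_(a, b <- DH h) \sw_(x, v <- t) ((a * x) \ox rho b v).

Lemma trhoE (V : vectType k) (rho : H -> V -> V) : hmod rho -> forall h x v,
  trho rho h (x \ox v) = \sw_(a, b <- DH h) ((a * x) \ox rho b v).
Proof.
by case=> l1 l2 _ _ h x v; apply: eq_tlift => a b; rewrite tliftB //; lin.
Qed.

Lemma hmod_tens (V : vectType k) (rho : H -> V -> V) : hmod rho -> hmod (trho rho).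
Proof.
move=> m; case: (m) => l1 l2 r1 rM.
have lt1 v : linear (fun h => trho rho h v) by rewrite /trho; lin.
have lt2 h : linear (trho rho h) by rewrite /trho; lin.
split=> //.
  apply: lin_tens_eq => [|//|x v]; first exact: lt2.
  by rewrite trhoE // sw1 ?mul1r ?r1 //; lin.
move=> h g; apply: lin_tens_eq; [exact: lt2 | by lin |].
move=> x v; rewrite !trhoE // swM; [|lin|lin].
rewrite (tlift_push _ _ (lt2 h)) tliftC; apply: eq_tlift => a b.
by rewrite trhoE //; apply: eq_tlift => c d; rewrite rM mulrA.
Qed.

Definition tens_defect (V : vectType k) (F : V -> V) (t : tensor H V) : tensor H V :=
  \sw_(x, v <- t) (defect x \ox F v).

(** From x (x) v = i(p(x)) (x) v + d(x) (x) v, with p the retraction klin_retr and d = defect: the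
first term is an element of K acting on 1 (x) S(...).v, and the second is treated by the
section of V. *)
Definition tens_section (V : vectType k) (rho : H -> V -> V) (G : V -> tensor K V) (t : tensor H V) :
    tensor K (tensor H V) :=
  \sw_(x, v <- t) (\sw_(a, b <- D (klin_retr x)) (a \ox ((1 : H) \ox rho (i (S b)) v))
    + \sw_(y, w <- G v) \sw_(a, b <- D y) (b \ox (defect (i (Sinv a) * x) \ox w))).

(** A K-linear section for V yields one for H (x) V, whose error is the tensor
product of the errors. *)
Lemma splits_tens (V : vectType k) (rho : H -> V -> V) F G :
  hmod rho -> splits_upto rho F G -> splits_upto (trho rho) (tens_defect F) (tens_section rho G).
Proof.
move=> m [lF lG GK Gid]; case: (m) => l1 l2 r1 rM.
have lf := lin_klin_retr; have lnf := lin_defect.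
have lt1 v : linear (fun h => trho rho h v) by rewrite /trho; lin.
have lt2 h : linear (trho rho h) by rewrite /trho; lin.
have lG' : linear (tens_section rho G) by rewrite /tens_section; lin.
have tGE x v : tens_section rho G (x \ox v) = \sw_(a, b <- D (klin_retr x)) (a \ox ((1 : H) \ox rho (i (S b)) v))
    + \sw_(y, w <- G v) \sw_(a, b <- D y) (b \ox (defect (i (Sinv a) * x) \ox w)).
  by rewrite /tens_section tliftB //; lin.
split=> //.
- by rewrite /tens_defect; lin.
- move=> h; apply: lin_tens_eq; [by lin | by lin |] => x v.
  rewrite trhoE // (tlift_push _ _ lG') tGE (linD _ _ (@lin_tlift _ _ _ _ _)) swi; [|lin|lin].
  transitivity (\sw_(p, q <- D h) \sw_(a, b <- D (klin_retr (i p * x))) (a \ox ((1 : H) \ox rho (i (S b)) (rho (i q) v)))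
    + \sw_(p, q <- D h) \sw_(y, w <- G (rho (i q) v)) \sw_(a, b <- D y) (b \ox (defect (i (Sinv a) * (i p * x)) \ox w))).
    by rewrite -tlift_add; apply: eq_tlift => p q; rewrite tGE.
  congr (_ + _).
    transitivity (\sw_(p, q <- D h) \sw_(c, d <- D p) \sw_(a, b <- D (klin_retr x))
       ((c * a) \ox ((1 : H) \ox rho (i (S b)) (rho (i (S d * q)) v)))).
      apply: eq_tlift => p q; rewrite klin_retrM.
      rewrite (swM _ p (klin_retr x) (fun a b => a \ox ((1 : H) \ox rho (i (S b)) (rho (i q) v)))); [|lin|lin].
      do 2 (apply: eq_tlift => ? ?).
      by rewrite antipodeM !iM !rM.
    sw0 by (refine (swA _ _ _); lin).
    sw 1 by (refine (sw_antil (F := fun z => \sw_(a, b <- D (klin_retr x))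
       ((p * a) \ox ((1 : H) \ox rho (i (S b)) (rho (i z) v)))) _ _); [lin|by []]).
    refine (etrans (sw_counitr (F := fun z => \sw_(a, b <- D (klin_retr x))
       ((z * a) \ox ((1 : H) \ox rho (i (S b)) (rho (i 1) v)))) _ _) _); [lin|by []|].
    rewrite tlift_tlift; apply: eq_tlift => a b; rewrite tliftB; [|lin|lin].
    by rewrite i1 r1.
  transitivity (\sw_(p, q <- D h) \sw_(c, d <- D q) \sw_(y, w <- G v) \sw_(a, b <- D y)
     ((d * b) \ox (defect (i (Sinv a * (Sinv c * p)) * x) \ox w))).
    apply: eq_tlift => p q; rewrite GK tlift_tlift tliftC; apply: eq_tlift => y w.
    rewrite tliftB; [|lin|lin].
    rewrite (swM _ q y (fun a b => b \ox (defect (i (Sinv a) * (i p * x)) \ox w))); [|lin|lin].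
    do 2 (apply: eq_tlift => ? ?).
    by rewrite SinvM !iM !mulrA.
  sw0 by (symmetry; refine (swA _ _ _); lin).
  sw 1 by (refine (sw_Sinvl (F := fun z => \sw_(y, w <- G v) \sw_(a, b <- D y)
     ((q * b) \ox (defect (i (Sinv a * z) * x) \ox w))) _ _); [lin|by []]).
  refine (etrans (sw_counitl (F := fun z => \sw_(y, w <- G v) \sw_(a, b <- D y)
     ((z * b) \ox (defect (i (Sinv a * 1) * x) \ox w))) _ _) _); [lin|by []|].
  rewrite tlift_tlift; apply: eq_tlift => y w; rewrite tlift_tlift; apply: eq_tlift => a b.
  by rewrite tliftB ?mulr1 //; lin.
apply: lin_tens_eq; [by rewrite /tens_defect; lin | by lin |] => x v.
rewrite tGE (linD _ _ (@lin_tlift _ _ _ _ _)) /tens_defect tliftB; [|lin|lin].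
transitivity (i (klin_retr x) \ox v + defect x \ox (v - F v)).
  rewrite (linD _ _ (@lin_tens_r _ _ _ (defect x))) (linN _ (@lin_tens_r _ _ _ (defect x))).
  rewrite addrA -(linD _ _ (@lin_tens_l _ _ _ v)); congr (_ \ox _ - _).
  by rewrite /defect addrC subrK.
congr (_ + _).
  rewrite tlift_tlift; symmetry.
  transitivity (\sw_(a, b <- D (klin_retr x)) \sw_(c, d <- D a) (i c \ox rho (i (d * S b)) v)).
    apply: eq_tlift => a b; rewrite tliftB; [|lin|lin].
    rewrite trhoE // swi; [|lin|lin]; apply: eq_tlift => c d.
    by rewrite mulr1 iM rM.
  sw0 by (refine (swA _ _ _); lin).
  sw 1 by (refine (sw_antir (F := fun z => i p \ox rho (i z) v) _ _); [lin|by []]).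
  refine (etrans (sw_counitr (F := fun z => i z \ox rho (i 1) v) _ _) _); [lin|by []|].
  by rewrite i1 r1.
rewrite Gid !tlift_tlift tlift_tensr; apply: eq_tlift => y w; rewrite tlift_tlift; symmetry.
transitivity (\sw_(a, b <- D y) \sw_(c, d <- D b) (defect (i (c * Sinv a) * x) \ox rho (i d) w)).
  apply: eq_tlift => a b; rewrite tliftB; [|lin|lin].
  rewrite trhoE // swi; [|lin|lin]; apply: eq_tlift => c d.
  by rewrite -defectM iM mulrA.
sw0 by (symmetry; refine (swA _ _ _); lin).
sw 1 by (refine (sw_Sinvr (F := fun z => defect (i z * x) \ox rho (i q) w) _ _); [lin|by []]).
refine (etrans (sw_counitl (F := fun z => defect (i 1 * x) \ox rho (i z) w) _ _) _); [lin|by []|].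
by rewrite i1 mul1r.
Qed.

(** The values of F span at most the fraction ((n - 1)/n)^j of V. *)
Definition small_defect j := exists (V : vectType k) (rho : H -> V -> V) (F : V -> V)
    (G : V -> tensor K V) (U : {vspace V}),
  [/\ hmod rho, splits_upto rho F G, forall v, F v \in U,
      (\dim U * n ^ j <= n.-1 ^ j * \dim {:V})%N & (0 < \dim {:V})%N].

Lemma small_defect0 : small_defect 0.
Proof.
exists k^o, (fun h (c : k^o) => epsH h *: c), id, (fun _ => 0), fullv.
split=> //.
- split=> [v|h|v|h g v]; [by lin | by lin | by rewrite counit1 scale1r|].
  by rewrite counitM scalerA.
- split=> // [|x v|v]; [|by rewrite linear0|by rewrite linear0 subrr].
  by move=> c u v; rewrite scaler0 addr0.
- by move=> v; apply: memvf.
- by rewrite !expn0 mul1n muln1.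
- by rewrite dimvf.
Qed.

Lemma small_defectS j : small_defect j -> small_defect j.+1.
Proof.
case=> V [rho [F [G [U [m st FU le V0]]]]].
have [X fX ltX] := defect_rank.
exists (tensor H V), (trho rho), (tens_defect F), (tens_section rho G), (tensv X U).
split=> //; first exact: hmod_tens.
- exact: splits_tens.
- by move=> t; apply: tlift_mem => x v; apply: mem_tensv.
- rewrite dim_tensor expnS (expnS n.-1); apply: leq_trans (leq_mul (dim_tensv _ _) (leqnn _)) _.
  apply: (@leq_trans (n.-1 * n * (\dim U * n ^ j))%N).
    rewrite [(n.-1 * n)%N]mulnC mulnACA leq_mul // mulnC leq_mul //.
    by rewrite -ltnS prednK // (leq_ltn_trans _ ltX).
  apply: leq_trans (leq_mul (leqnn _) le) _.
  by rewrite -!mulnA leq_mul // [X in (_ <= X)%N]mulnCA leq_mul // mulnCA.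
- by rewrite dim_tensor muln_gt0 V0 (leq_ltn_trans _ ltX).
Qed.

(** Bernoulli's inequality without division. *)
Lemma pow_grow m j : (m ^ j * m + j * m ^ j <= m.+1 ^ j * m)%N.
Proof.
elim: j => [|j ih]; first by rewrite !expn0 !mul1n mul0n addn0.
rewrite !expnS; move: ih; move: (m ^ j)%N (m.+1 ^ j)%N => a b ih.
have : (m.+1 * (a * m + j * a) <= m.+1 * (b * m))%N by rewrite leq_mul.
by nia.
Qed.

(** The exponent n^2 makes ((n - 1)/n)^j smaller than 1/n. *)
Lemma small_split : exists (V : vectType k) (rho : H -> V -> V) (F : V -> V)
    (G : V -> tensor K V) (U : {vspace V}),
  [/\ hmod rho, splits_upto rho F G, forall v, F v \in U,
      (n * \dim U < \dim {:V})%N & (0 < \dim {:V})%N].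
Proof.
have sm j : small_defect j by elim: j => [|j]; [exact: small_defect0 | exact: small_defectS].
have [X _ ltX] := defect_rank.
have n0 : (0 < n)%N by rewrite (leq_ltn_trans _ ltX).
pose j := (n * n)%N.
have [V [rho [F [G [U [m st FU le V0]]]]]] := sm j.
exists V, rho, F, G, U; split=> //.
have nj : (0 < n ^ j)%N by rewrite expn_gt0 n0.
rewrite -(ltn_pmul2r nj) -mulnA; apply: leq_ltn_trans (leq_mul (leqnn _) le) _.
rewrite mulnA [(\dim {:V} * _)%N]mulnC ltn_pmul2r //.
have := pow_grow n.-1 j; rewrite prednK //; rewrite /j.
case: (posnP n.-1) => [-> _|p0].
  by rewrite exp0n ?muln_gt0 ?n0 // muln0 expn_gt0 n0.
move=> le2; rewrite -(ltn_pmul2r p0); apply: leq_trans le2.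
have a0 : (0 < n.-1 ^ (n * n))%N by rewrite expn_gt0 p0.
move: a0; move: (_ ^ _)%N => a a0.
by move: p0 n0; case: (n) => // p; case: p => // p _ _; rewrite /=; nia.
Qed.

(** Z y = L_1 (x) F(L_2 y) takes values in H (x) U, whose dimension is less than that of V,
so Z kills some y <> 0. Then the sum of P(L_1, L_2 y), with P built from the
section G and a functional eta with eta(y) = 1, is an integral: K-linearity of P moves h onto
L. Its counit is eta(S(L_1) L_2 y) minus a term that vanishes with Z y. *)
Theorem subhopf_integral : exists L', 
  (forall h, h * L' = eps h *: L') /\ eps L' = 1.
Proof.
have [V [rho [F [G [U [m st FU le V0]]]]]] := small_split.
case: (m) => l1 l2 r1 rM; case: (st) => lF lG GK Gid.
pose Z y : tensor H V := \sw_(a, b <- DH L) (a \ox F (rho b y)).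
have lZ : linear Z by rewrite /Z; lin.
have [y y0 Zy] : exists2 y, y != 0 & Z y = 0.
  pose mx := GRing.isLinear.Build k V (tensor H V) *:%R Z lZ.
  pose M : {linear V -> tensor H V} := HB.pack Z mx.
  pose f := linfun M.
  have : (0 < \dim (lker f))%N.
    have := limg_ker_dim f fullv; rewrite capfv.
    have : (\dim (limg f) < \dim {:V})%N.
      apply: leq_ltn_trans le; rewrite -[X in (_ <= X * _)%N]/n.
      apply: leq_trans (dim_tensv fullv U).
      apply: dimvS; apply/subvP => _ /memv_imgP[v _ ->]; rewrite lfunE.
      by apply: tlift_mem => a b; apply: mem_tensv; rewrite ?memvf.
    by lia.
  rewrite lt0n dimv_eq0 => nz.
  exists (vpick (lker f)); first by rewrite vpick0.
  by have := memv_pick (lker f); rewrite memv_ker lfunE => /eqP.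
have [c cy] : exists c, (co c y : k) != 0.
  apply/existsP; apply: contraNT y0 => /existsPn h; apply/eqP.
  rewrite -(co_sum y) big1 // => c _; move: (h c); rewrite negbK => /eqP ->.
  by rewrite scale0r.
pose eta v : k^o := (co c y : k)^-1 *: co c v.
have leta : linear eta by rewrite /eta; lin.
have eta1 : eta y = 1 by rewrite /eta /GRing.scale /= mulVf.
pose P x v : K := \sw_(q, w <- G v) \sw_(a, b <- D q) ((eta (rho (SH (i (Sinv a) * x)) w) : k) *: b).
have lP1 v : linear (fun x => P x v) by rewrite /P; lin.
have lP2 x : linear (P x) by rewrite /P; lin.
have PK h x v : \sw_(a, b <- D h) P (i a * x) (rho (i b) v) = h * P x v.
  transitivity (\sw_(p, q <- D h) \sw_(d, e <- D q) \sw_(y, w <- G v) \sw_(a, b <- D y)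
    ((eta (rho (SH (i (Sinv a * (Sinv d * p)) * x)) w) : k) *: (e * b))).
    apply: eq_tlift => p q; rewrite /P GK tlift_tlift tliftC; apply: eq_tlift => z w.
    rewrite tliftB; [|lin|lin].
    rewrite (swM _ q z (fun a b => (eta (rho (SH (i (Sinv a) * (i p * x))) w) : k) *: b)); [|lin|lin].
    do 2 (apply: eq_tlift => ? ?).
    by rewrite SinvM !iM !mulrA.
  sw0 by (symmetry; refine (swA _ _ _); lin).
  sw 1 by (refine (sw_Sinvl (F := fun z => \sw_(y, w <- G v) \sw_(a, b <- D y)
     ((eta (rho (SH (i (Sinv a * z) * x)) w) : k) *: (q * b))) _ _); [lin|by []]).
  refine (etrans (sw_counitl (F := fun z => \sw_(y, w <- G v) \sw_(a, b <- D y)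
     ((eta (rho (SH (i (Sinv a * 1) * x)) w) : k) *: (z * b))) _ _) _); [lin|by []|].
  rewrite /P tlift_mulr; apply: eq_tlift => q w; rewrite tlift_mulr; apply: eq_tlift => a b.
  by rewrite mulr1 scalerAr.
exists (\sw_(a, b <- DH L) P a (rho b y)); split.
  move=> h.
  transitivity (\sw_(p, q <- DH (i h)) \sw_(a, b <- DH L) P (p * a) (rho (q * b) y)).
    rewrite swi; [|lin|lin]; rewrite tliftC tlift_mulr; apply: eq_tlift => a b.
    by rewrite -PK; apply: eq_tlift => p q; rewrite rM.
  rewrite -(swM _ (i h) L (fun a b => P a (rho b y))); [|lin|lin].
  rewrite Ll linearZ /= (linZ _ _ (@lin_tlift _ _ _ _ _)).
  by rewrite ieps.
rewrite -[RHS]eta1 -[in RHS](r1 y).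
transitivity (\sw_(a, b <- DH L) (eta (rho (SH a * b) y) - eta (rho (SH a) (F (rho b y))))).
  rewrite tlift_lfun; apply: eq_tlifts => a b.
  transitivity (\sw_(q, w <- G (rho b y)) eta (rho (SH a) (rho (i q) w))).
    rewrite /P tlift_lfun; apply: eq_tlift => q w; rewrite tlift_lfun.
    refine (etrans (sw_counitr (F := fun z => eta (rho (SH (i (Sinv z) * a)) w)) _ _) _); [lin| |].
      by move=> c0 d; rewrite linearZ /=; apply: mulrC.
    by rewrite antipodeM rM -iS antipodeKinv.
  rewrite -(tlift_push (L := fun z => eta (rho (SH a) z))); last by lin.
  by rewrite -Gid (linB _ _ (l2 _)) (linB _ _ leta) rM.
rewrite tlift_sub.
have -> : \sw_(a, b <- DH L) eta (rho (SH a) (F (rho b y))) = 0.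
  transitivity (tlift (fun a v => eta (rho (SH a) v)) (Z y)).
    by rewrite /Z tlift_tlift; apply: eq_tlift => a b; rewrite tliftB //; lin.
  by rewrite Zy (lin0 (@lin_tlift _ _ _ _ _)).
rewrite subr0 (sw_antil (F := fun z => eta (rho z y))) //; last by lin.
by rewrite L1 scale1r.
Qed.

End SubHopf.

(** * Hopf structure on a stable subspace; integrals of semisimple Hopf algebras *)

(** P is a linear retraction of the inclusion i, and Di and Si say that the image of i is
stable under coproduct and antipode. *)
Section Build.
Variables (k : fieldType) (H : falgType k) (HH : hopf_algebra H).
Variables (K : falgType k) (i : 'Hom(K, H)) (P : 'Hom(H, K)).
Local Notation S := (antipode HH).
Local Notation D := (comul HH).
Local Notation eps h := (counit HH h : k).
Hypothesis Pi : forall x, P (i x) = x.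
Hypothesis iM : forall x y, i (x * y) = i x * i y.
Hypothesis i1 : i 1 = 1.
Hypothesis Di : forall x, D (i x) = \sw_(a, b <- D (i x)) (i (P a) \ox i (P b)).
Hypothesis Si : forall x, i (P (S (i x))) = S (i x).

Let iinj : injective i. Proof. by move=> x y e; rewrite -(Pi x) e Pi. Qed.

Lemma sub_lin : linear (fun x => \sw_(a, b <- D (i x)) (P a \ox P b)).
Proof. by lin. Qed.

Definition sub_comul : 'Hom(K, tensor K K) := lhom sub_lin.
Definition sub_counit : 'Hom(K, k^o) := (counit HH \o i)%VF.
Definition sub_antipode : 'End(K) := (P \o (S \o i))%VF.

Lemma sub_sw x (W : lmodType k) (F : K -> K -> W) :
  (forall b, linear (fun a => F a b)) -> (forall a, linear (F a)) ->
  \sw_(a, b <- sub_comul x) F a b = \sw_(a, b <- D (i x)) F (P a) (P b).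
Proof.
move=> l1 l2; rewrite lhomE tlift_tlift; apply: eq_tlift => a b.
by rewrite tliftB.
Qed.

Lemma sub_swP x (W : lmodType k) (F : H -> H -> W) :
  (forall b, linear (fun a => F a b)) -> (forall a, linear (F a)) ->
  \sw_(a, b <- D (i x)) F (i (P a)) (i (P b)) = \sw_(a, b <- D (i x)) F a b.
Proof.
move=> l1 l2; rewrite [in RHS]Di tlift_tlift; apply: eq_tlift => a b.
by rewrite tliftB.
Qed.

Lemma sub_swi x (W : lmodType k) (F : H -> H -> W) :
  (forall b, linear (fun a => F a b)) -> (forall a, linear (F a)) ->
  \sw_(a, b <- sub_comul x) F (i a) (i b) = \sw_(a, b <- D (i x)) F a b.
Proof. by move=> l1 l2; rewrite sub_sw ?sub_swP //; lin. Qed.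

Lemma sub_comulA h :
  \sw_(h1, h2 <- sub_comul h) \sw_(h11, h12 <- sub_comul h1) (h11 \ox h12 \ox h2) =
  \sw_(h1, h2 <- sub_comul h) \sw_(h21, h22 <- sub_comul h2) (h1 \ox h21 \ox h22).
Proof.
transitivity (\sw_(a, b <- D (i h)) \sw_(c, d <- D a) (P c \ox P d \ox P b)).
  rewrite -sub_swi; [|lin|lin]; apply: eq_tlift => a b.
  by rewrite sub_sw ?Pi; lin.
transitivity (\sw_(a, b <- D (i h)) \sw_(c, d <- D b) (P a \ox P c \ox P d)).
  by refine (swA _ _ _); lin.
rewrite -sub_swi; [|lin|lin]; apply: eq_tlift => a b.
by rewrite sub_sw ?Pi; lin.
Qed.

Lemma sub_counitE x : sub_counit x = counit HH (i x).
Proof. by rewrite comp_lfunE. Qed.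
Lemma sub_antipodeE x : i (sub_antipode x) = S (i x).
Proof. by rewrite !comp_lfunE. Qed.

Lemma sub_counitl h : \sw_(h1, h2 <- sub_comul h) (sub_counit h1 *: h2) = h.
Proof.
apply: iinj; rewrite tlift_lfun.
transitivity (\sw_(a, b <- D (i h)) (eps a *: b)); last exact: counitl.
rewrite -sub_swi; [|lin|lin]; apply: eq_tlift => a b.
by rewrite linearZ /= sub_counitE.
Qed.

Lemma sub_counitr h : \sw_(h1, h2 <- sub_comul h) (sub_counit h2 *: h1) = h.
Proof.
apply: iinj; rewrite tlift_lfun.
transitivity (\sw_(a, b <- D (i h)) (eps b *: a)); last exact: counitr.
rewrite -sub_swi; [|lin|lin]; apply: eq_tlift => a b.
by rewrite linearZ /= sub_counitE.
Qed.

Lemma sub_comulM h g : sub_comul (h * g) = tmul (sub_comul h) (sub_comul g).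
Proof.
rewrite lhomE iM swM; [|lin|lin].
rewrite /tmul.
transitivity (\sw_(a, b <- D (i h)) \sw_(c, d <- sub_comul g) (P (a * i c) \ox P (b * i d))).
  by apply: eq_tlift => a b; rewrite (@sub_swi _ _ (fun c d => P (a * c) \ox P (b * d))) //; lin.
rewrite -sub_swi; [|lin|lin]; apply: eq_tlift => a b; apply: eq_tlift => c d.
by rewrite -!iM !Pi.
Qed.

Lemma sub_comul1 : sub_comul 1 = 1 \ox 1.
Proof. by rewrite lhomE i1 sw1 -?i1 ?Pi //; lin. Qed.

Lemma sub_counitM h g : sub_counit (h * g) = (sub_counit h : k) * sub_counit g.
Proof. by rewrite !sub_counitE iM counitM. Qed.

Lemma sub_counit1 : sub_counit 1 = 1.
Proof. by rewrite sub_counitE i1 counit1. Qed.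

Lemma sub_antipodel h :
  \sw_(h1, h2 <- sub_comul h) (sub_antipode h1 * h2) = sub_counit h *: 1.
Proof.
apply: iinj; rewrite tlift_lfun linearZ /= i1 sub_counitE -antipodel.
rewrite -sub_swi; [|lin|lin]; apply: eq_tlift => a b.
by rewrite iM sub_antipodeE.
Qed.

Lemma sub_antipoder h :
  \sw_(h1, h2 <- sub_comul h) (h1 * sub_antipode h2) = sub_counit h *: 1.
Proof.
apply: iinj; rewrite tlift_lfun linearZ /= i1 sub_counitE -antipoder.
rewrite -sub_swi; [|lin|lin]; apply: eq_tlift => a b.
by rewrite iM sub_antipodeE.
Qed.

Definition sub_hopf : hopf_algebra K :=
  HopfAlgebra sub_comulA sub_counitl sub_counitr sub_comulM sub_comul1 sub_counitM
    sub_counit1 sub_antipodel sub_antipoder.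

Lemma sub_comul_i x : D (i x) = \sw_(a, b <- comul sub_hopf x) (i a \ox i b).
Proof. by rewrite /= (@sub_swi _ _ (fun a b => a \ox b)) ?tlift_tens //; lin. Qed.

End Build.

Section Semisimple.
Variables (k : fieldType) (H : falgType k) (HH : hopf_algebra H).

(** A complement of the augmentation ideal is spanned by an integral. *)
Lemma semisimple_integral : semisimple H -> exists L,
  (forall h, h * L = (counit HH h : k) *: L) /\ (counit HH L : k) = 1.
Proof.
move=> ss; have [|J [lJ IJ IJ0]] := ss (lker (counit HH)).
  by move=> h a; rewrite !memv_ker counitM => /eqP ->; rewrite mulr0.
have : 1 \in (lker (counit HH) + J)%VS by rewrite IJ memvf.
case/memv_addP => e eI [L LJ e1]; exists L.
have eL : (counit HH L : k) = 1.
  have := counit1 HH; rewrite e1 linearD /=; move: eI; rewrite memv_ker => /eqP ->.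
  by rewrite add0r.
split=> // h; apply/eqP; rewrite -subr_eq0 -memv0 -IJ0 memv_cap; apply/andP; split.
  by rewrite memv_ker linearB /= counitM eL linearZ /= eL mulr1 /GRing.scale /= mulr1 subrr.
by rewrite rpredB ?lJ ?rpredZ.
Qed.
End Semisimple.

(** * The legs of the R-matrix *)

Section SubSpace.
Variables (k : fieldType) (char0 : [pchar k] =i pred0).
Variables (H : falgType k) (HH : hopf_algebra H).
Local Notation S := (antipode HH).
Local Notation D := (comul HH).
Local Notation eps h := (counit HH h : k).
Variables (X : {vspace H}).
Hypothesis X1 : 1 \in X.
Hypothesis XM : forall x y, x \in X -> y \in X -> x * y \in X.
Hypothesis XD : forall x, x \in X -> D x \in tensv X X.
Hypothesis XS : forall x, x \in X -> S x \in X.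
Hypothesis Sinj : injective S.

Fact X_aspace : is_aspace X.
Proof.
rewrite /is_aspace has_algid1 //=; apply/prodvP => x y; exact: XM.
Qed.
Let KX : {aspace H} := ASpace X_aspace.
Let K : falgType k := subvs_of KX.

Fact lin_val : linear (fun x : K => vsval x). Proof. by move=> c u v; rewrite linearP. Qed.
Fact lin_proj : linear (fun x : H => vsproj KX x : K). Proof. by move=> c u v; rewrite linearP. Qed.
Let i : 'Hom(K, H) := lhom lin_val.
Let P : 'Hom(H, K) := lhom lin_proj.
Let iE x : i x = vsval x. Proof. exact: lhomE. Qed.
Let PE x : P x = vsproj KX x. Proof. exact: lhomE. Qed.
Let Pi x : P (i x) = x.
Proof. by rewrite PE iE vsvalK. Qed.
Let iP x : x \in X -> i (P x) = x.
Proof. by move=> xX; rewrite PE iE vsprojK. Qed.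
Let iX x : i x \in X. Proof. by rewrite iE; exact: subvsP. Qed.
Let iM x y : i (x * y) = i x * i y. Proof. by rewrite !iE. Qed.
Let i1 : i 1 = 1. Proof. by rewrite iE; apply/eqP; rewrite -[X in X == _]/(algid KX) algid_eq1. Qed.
Let Di x : D (i x) = \sw_(a, b <- D (i x)) (i (P a) \ox i (P b)).
Proof.
have lf : linear (tlift (fun a b => i (P a) \ox i (P b))) by lin.
have /subvP sub : (tensv X X <= lker (lhom lf - \1%VF))%VS.
  apply/span_subvP => _ /allpairsP[[u v] /= [uX vX ->]].
  rewrite memv_ker add_lfunE opp_lfunE id_lfunE lhomE tliftB; [|lin|lin].
  by rewrite !iP ?subrr //; apply: vbasis_mem.
have := sub _ (XD (iX x)).
by rewrite memv_ker add_lfunE opp_lfunE id_lfunE lhomE subr_eq0 => /eqP/esym.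
Qed.
Let Si x : i (P (S (i x))) = S (i x).
Proof. by rewrite iP // XS. Qed.
Let HK := sub_hopf Pi iM i1 Di Si.

Variable L : H.
Hypothesis Ll : forall h, h * L = eps h *: L.
Hypothesis L1 : eps L = 1.

Let iinj : injective i. Proof. by move=> x y e; rewrite -(Pi x) e Pi. Qed.

Lemma sub_integral : exists2 L', L' \in X &
  (forall h, h \in X -> h * L' = eps h *: L') /\ eps L' = 1.
Proof.
have [] := @subhopf_integral k H HH K HK i iinj iM i1 _ _ _ Sinj L Ll L1.
- exact: sub_comul_i.
- by move=> x; rewrite /= sub_antipodeE.
- by move=> x; rewrite /= sub_counitE.
move=> L' [L'l L'1]; exists (i L') => //; split; last by rewrite -L'1 /= sub_counitE.
move=> h hX; rewrite -(iP hX) -iM L'l linearZ /=; congr (_ *: _).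
by rewrite sub_counitE.
Qed.

Lemma sub_involutive (lam : 'Hom(H, k^o)) :
  (forall h, h \in X -> \sw_(a, b <- D h) ((lam a : k) *: b) = (lam h : k) *: 1) ->
  lam 1 = 1 -> forall h, h \in X -> S (S h) = h.
Proof.
move=> laml lam1 h hX; have [L' L'X [L'l L'1]] := sub_integral.
have SE x : i (antipode HK x) = S (i x) by rewrite /= sub_antipodeE.
rewrite -(iP hX) -!SE; congr (i _).
apply: (@antipode_involutive k char0 K HK _ (P L') (lam \o i)%VF).
- by move=> x y e; apply/iinj/Sinj; rewrite -!SE e.
- move=> x; apply: iinj; rewrite iM iP // L'l // linearZ /= iP //; congr (_ *: _).
  by rewrite sub_counitE.
- by rewrite /= sub_counitE iP.
- move=> x; apply: iinj; rewrite tlift_lfun linearZ /= i1 comp_lfunE -laml //.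
  rewrite -(sub_swi Di); [|lin|lin]; apply: eq_tlift => a b.
  by rewrite linearZ /= comp_lfunE.
- by rewrite comp_lfunE i1.
Qed.

(** Since S^2 = 1 on X, this is S applied to the antipode axiom S(a)b. *)
Lemma sub_cop (inv : forall h, h \in X -> S (S h) = h) h : h \in X ->
  \sw_(a, b <- D h) (S b * a) = eps h *: 1.
Proof.
move=> hX; rewrite -(iP hX) -(sub_swi Di) /=; [|lin|lin].
transitivity (\sw_(a, b <- comul HK (P h)) S (S (i a) * i b)).
  by apply: eq_tlift => a b; rewrite antipodeM inv.
rewrite /= -(tlift_push (L := fun z => S z)); last by lin.
transitivity (S (i (\sw_(a, b <- comul HK (P h)) (antipode HK a * b)))).
  by rewrite [in RHS]tlift_lfun; congr (S _); apply: eq_tlift => a b; rewrite iM /= sub_antipodeE.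
by rewrite antipodel !linearZ /= i1 antipode1 sub_counitE.
Qed.
End SubSpace.

Section Legs.
Variables (k : fieldType) (char0 : [pchar k] =i pred0).
Variables (H : falgType k) (HH : hopf_algebra H).
Variables (R : tensor H H) (qtR : quasitriangular HH R) (ssH : semisimple H).
Local Notation S := (antipode HH).
Local Notation D := (comul HH).
Local Notation eps h := (counit HH h : k).
Implicit Types f g : 'Hom(H, k^o).

(** The legs of R are the images of these maps from the dual of H. *)
Definition legr f : H := \sw_(r, s <- R) ((f r : k) *: s).
Definition legl f : H := \sw_(r, s <- R) ((f s : k) *: r).
Lemma lin_legr : linear legr. Proof. by rewrite /legr; lin. Qed.
Lemma lin_legl : linear legl. Proof. by rewrite /legl; lin. Qed.
Definition Xr := limg (lhom lin_legr).
Definition Xl := limg (lhom lin_legl).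

Lemma legr_mem f : legr f \in Xr.
Proof. by rewrite -(lhomE lin_legr) memv_img // memvf. Qed.
Lemma legl_mem f : legl f \in Xl.
Proof. by rewrite -(lhomE lin_legl) memv_img // memvf. Qed.
Lemma XrP x : x \in Xr -> exists f, x = legr f.
Proof. by case/memv_imgP => f _ ->; exists f; rewrite lhomE. Qed.
Lemma XlP x : x \in Xl -> exists f, x = legl f.
Proof. by case/memv_imgP => f _ ->; exists f; rewrite lhomE. Qed.

Lemma Sinj_qt : injective S. Proof. exact: antipode_inj qtR. Qed.

Lemma Xr1 : 1 \in Xr.
Proof.
have -> : 1 = legr (counit HH) by rewrite -[LHS](counitR_l qtR).
exact: legr_mem.
Qed.
Lemma Xl1 : 1 \in Xl.
Proof.
have -> : 1 = legl (counit HH) by rewrite -[LHS](counitR_r qtR).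
exact: legl_mem.
Qed.

(** The hexagon axioms make legr and legl multiplicative up to order for the convolution
product of the dual, and dually they make the legs stable under the coproduct. *)
Lemma XrM x y : x \in Xr -> y \in Xr -> x * y \in Xr.
Proof.
move=> /XrP[f ->] /XrP[g ->].
have lc : linear (fun h => \sw_(a, b <- D h) ((f a : k) * (g b : k) : k^o)) by lin.
have -> : legr f * legr g = legr (lhom lc); last exact: legr_mem.
rewrite /legr tlift_mull.
transitivity (\sw_(r, s <- R) \sw_(r', s' <- R) (((f r : k) * (g r' : k)) *: (s * s'))).
  apply: eq_tlift => r s; rewrite tlift_mulr; apply: eq_tlift => r' s'.
  by rewrite -scalerAl -scalerAr scalerA.
rewrite -(swRl qtR (fun a b s => ((f a : k) * (g b : k)) *: s)); try lin.
apply: eq_tlift => r s; rewrite lhomE.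
by rewrite (tlift_push (L := fun z : k^o => (z : k) *: s)); lin.
Qed.

Lemma XlM x y : x \in Xl -> y \in Xl -> x * y \in Xl.
Proof.
move=> /XlP[f ->] /XlP[g ->].
have lc : linear (fun h => \sw_(a, b <- D h) ((g a : k) * (f b : k) : k^o)) by lin.
have -> : legl f * legl g = legl (lhom lc); last exact: legl_mem.
rewrite /legl tlift_mull.
transitivity (\sw_(r, s <- R) \sw_(r', s' <- R) (((g s' : k) * (f s : k)) *: (r * r'))).
  apply: eq_tlift => r s; rewrite tlift_mulr; apply: eq_tlift => r' s'.
  by rewrite -scalerAl -scalerAr scalerA mulrC.
rewrite -(swRr qtR (fun r a b => ((g a : k) * (f b : k)) *: r)); try lin.
apply: eq_tlift => r s; rewrite lhomE.
by rewrite (tlift_push (L := fun z : k^o => (z : k) *: r)); lin.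
Qed.

Lemma lin_co' (j : 'I_(\dim {:H})) : linear (fun z : H => co j z). Proof. exact: lin_co. Qed.

Lemma XrD x : x \in Xr -> D x \in tensv Xr Xr.
Proof.
move=> /XrP[f ->].
have -> : D (legr f) = \sw_(r, s <- R) \sw_(r', s' <- R) ((f (r * r') : k) *: (s' \ox s)).
  rewrite -(swRr qtR (fun r a b => (f r : k) *: (a \ox b))); try lin.
  rewrite /legr tlift_lfun; apply: eq_tlift => r s.
  rewrite linearZ /= -[in LHS](tlift_tens (D s)).
  by rewrite tliftZ.
have lf j : linear (fun r => f (bv j * r)) by lin.
have -> : \sw_(r, s <- R) \sw_(r', s' <- R) ((f (r * r') : k) *: (s' \ox s)) =
   \sum_j (legr (lhom (lf j)) \ox legr (lhom (lin_co' j))).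
  transitivity (\sum_j \sw_(r, s <- R) \sw_(r', s' <- R) (((co j r : k) * (f (bv j * r') : k)) *: (s' \ox s))).
    rewrite tlift_sum; apply: eq_tlift => r s; rewrite tlift_sum; apply: eq_tlift => r' s'.
    rewrite -scaler_suml; congr (_ *: _).
    by rewrite (lin_expand (f := fun r => f (r * r')) r) //; lin.
  apply: eq_bigr => j _; rewrite /legr tlift_tensr; apply: eq_tlift => r s.
  rewrite tlift_tensl; apply: eq_tlift => r' s'; rewrite !lhomE.
  by rewrite [RHS](linZ _ _ (@lin_tens_r _ _ _ _)) (linZ _ _ (@lin_tens_l _ _ _ _)) scalerA.
by apply: memv_suml => j _; apply: mem_tensv; apply: legr_mem.
Qed.

Lemma XlD x : x \in Xl -> D x \in tensv Xl Xl.
Proof.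
move=> /XlP[f ->].
have -> : D (legl f) = \sw_(r, s <- R) \sw_(r', s' <- R) ((f (s * s') : k) *: (r \ox r')).
  rewrite -(swRl qtR (fun a b s => (f s : k) *: (a \ox b))); try lin.
  rewrite /legl tlift_lfun; apply: eq_tlift => r s.
  rewrite linearZ /= -[in LHS](tlift_tens (D r)).
  by rewrite tliftZ.
have lf j : linear (fun r => f (bv j * r)) by lin.
have -> : \sw_(r, s <- R) \sw_(r', s' <- R) ((f (s * s') : k) *: (r \ox r')) =
   \sum_j (legl (lhom (lin_co' j)) \ox legl (lhom (lf j))).
  transitivity (\sum_j \sw_(r, s <- R) \sw_(r', s' <- R) (((co j s : k) * (f (bv j * s') : k)) *: (r \ox r'))).
    rewrite tlift_sum; apply: eq_tlift => r s; rewrite tlift_sum; apply: eq_tlift => r' s'.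
    rewrite -scaler_suml; congr (_ *: _).
    by rewrite (lin_expand (f := fun s => f (s * s')) s) //; lin.
  apply: eq_bigr => j _; rewrite /legl tlift_tensl; apply: eq_tlift => r s.
  rewrite tlift_tensr; apply: eq_tlift => r' s'; rewrite !lhomE.
  by rewrite [RHS](linZ _ _ (@lin_tens_r _ _ _ _)) (linZ _ _ (@lin_tens_l _ _ _ _)) scalerA mulrC.
by apply: memv_suml => j _; apply: mem_tensv; apply: legl_mem.
Qed.

Let Sinv : 'End(H) := (S^-1)%VF.
Let SinvK x : Sinv (S x) = x.
Proof. by rewrite lker0_lfunK //; apply/lker0P; apply: Sinj_qt. Qed.

Lemma XrS x : x \in Xr -> S x \in Xr.
Proof.
move=> /XrP[f ->]; have -> : S (legr f) = legr (f \o Sinv)%VF; last exact: legr_mem.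
rewrite /legr tlift_lfun.
transitivity (\sw_(r, s <- R) ((f (Sinv (S r)) : k) *: S s)).
  by apply: eq_tlift => r s; rewrite SinvK linearZ.
rewrite (swR_SS qtR (fun a b => (f (Sinv a) : k) *: b)); try lin.
by apply: eq_tlift => r s; rewrite comp_lfunE.
Qed.

Lemma XlS x : x \in Xl -> S x \in Xl.
Proof.
move=> /XlP[f ->]; have -> : S (legl f) = legl (f \o Sinv)%VF; last exact: legl_mem.
rewrite /legl tlift_lfun.
transitivity (\sw_(r, s <- R) ((f (Sinv (S s)) : k) *: S r)).
  by apply: eq_tlift => r s; rewrite SinvK linearZ.
rewrite (swR_SS qtR (fun a b => (f (Sinv b) : k) *: a)); try lin.
by apply: eq_tlift => r s; rewrite comp_lfunE.
Qed.

Lemma expand_r (W : lmodType k) (F : H -> H -> W) :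
  (forall b, linear (fun a => F a b)) -> (forall a, linear (F a)) ->
  \sw_(r, s <- R) F r s = \sum_j F (bv j) (legr (lhom (lin_co' j))).
Proof.
move=> l1 l2.
transitivity (\sum_j \sw_(r, s <- R) ((co j r : k) *: F (bv j) s)).
  rewrite tlift_sum; apply: eq_tlift => r s.
  exact: (lin_expand (f := fun r => F r s) r).
apply: eq_bigr => j _; rewrite /legr (tlift_push _ _ (l2 _)); apply: eq_tlift => r s.
by rewrite lhomE linZ.
Qed.

Lemma expand_l (W : lmodType k) (F : H -> H -> W) :
  (forall b, linear (fun a => F a b)) -> (forall a, linear (F a)) ->
  \sw_(r, s <- R) F r s = \sum_j F (legl (lhom (lin_co' j))) (bv j).
Proof.
move=> l1 l2.
transitivity (\sum_j \sw_(r, s <- R) ((co j s : k) *: F r (bv j))).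
  rewrite tlift_sum; apply: eq_tlift => r s.
  exact: (lin_expand (f := fun s => F r s) s).
apply: eq_bigr => j _; rewrite /legl (tlift_push (L := fun r => F r (bv j)) _ _ (l1 _)).
by apply: eq_tlift => r s; rewrite lhomE (linZ (f := fun r => F r (bv j))).
Qed.

(** If L' = legl g is a normalised integral of the left leg, then g restricted to the right
leg is a normalised integral of its dual: pairing through R turns the product of the
left leg into the coproduct of the right one. *)
Lemma Xr_involutive h : h \in Xr -> S (S h) = h.
Proof.
have [L [Ll L1]] := semisimple_integral HH ssH.
have [L' /XlP[g eL] [L'l L'1]] := sub_integral Xl1 XlM XlD XlS Sinj_qt Ll L1.
apply: (@sub_involutive _ char0 _ _ _ Xr1 XrM XrD XrS Sinj_qt L Ll L1 g).
  move=> _ /XrP[f ->].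
  transitivity (\sw_(r, s <- R) ((f (r * L') : k) *: s)).
    transitivity (\sw_(r, s <- R) \sw_(r', s' <- R) (((f (r * r') : k) * (g s' : k)) *: s)).
      rewrite -(swRr qtR (fun r a b => ((f r : k) * (g a : k)) *: b)); try lin.
      rewrite {1}/legr tlift_lfun tlift_tlift; apply: eq_tlift => r s.
      rewrite linearZ /= (linZ _ _ (@lin_tlift _ _ _ _ _)) tliftZ.
      by apply: eq_tlift => a b; rewrite scalerA.
    apply: eq_tlift => r s; rewrite eL /legl tlift_mulr tlift_lfun.
    rewrite (tlift_push (L := fun z : k^o => (z : k) *: s)); last by lin.
    by apply: eq_tlift => a b; rewrite -scalerAr linearZ mulrC.
  rewrite (expand_l (F := fun r s => (f (r * L') : k) *: s)); try lin.
  transitivity (\sw_(r, s <- R) ((eps r * (f L' : k)) *: s)).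
    rewrite (expand_l (F := fun r s => (eps r * (f L' : k)) *: s)); try lin.
    by apply: eq_bigr => j _; rewrite L'l ?legl_mem // linearZ.
  transitivity ((f L' : k) *: (1 : H)).
    refine (swR_el qtR (F := fun s => (f L' : k) *: s) _ _); first by lin.
    by move=> a b; rewrite scalerA.
  congr (_ *: _); rewrite eL /legl /legr !tlift_lfun; apply: eq_tlifts => r s.
  by rewrite !linearZ; apply: mulrC.
move: L'1; rewrite eL /legl tlift_lfun => e1; rewrite -[RHS]e1; symmetry.
refine (swR_el qtR (F := fun z => g z) _ _); first by lin.
by move=> a b; rewrite linearZ /=; apply: mulrC.
Qed.

Lemma swR_cop (W : lmodType k) (F : H -> H -> W) :
  (forall b, linear (fun a => F a b)) -> (forall a, linear (F a)) ->
  \sw_(r, s <- R) \sw_(a, b <- D s) F r (S b * a) = F 1 1.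
Proof.
move=> l1 l2; rewrite (expand_r (F := fun r s => \sw_(a, b <- D s) F r (S b * a))); try lin.
transitivity (\sw_(r, s <- R) (eps s *: F r 1)); last first.
  by refine (swR_er qtR (F := fun r => F r 1) _ _); [lin|].
rewrite (expand_r (F := fun r s => eps s *: F r 1)); try lin.
apply: eq_bigr => j _; rewrite -(tlift_push _ _ (l2 _)) -linZ //; congr (F _ _).
exact: (sub_cop Xr1 XrM XrD XrS Xr_involutive (legr_mem _)).
Qed.

End Legs.

(** * Symmetric separability idempotents and quantum commutativity *)

Section Sep.
Variables (k : fieldType) (A : falgType k).
Variables (x : tensor A A) (sepx : symmetric_separability_idempotent x).
Variables (alpha : 'Hom(A, k^o)).
Hypothesis alphaE : \sw_(x1, x2 <- x) (alpha x1 *: x2) = 1.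
Implicit Types (a b : A) (W : lmodType k).
Local Notation "⟨ a ⟩" := (alpha a : k).

Lemma swx_sym W (F : A -> A -> W) :
  (forall b, linear (fun a => F a b)) -> (forall a, linear (F a)) ->
  \sw_(x1, x2 <- x) F x1 x2 = \sw_(x1, x2 <- x) F x2 x1.
Proof.
move=> l1 l2; rewrite -[in LHS](sepC sepx) /tswap tlift_tlift; apply: eq_tlift => a b.
by rewrite tliftB.
Qed.

Lemma swx_l a W (F : A -> A -> W) :
  (forall b, linear (fun a => F a b)) -> (forall a, linear (F a)) ->
  \sw_(x1, x2 <- x) F (a * x1) x2 = \sw_(x1, x2 <- x) F x1 (x2 * a).
Proof.
move=> l1 l2; have e := congr1 (tlift F) (sepA sepx a).
rewrite !tlift_tlift in e; etransitivity; last (etransitivity; first exact: e).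
  by apply: eq_tlift => b c; rewrite tliftB //; lin.
by apply: eq_tlift => b c; rewrite tliftB //; lin.
Qed.

Lemma swx_r a W (F : A -> A -> W) :
  (forall b, linear (fun a => F a b)) -> (forall a, linear (F a)) ->
  \sw_(x1, x2 <- x) F (x1 * a) x2 = \sw_(x1, x2 <- x) F x1 (a * x2).
Proof.
move=> l1 l2; rewrite (swx_sym (F := fun u v => F (u * a) v)); try lin.
rewrite -(@swx_l a _ (fun u v => F v u)) //.
by rewrite (swx_sym (F := fun u v => F u (a * v))) //; lin.
Qed.

(** The legs of x are dual bases for the form (a, b) |-> alpha(ab); the four lemmas
differ in the leg that is contracted and in the side of the factor b. *)
Lemma dual_rl b : \sw_(x1, x2 <- x) (⟨x1 * b⟩ *: x2) = b.
Proof.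
rewrite (@swx_r b _ (fun u v => ⟨u⟩ *: v)); try lin.
rewrite -[RHS]mulr1 -alphaE tlift_mulr; apply: eq_tlift => u v.
by rewrite scalerAr.
Qed.

Lemma dual_ll b : \sw_(x1, x2 <- x) (⟨b * x1⟩ *: x2) = b.
Proof.
rewrite (@swx_l b _ (fun u v => ⟨u⟩ *: v)); try lin.
rewrite -[RHS]mul1r -alphaE tlift_mull; apply: eq_tlift => u v.
by rewrite scalerAl.
Qed.

Lemma dual_rr b : \sw_(x1, x2 <- x) (⟨x2 * b⟩ *: x1) = b.
Proof. by rewrite -[RHS]dual_rl [RHS](swx_sym (F := fun u v => ⟨u * b⟩ *: v)) //; lin. Qed.

Lemma dual_lr b : \sw_(x1, x2 <- x) (⟨b * x2⟩ *: x1) = b.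
Proof. by rewrite -[RHS]dual_ll [RHS](swx_sym (F := fun u v => ⟨b * u⟩ *: v)) //; lin. Qed.

Lemma alphaZ (d : k) a : ⟨d *: a⟩ = d * ⟨a⟩. Proof. by rewrite linearZ. Qed.

(** Expanding one factor in dual bases on either side gives the same double sum, so the
form is symmetric. *)
Lemma alphaC a b : ⟨a * b⟩ = ⟨b * a⟩.
Proof.
transitivity (\sw_(x1, x2 <- x) (⟨a * x2⟩ * ⟨b * x1⟩ : k^o)).
  rewrite -[in LHS](dual_ll b) tlift_mulr tlift_lfun; apply: eq_tlifts => u v.
  by rewrite -scalerAr alphaZ; apply: mulrC.
rewrite -[in RHS](dual_lr a) tlift_mulr tlift_lfun; apply: eq_tlifts => u v.
by rewrite -scalerAr alphaZ.
Qed.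

Lemma alpha_inj a b : (forall c, ⟨c * a⟩ = ⟨c * b⟩) -> a = b.
Proof.
move=> e; rewrite -(dual_rl a) -(dual_rl b); apply: eq_tlift => u v; by rewrite e.
Qed.

(** The trace in the dual bases x^1, x^2, with x^2 x^1 = 1. *)
Lemma alpha_Tr a : ⟨a⟩ = Tr (fun b => a * b).
Proof.
rewrite (eq_Tr (g := fun b => \sw_(x1, x2 <- x) (⟨b * x1⟩ *: (a * x2)))); last first.
  move=> b; rewrite -[in LHS](dual_ll b) tlift_mulr; apply: eq_tlift => u v.
  by rewrite scalerAr.
rewrite Tr_tlift -[in LHS](mulr1 a) -(sep1 sepx).
rewrite (swx_sym (F := fun u v => u * v)); try lin.
rewrite tlift_mulr tlift_lfun; apply: eq_tlifts => u v.
by rewrite (Tr_rank1 (f := fun b => ⟨b * u⟩)) ?mulrA //; lin.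
Qed.

End Sep.

Section ModAlg.
Variables (k : fieldType) (char0 : [pchar k] =i pred0).
Variables (H : falgType k) (HH : hopf_algebra H) (ssH : semisimple H).
Variables (R : tensor H H) (qtR : quasitriangular HH R).
Variables (A : falgType k) (MA : module_algebra HH A) (qcA : quantum_commutative R MA).
Variables (x : tensor A A) (sepx : symmetric_separability_idempotent x).
Variables (alpha : 'Hom(A, k^o)).
Hypothesis alphaE : \sw_(x1, x2 <- x) (alpha x1 *: x2) = 1.
Implicit Types (a b : A) (h g : H) (W : lmodType k).
Local Notation "⟨ a ⟩" := (alpha a : k).
Local Notation "h · a" := (act MA h a) (at level 38, right associativity).
Local Notation S := (antipode HH).
Local Notation D := (comul HH).
Local Notation eps h := (counit HH h : k).

Lemma act_mulS h a b :
  (h · a) * b = \sw_(p, q <- D h) (p · (a * (S q · b))).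
Proof.
symmetry; transitivity (\sw_(p, q <- D h) \sw_(c, d <- D p) ((c · a) * ((d * S q) · b))).
  apply: eq_tlift => p q; rewrite act_mul; apply: eq_tlift => c d.
  by rewrite actM.
sw0 by (refine (swA _ _ _); lin).
sw 1 by (refine (sw_antir (F := fun z => (p · a) * (z · b)) _ _); [lin|by []]).
by refine (etrans (sw_counitr (F := fun z => (z · a) * (1 · b)) _ _) _);
  [lin|by []|rewrite act1].
Qed.

(** By act_mulS and cyclicity of the trace. *)
Lemma alpha_act h a : ⟨h · a⟩ = \sw_(p, q <- D h) (Tr (fun b => a * ((S q * p) · b)) : k^o).
Proof.
rewrite (alpha_Tr sepx alphaE) (eq_Tr (act_mulS h a)) Tr_tlift; apply: eq_tlifts => p q.
rewrite (TrC (f := fun b => a * (S q · b)) (g := fun b => p · b)); try lin.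
by apply: eq_Trs => b; rewrite actM.
Qed.

Lemma lin_Tr_act a : linear (fun h => Tr (fun b => a * (h · b)) : k^o).
Proof.
rewrite /Tr => d u v; rewrite scaler_sumr -big_split; apply: eq_bigr => i _.
by rewrite linearP add_lfunE scale_lfunE mulrDr -scalerAr lin_co.
Qed.

Lemma lin_Tr_mul h (F : H -> A) : linear F ->
  linear (fun g => Tr (fun b => F g * (h · b)) : k^o).
Proof.
move=> lF d u v; rewrite /Tr scaler_sumr -big_split; apply: eq_bigr => i _.
by rewrite lF mulrDl -scalerAl lin_co.
Qed.

(** An instance of alpha_act in which the right leg of R contracts by swR_cop. *)
Lemma alphaR (F : H -> A) : linear F ->
  \sw_(r, s <- R) (alpha (s · F r)) = alpha (F 1).
Proof.
move=> lF; transitivity (\sw_(r, s <- R) \sw_(p, q <- D s)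
    (Tr (fun b => F r * ((S q * p) · b)) : k^o)).
  by apply: eq_tlift => r s; apply: alpha_act.
rewrite (swR_cop char0 qtR ssH (F := fun r z => Tr (fun b => F r * (z · b)) : k^o)).
- by rewrite (alpha_Tr sepx alphaE); apply: eq_Trs => b; rewrite act1.
- by move=> b; apply: lin_Tr_mul.
- by move=> b; apply: lin_Tr_act.
Qed.

Lemma adjR (F : H -> A) b : linear F ->
  \sw_(r, s <- R) alpha ((s · b) * F r) = \sw_(r, s <- R) alpha (b * (S s · F r)).
Proof.
move=> lF; transitivity (\sw_(r, s <- R) \sw_(p, q <- D s) alpha (p · (b * (S q · F r)))).
  by apply: eq_tlift => r s; rewrite act_mulS tlift_lfun.
rewrite (swRr qtR (fun r p q => alpha (p · (b * (S q · F r))))); try lin.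
sw 1 by (refine (alphaR (F := fun r => b * (S q · F (p * r))) _); lin).
by apply: eq_tlift => r s; rewrite mulr1.
Qed.

Local Notation u := (drinfeld HH R).

(** Quantum commutativity makes u the Nakayama automorphism of alpha, which is the
identity as alpha is symmetric. *)
Lemma drinfeld_act a : u · a = a.
Proof.
apply: (alpha_inj sepx alphaE) => b; rewrite [in RHS](alphaC sepx alphaE) [in RHS]qcA [in RHS]tlift_lfun; symmetry.
transitivity (\sw_(r, s <- R) alpha (b * (S s · (r · a)))).
  by rewrite -(adjR (F := fun r => r · a)) //; lin.
rewrite /drinfeld tlift_lfun tlift_lfunl tlift_mulr tlift_lfun; apply: eq_tlifts => r s.
by rewrite actM.
Qed.

Lemma SS_act h a : S (S h) · a = h · a.
Proof. by rewrite -[in LHS](drinfeld_act a) -actM (drinfeldE qtR) actM drinfeld_act. Qed.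

Lemma alphaH h a : ⟨h · a⟩ = eps h * ⟨a⟩.
Proof.
rewrite alpha_act.
transitivity (\sw_(p, q <- D h) (Tr (fun b => a * (S (S p * q) · b)) : k^o)).
  apply: eq_tlifts => p q; apply: eq_Trs => b.
  by rewrite antipodeM !actM SS_act.
rewrite (sw_antil (F := fun z => Tr (fun b => a * (S z · b)) : k^o)) //.
  rewrite antipode1 (alpha_Tr sepx alphaE) /GRing.scale /=; congr (_ * _).
  by apply: eq_Tr => b; rewrite act1.
apply: (lin_comp (g := fun z => S z) (@lin_Tr_act a)); lin.
Qed.

Lemma adjH h a b : ⟨(h · a) * b⟩ = ⟨a * (S h · b)⟩.
Proof.
rewrite act_mulS tlift_lfun.
transitivity (\sw_(p, q <- D h) (eps p *: alpha (a * (S q · b)))).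
  by apply: eq_tlifts => p q; rewrite alphaH.
by refine (sw_counitl (F := fun q => alpha (a * (S q · b))) _ _); [lin|].
Qed.

(** Invariance of x, dual to the invariance adjH of the form. *)
Lemma swx_act h W (F : A -> A -> W) :
  (forall b, linear (fun a => F a b)) -> (forall a, linear (F a)) ->
  \sw_(x1, x2 <- x) F (h · x1) x2 = \sw_(x1, x2 <- x) F x1 (S h · x2).
Proof.
move=> l1 l2; transitivity (\sw_(x1, x2 <- x) \sw_(y1, y2 <- x)
    (⟨x1 * (S h · y1)⟩ *: F y2 x2)).
  apply: eq_tlift => x1 x2; rewrite -[in LHS](dual_ll sepx alphaE (h · x1)).
  rewrite (tlift_push _ _ (l1 x2)); apply: eq_tlift => y1 y2.
  by rewrite (linZ _ _ (l1 x2)) adjH.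
rewrite tliftC [RHS](swx_sym sepx (F := fun a b => F a (S h · b))); try lin.
apply: eq_tlift => y1 y2; rewrite -[in RHS](dual_rl sepx alphaE (S h · y1)).
rewrite (tlift_push _ _ (l2 y2)); apply: eq_tlift => x1 x2.
by rewrite (linZ _ _ (l2 y2)).
Qed.

Lemma Sdrinfeld_act a : \sw_(r, s <- R) (S r · (s · a)) = a.
Proof.
transitivity (S u · a).
  rewrite /drinfeld tlift_lfun tlift_lfun tlift_lfunl; apply: eq_tlift => r s.
  by rewrite antipodeM actM SS_act.
apply: (alpha_inj sepx alphaE) => b.
by rewrite -adjH drinfeld_act.
Qed.

(** Quantum commutativity for the inverse of R. *)
Lemma qcV a b : \sw_(r, s <- R) ((S r · a) * (s · b)) = b * a.
Proof.
transitivity (\sw_(r, s <- R) \sw_(r', s' <- R) (((s' * s) · b) * ((r' * S r) · a))).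
  apply: eq_tlift => r s; rewrite qcA; apply: eq_tlift => r' s'.
  by rewrite !actM.
rewrite tliftC (swR_invr qtR (fun p q => (q · b) * (p · a))); try lin.
by rewrite !act1.
Qed.

(** Distribute S(R^1) over the product and split R by the hexagon axiom: one copy
acts on b alone and disappears by Sdrinfeld_act, the other reverses the product. *)
Lemma S_act_mul p b : \sw_(r, s <- R) (S r · (p * (s · b))) = b * p.
Proof.
transitivity (\sw_(r, s <- R) \sw_(c, d <- D r) ((S d · p) * (S c · (s · b)))).
  apply: eq_tlift => r s; rewrite act_mul.
  by rewrite (swS HH r (fun u v => (u · p) * (v · (s · b)))); lin.
rewrite (swRl qtR (fun c d s => (S d · p) * (S c · (s · b)))); try lin.
rewrite tliftC -[RHS]qcV; apply: eq_tlift => r s.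
rewrite -[in RHS](Sdrinfeld_act (s · b)) tlift_mulr; apply: eq_tlift => r' s'.
by rewrite actM.
Qed.

(** The same when the remaining part of the coproduct of R^1 is kept; this is the form in which
coproducts of R^1 arise from phi. *)
Lemma S_act_mulD p b W (F : A -> H -> W) :
  (forall z, linear (fun a => F a z)) -> (forall a, linear (F a)) ->
  \sw_(r, s <- R) \sw_(c, d <- D r) F (S c · (p * (s · b))) d =
  \sw_(r, s <- R) F ((s · b) * p) r.
Proof.
move=> l1 l2; rewrite (swRl qtR (fun c d s => F (S c · (p * (s · b))) d)); try lin.
rewrite tliftC; apply: eq_tlift => r s; rewrite -S_act_mul (tlift_push _ _ (l1 r)).
by apply: eq_tlift => r' s'; rewrite actM.
Qed.

End ModAlg.

(** * The algebra B as an algebra of operators *)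

Section DualLin.
Variables (k : fieldType) (A : falgType k).
Local Notation dualA := 'Hom(A, k^o).

Lemma lin_hitl_l (f : dualA) : linear (fun a => hitl a f).
Proof.
move=> c u v; apply/lfunP => b; rewrite add_lfunE scale_lfunE !hitlE.
by rewrite mulrDr -scalerAr linearP.
Qed.
Lemma lin_hitr_r (f : dualA) : linear (fun a => hitr f a).
Proof.
move=> c u v; apply/lfunP => b; rewrite add_lfunE scale_lfunE !hitrE.
by rewrite mulrDl -scalerAl linearP.
Qed.
Lemma lin_hitl_r a : linear (fun f : dualA => hitl a f).
Proof.
by move=> c u v; apply/lfunP => b; rewrite add_lfunE scale_lfunE !hitlE add_lfunE scale_lfunE.
Qed.
Lemma lin_dcomul : linear (@dcomul k A).
Proof.
move=> c u v; rewrite /dcomul scaler_sumr -big_split; apply: eq_bigr => i _ /=.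
rewrite scaler_sumr -big_split; apply: eq_bigr => j _ /=.
by rewrite add_lfunE scale_lfunE scalerDl scalerA.
Qed.

Variables (H : falgType k) (HH : hopf_algebra H) (MA : module_algebra HH A).
Lemma dactE f h a : dact MA f h a = f (act MA h a).
Proof. by rewrite /dact comp_lfunE. Qed.
Lemma lin_dact_l h : linear (fun f : dualA => dact MA f h).
Proof.
by move=> c u v; apply/lfunP => b; rewrite add_lfunE scale_lfunE !dactE add_lfunE scale_lfunE.
Qed.
Lemma lin_dact_r f : linear (fun h => dact MA f h).
Proof.
move=> c u v; apply/lfunP => b; rewrite add_lfunE scale_lfunE !dactE.
by rewrite linearP add_lfunE scale_lfunE linearP.
Qed.

End DualLin.
#[export] Hint Resolve lin_hitl_l lin_hitr_r lin_hitl_r lin_dcomul lin_dact_l lin_dact_r : lin.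

Section Ev.
Variables (k : fieldType) (A H : falgType k).
Local Notation dualA := 'Hom(A, k^o).
Local Notation B := (B_space H A).
Local Notation "f ⟦ a ⟧" := ((f : dualA) (a : A) : k) (at level 9).

(** B acts faithfully by maps from A to A (x) H; see ev_inj. *)
Definition ev (c : A) (t : B) : tensor A H :=
  \sw_(a, s <- t) \sw_(h, f <- s) (f⟦c⟧ *: (a \ox h)).

Lemma lin_ev_l t : linear (fun c => ev c t). Proof. by rewrite /ev; lin. Qed.
Lemma lin_ev_r c : linear (ev c). Proof. by rewrite /ev; lin. Qed.

Lemma evE c a h f : ev c (a \ox h \ox f) = f⟦c⟧ *: (a \ox h).
Proof. by rewrite /ev !tliftB //; lin. Qed.

Lemma B_ind (W : lmodType k) (F G : B -> W) : linear F -> linear G ->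
  (forall a h f, F (a \ox h \ox f) = G (a \ox h \ox f)) -> forall t, F t = G t.
Proof.
move=> lF lG e; apply: lin_tens_eq => // a; apply: lin_tens_eq => [||h f]; [lin|lin|exact: e].
Qed.

Definition unev (j : 'I_(\dim {:A})) (t : tensor A H) : B :=
  \sw_(a, h <- t) (a \ox h \ox dual_vbasis j).

Lemma lin_unev j : linear (unev j). Proof. by rewrite /unev; lin. Qed.

(** B is recovered from its values on a basis of A and the dual basis. *)
Lemma unevK t : \sum_j unev j (ev (bv j) t) = t.
Proof.
move: t; apply: B_ind => [||a h f].
- by apply: lin_sum => j; apply: lin_comp; [exact: lin_unev | exact: lin_ev_r].
- by lin.
transitivity (\sum_j (f⟦bv j⟧ *: (a \ox h \ox (dual_vbasis j : dualA)))).
  apply: eq_bigr => j _; rewrite evE (linZ _ _ (@lin_unev _)) /unev tliftB //; lin.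
have ef : f = \sum_j (f⟦bv j⟧ *: (dual_vbasis j : dualA)).
  apply/lfunP => c; rewrite sum_lfunE -[in LHS](co_sum c) linear_sum.
  by apply: eq_bigr => j _; rewrite linearZ scale_lfunE /dual_vbasis lfunE /=; apply: mulrC.
rewrite [in RHS]ef (linS _ (@lin_tens_r _ _ _ h)) (linS _ (@lin_tens_r _ _ _ a)).
apply: eq_bigr => j _.
by rewrite (linZ _ _ (@lin_tens_r _ _ _ h)) (linZ _ _ (@lin_tens_r _ _ _ a)).
Qed.

Lemma ev_inj t t' : (forall c, ev c t = ev c t') -> t = t'.
Proof. by move=> e; rewrite -(unevK t) -(unevK t'); apply: eq_bigr => j _; rewrite e. Qed.

Definition ev2 (c e : A) (T : tensor B B) : tensor (tensor A H) (tensor A H) :=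
  \sw_(u, v <- T) (ev c u \ox ev e v).

Lemma lin_ev2 c e : linear (ev2 c e).
Proof. by rewrite /ev2; lin. Qed.

Lemma ev2E c e u v : ev2 c e (u \ox v) = ev c u \ox ev e v.
Proof. by rewrite /ev2 tliftB; have := lin_ev_r => ?; lin. Qed.

Lemma ev2_inj T T' : (forall c e, ev2 c e T = ev2 c e T') -> T = T'.
Proof.
have K U : \sum_i \sum_j \sw_(p, q <- ev2 (bv i) (bv j) U) (unev i p \ox unev j q) = U.
  move: U; have l1 := lin_ev_r; have l2 := lin_unev.
  apply: lin_tens_eq => [||u v].
  - by apply: lin_sum => i; apply: lin_sum => j; rewrite /ev2; lin.
  - by lin.
  rewrite -[in RHS](unevK u) -[in RHS](unevK v) (linS _ (@lin_tens_l _ _ _ _)).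
  apply: eq_bigr => i _; rewrite (linS _ (@lin_tens_r _ _ _ _)); apply: eq_bigr => j _.
  by rewrite ev2E tliftB //; lin.
by move=> e; rewrite -(K T) -(K T'); apply: eq_bigr => i _; apply: eq_bigr => j _; rewrite e.
Qed.

(** Under ev the product of B becomes composition, in the opposite order. *)
Lemma ev_mul c (u v : B) : ev c (B_mul u v) =
  \sw_(p, h <- ev c u) \sw_(q, g <- ev p v) (q \ox (h * g)).
Proof.
have l1 := lin_ev_r; have l2 := lin_ev_l.
move: u; apply: B_ind => [||a h f]; [by rewrite /B_mul; lin | by lin |].
move: v; apply: B_ind => [||b g f']; [by rewrite /B_mul; lin | by lin |].
rewrite /B_mul !tliftB; try lin.
rewrite (linZ _ _ (l1 c)) !evE (linZ _ _ (@lin_tlift _ _ _ _ _)) tliftB; try lin.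
rewrite evE (linZ _ _ (@lin_tlift _ _ _ _ _)) tliftB; try lin.
by rewrite !scalerA mulrC.
Qed.

End Ev.

(** * The image of phi and the Mueger center *)

Section Main.
Variables (k : fieldType).
Variables (H : falgType k) (HH : hopf_algebra H).
Variables (R : tensor H H) (qtR : quasitriangular HH R).
Variables (A : falgType k) (MA : module_algebra HH A).
Variables (x : tensor A A) (sepx : symmetric_separability_idempotent x).
Variables (alpha : 'Hom(A, k^o)).
Hypothesis alphaE : \sw_(x1, x2 <- x) (alpha x1 *: x2) = 1.
Implicit Types (a b c e : A) (h g : H) (W : lmodType k).
Local Notation "⟨ a ⟩" := (alpha a : k).
Local Notation "h · a" := (act MA h a) (at level 38, right associativity).
Local Notation S := (antipode HH).
Local Notation D := (comul HH).
Local Notation eps h := (counit HH h : k).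
Local Notation φ := (phi MA x alpha).
Local Notation B := (B_space H A).
Local Notation AH := (smash_space H A).

(** The map of which phi(u) is the encoding, as ev_phi shows. *)
Definition psi0 c (a : A) (h : H) : tensor A H := \sw_(p, q <- D h) ((S p · (c * a)) \ox q).
Definition psi c (u : AH) : tensor A H := tlift (psi0 c) u.

Lemma psiE c a h : psi c (a \ox h) = \sw_(p, q <- D h) ((S p · (c * a)) \ox q).
Proof. by rewrite /psi tliftB /psi0 //; lin. Qed.

Lemma lin_psi c : linear (psi c). Proof. by rewrite /psi; lin. Qed.
Lemma lin_psi_l u : linear (fun c => psi c u). Proof. by rewrite /psi /psi0; lin. Qed.

Lemma phiE a h : φ (a \ox h) =
  \sw_(p, q <- D h) \sw_(x1, x2 <- x) ((S p · (x1 * a)) \ox q \ox hitl x2 alpha).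
Proof. by rewrite /phi lfunE /= tliftB //; lin. Qed.

(** The legs of x in the definition of phi are dual bases for alpha, so the evaluation at c
replaces x^1 by c. *)
Lemma ev_phi c u : ev c (φ u) = psi c u.
Proof.
have l1 := @lin_ev_r k A H c; have l2 := lin_psi c.
move: u; apply: lin_tens_eq => [||a h]; [lin | exact: l2 |].
rewrite phiE psiE (tlift_push _ _ l1); apply: eq_tlift => p q.
rewrite (tlift_push _ _ l1).
transitivity (\sw_(x1, x2 <- x) (⟨c * x2⟩ *: ((S p · (x1 * a)) \ox q))).
  by apply: eq_tlift => x1 x2; rewrite evE hitlE.
rewrite -[in RHS](dual_lr sepx alphaE c).
rewrite tlift_mull tlift_lfun tlift_tensl; apply: eq_tlift => x1 x2.
by rewrite -scalerAl linearZ /= (linZ _ _ (@lin_tens_l _ _ _ q)).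
Qed.

Lemma ev2_phi c e (T : tensor AH AH) :
  ev2 c e (tmap φ φ T) = \sw_(u, v <- T) (psi c u \ox psi e v).
Proof.
rewrite /tmap (tlift_push _ _ (@lin_ev2 _ _ _ c e)); apply: eq_tlift => u v.
by rewrite ev2E !ev_phi.
Qed.

(** The copy x_1 and the coproduct of alpha are contracted by duality, as in
ev_phi. *)
Lemma ev2_BR c e : ev2 c e (B_R R MA x alpha) =
  \sw_(y1, y2 <- x) \sw_(r11, r12 <- R) \sw_(r21, r22 <- R) \sw_(r31, r32 <- R)
   ((((r32 · y1) * ((r12 · c) * e)) \ox (r21 * r31)) \ox (y2 \ox (r11 * r22))).
Proof.
have lE := @lin_ev2 k A H c e.
pose Y (y1 y2 : A) (r11 r21 r22 r31 r32 : H) (p : A) : tensor (tensor A H) (tensor A H) :=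
  (((r32 · y1) * p) \ox (r21 * r31)) \ox (y2 \ox (r11 * r22)).
have lY y1 y2 r11 r21 r22 r31 r32 : linear (Y y1 y2 r11 r21 r22 r31 r32).
  by rewrite /Y; lin.
transitivity (\sw_(x1, x2 <- x) \sw_(y1, y2 <- x)
  \sw_(r11, r12 <- R) \sw_(r21, r22 <- R) \sw_(r31, r32 <- R)
   (⟨(r12 · c) * (e * x2)⟩ *: Y y1 y2 r11 r21 r22 r31 r32 x1)).
  rewrite /B_R (tlift_push _ _ lE); apply: eq_tlift => x1 x2.
  rewrite (tlift_push _ _ lE); apply: eq_tlift => y1 y2.
  rewrite (tlift_push _ _ lE).
  sw 1 by (rewrite (tlift_push _ _ lE); refine (eq_tlift _ (fun r s => _));
           rewrite (tlift_push _ _ lE); refine (eq_tlift _ (fun r s => _));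
           rewrite (tlift_push _ _ lE); refine (eq_tlift _ (fun r s => _));
           rewrite ev2E !evE hitlE dactE; reflexivity).
  rewrite tliftC; apply: eq_tlift => r11 r12; rewrite tliftC; apply: eq_tlift => r21 r22.
  rewrite tliftC; apply: eq_tlift => r31 r32.
  rewrite -dcomulP (tlift_push (L := fun z : k^o => (z : k) *: _)); last by lin.
  apply: eq_tlift => f1 f2.
  by rewrite (linZ _ _ (@lin_tens_l _ _ _ _)) (linZ _ _ (@lin_tens_r _ _ _ _)) scalerA.
rewrite tliftC; apply: eq_tlift => y1 y2.
rewrite tliftC; apply: eq_tlift => r11 r12.
rewrite tliftC; apply: eq_tlift => r21 r22.
rewrite tliftC; apply: eq_tlift => r31 r32.
rewrite -[_ \ox _ in RHS]/(Y y1 y2 r11 r21 r22 r31 r32 _).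
rewrite -[in RHS](dual_lr sepx alphaE ((r12 · c) * e)) (tlift_push _ _ (lY _ _ _ _ _ _ _)).
by apply: eq_tlift => x1 x2; rewrite (linZ _ _ (lY _ _ _ _ _ _ _)) mulrA.
Qed.

(** The operators in Im phi are determined by their values at 1. *)
Lemma psi_1 c u : psi c u =
  \sw_(p, h <- psi 1 u) \sw_(h1, h2 <- D h) (((S h1 · c) * p) \ox h2).
Proof.
have l2 := lin_psi; move: u; apply: lin_tens_eq => [||a h]; [exact: l2 | by lin |].
rewrite !psiE tlift_tlift; symmetry.
transitivity (\sw_(p, q <- D h) \sw_(h1, h2 <- D q) (((S h1 · c) * (S p · a)) \ox h2)).
  by apply: eq_tlift => p q; rewrite mul1r tliftB //; lin.
sw0 by (symmetry; refine (swA _ _ _); lin).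
apply: eq_tlift => p q; rewrite act_mul.
rewrite (swS HH p (fun u v => (u · c) * (v · a))); [|lin|lin].
by rewrite tlift_tensl.
Qed.

Lemma tensv_limg (T : tensor B B) : T \in tensv (limg φ) (limg φ) ->
  exists U, T = tmap φ φ U.
Proof.
have lm : linear (tmap φ φ : tensor AH AH -> tensor B B) by rewrite /tmap; lin.
move=> TI; suff : T \in limg (lhom lm) by case/memv_imgP => U _ ->; exists U; rewrite lhomE.
move: T TI; apply/subvP; rewrite /tensv; apply/span_subvP => _ /allpairsP[[u v] /= [uI vI ->]].
have /memv_imgP[u' _ ->] := vbasis_mem uI; have /memv_imgP[v' _ ->] := vbasis_mem vI.
have -> : φ u' \ox φ v' = lhom lm (u' \ox v') by rewrite lhomE /tmap tliftB //; lin.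
by rewrite memv_img // memvf.
Qed.

(** As R_B is in the image, its value at (c, 1) is obtained from its value at (1, 1) by
the rule psi_1, here the map Ps. The contraction Th, by alpha on the second A-leg and by the
counit on the first H-leg, leaves the identity half. Multiplying half by
a second copy of R and cancelling gives the Mueger condition. *)
Lemma mueger_of_mem : B_R R MA x alpha \in tensv (limg φ) (limg φ) ->
  in_mueger_center R MA.
Proof.
case/tensv_limg => U eU.
have half c : \sw_(r, s <- R) ((s · c) \ox r) = \sw_(r, s <- R) ((S r · c) \ox s).
  pose Th (z : tensor (tensor A H) (tensor A H)) : tensor A H :=
    \sw_(u, v <- z) \sw_(p, h <- u) \sw_(q, g <- v) ((eps h * ⟨q⟩) *: (p \ox g)).
  pose Ps (z : tensor (tensor A H) (tensor A H)) : tensor (tensor A H) (tensor A H) :=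
    \sw_(u, v <- z) (\sw_(p, h <- u) \sw_(h1, h2 <- D h) (((S h1 · c) * p) \ox h2) \ox v).
  have lTh : linear Th by rewrite /Th; lin.
  have lPs : linear Ps by rewrite /Ps; lin.
  have ThE p h q g : Th ((p \ox h) \ox (q \ox g)) = (eps h * ⟨q⟩) *: (p \ox g).
    by rewrite /Th !tliftB //; lin.
  have PsE p h v : Ps ((p \ox h) \ox v) = \sw_(h1, h2 <- D h) ((((S h1 · c) * p) \ox h2) \ox v).
    by rewrite /Ps !tliftB ?tlift_tensl //; lin.
  have e : ev2 c 1 (B_R R MA x alpha) = Ps (ev2 1 1 (B_R R MA x alpha)).
    rewrite eU !ev2_phi (tlift_push _ _ lPs); apply: eq_tlift => u v.
    by rewrite /Ps tliftB -?psi_1 //; lin.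
  have {e} := congr1 Th e; rewrite !ev2_BR.
  have lTP : linear (fun z => Th (Ps z)) by lin.
  move=> e; transitivity (\sw_(y1, y2 <- x) \sw_(r11, r12 <- R) \sw_(r21, r22 <- R) \sw_(r31, r32 <- R)
     ((eps (r21 * r31) * ⟨y2⟩) *: (((r32 · y1) * (r12 · c)) \ox (r11 * r22)))).
    symmetry.
    transitivity (\sw_(y1, y2 <- x) (⟨y2⟩ *: \sw_(r, s <- R) ((y1 * (s · c)) \ox r))).
      apply: eq_tlift => y1 y2; rewrite tliftZ; apply: eq_tlift => r11 r12.
      transitivity (\sw_(r21, r22 <- R) (eps r21 *: (⟨y2⟩ *: ((y1 * (r12 · c)) \ox (r11 * r22))))).
        apply: eq_tlift => r21 r22.
        refine (etrans (swR_el qtR (F := fun z => (eps r21 * ⟨y2⟩) *: (((z · y1) * (r12 · c)) \ox (r11 * r22))) _ _) _).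
        - by lin.
        - by move=> a b; rewrite counitM scalerA mulrCA -mulrA.
        - by rewrite act1 scalerA.
      refine (etrans (swR_el qtR (F := fun z => ⟨y2⟩ *: ((y1 * (r12 · c)) \ox (r11 * z))) _ _) _).
      - by lin.
      - by [].
      - by rewrite mulr1.
    transitivity (\sw_(r, s <- R) (((\sw_(y1, y2 <- x) (⟨y2 * 1⟩ *: y1)) * (s · c)) \ox r)).
      rewrite [LHS](eq_tlift _ (fun _ _ => tliftZ _ _ _)) tliftC; apply: eq_tlift => r s.
      rewrite tlift_mull tlift_tensl; apply: eq_tlift => y1 y2.
      by rewrite mulr1 -scalerAl (linZ _ _ (@lin_tens_l _ _ _ _)).
    by apply: eq_tlift => r s; rewrite (dual_rr sepx alphaE) mul1r.
  transitivity (Th (\sw_(y1, y2 <- x) \sw_(r11, r12 <- R) \sw_(r21, r22 <- R) \sw_(r31, r32 <- R)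
     ((((r32 · y1) * ((r12 · c) * 1)) \ox (r21 * r31)) \ox (y2 \ox (r11 * r22))))).
    symmetry; rewrite (tlift_push _ _ lTh); apply: eq_tlift => y1 y2.
    rewrite (tlift_push _ _ lTh); apply: eq_tlift => r11 r12.
    rewrite (tlift_push _ _ lTh); apply: eq_tlift => r21 r22.
    rewrite (tlift_push _ _ lTh); apply: eq_tlift => r31 r32.
    by rewrite ThE mulr1.
  rewrite e.
  transitivity (\sw_(y1, y2 <- x) \sw_(r21, r22 <- R) \sw_(r31, r32 <- R) \sw_(r11, r12 <- R)
     (⟨y2⟩ *: (((S (r21 * r31) · c) * ((r32 · y1) * (r12 · 1))) \ox (r11 * r22)))).
    rewrite (tlift_push (L := fun z => Th (Ps z)) _ _ lTP); apply: eq_tlift => y1 y2.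
    rewrite (tlift_push (L := fun z => Th (Ps z)) _ _ lTP).
    sw 1 by (refine (tlift_push (L := fun z => Th (Ps z)) _ _ lTP)).
    rewrite tliftC; apply: eq_tlift => r21 r22.
    sw 1 by (refine (tlift_push (L := fun z => Th (Ps z)) _ _ lTP)).
    rewrite tliftC; apply: eq_tlift => r31 r32; apply: eq_tlift => r11 r12.
    rewrite PsE (tlift_push _ _ lTh).
    refine (etrans (sw_counitr (F := fun z => ⟨y2⟩ *: (((S z · c) * ((r32 · y1) * (r12 · 1))) \ox (r11 * r22))) _ _) _).
    - by lin.
    - by move=> a b; rewrite ThE scalerA mulr1.
    - by [].
  transitivity (\sw_(y1, y2 <- x) \sw_(r21, r22 <- R) \sw_(r31, r32 <- R)
     (⟨y2⟩ *: (((S (r21 * r31) · c) * (r32 · y1)) \ox r22))).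
    do 3 (apply: eq_tlift => ? ?).
    refine (etrans (swR_er qtR (F := fun z => ⟨_⟩ *: (((S (_ * _) · c) * (_ · _)) \ox (z * _))) _ _) _); last by rewrite mul1r.
      by lin.
    move=> a b; rewrite act_one -scalerAr mulr1 -scalerAr (linZ _ _ (@lin_tens_l _ _ _ _)).
    by rewrite !scalerA mulrC.
  rewrite tliftC; apply: eq_tlift => r21 r22; rewrite tliftC.
  refine (etrans (swR_er qtR (F := fun z => (S (r21 * z) · c) \ox r22) _ _) _); last by rewrite mulr1.
    by lin.
  move=> r31 r32.
  transitivity (((S (r21 * r31) · c) * (r32 · (\sw_(y1, y2 <- x) (⟨y2 * 1⟩ *: y1)))) \ox r22).
    rewrite tlift_lfun tlift_mulr tlift_tensl; apply: eq_tlift => y1 y2.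
    by rewrite mulr1 linearZ /= -scalerAr (linZ _ _ (@lin_tens_l _ _ _ _)).
  rewrite (dual_rr sepx alphaE) act_one -scalerAr mulr1.
  by rewrite (linZ _ _ (@lin_tens_l _ _ _ _)).
move=> a.
transitivity (\sw_(r, s <- R) \sw_(r', s' <- R) ((S r' · (r · a)) \ox (s' * s))).
  apply: eq_tlift => r s.
  have := congr1 (tlift (fun z g => z \ox (g * s))) (half (r · a)).
  rewrite !tlift_tlift => e; etransitivity; last (etransitivity; first exact: e).
    by apply: eq_tlift => r' s'; rewrite tliftB ?actM //; lin.
  by apply: eq_tlift => r' s'; rewrite tliftB //; lin.
rewrite tliftC -[in RHS](act1 MA a) -(swR_invl qtR (fun u v => (u · a) \ox v)); [|lin|lin].
by do 2 (apply: eq_tlift => ? ?); rewrite actM.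
Qed.

End Main.

(** * Compatibility of phi with the weak Hopf structures *)

Section PhiMap.
Variables (k : fieldType) (char0 : [pchar k] =i pred0).
Variables (H : falgType k) (HH : hopf_algebra H) (ssH : semisimple H).
Variables (R : tensor H H) (qtR : quasitriangular HH R).
Variables (A : falgType k) (MA : module_algebra HH A) (qcA : quantum_commutative R MA).
Variables (x : tensor A A) (sepx : symmetric_separability_idempotent x).
Variables (alpha : 'Hom(A, k^o)).
Hypothesis alphaE : \sw_(x1, x2 <- x) (alpha x1 *: x2) = 1.
Implicit Types (a b c e : A) (h g : H) (W : lmodType k).
Local Notation "⟨ a ⟩" := (alpha a : k).
Local Notation "h · a" := (act MA h a) (at level 38, right associativity).
Local Notation S := (antipode HH).
Local Notation D := (comul HH).
Local Notation eps h := (counit HH h : k).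
Local Notation φ := (phi MA x alpha).
Local Notation B := (B_space H A).
Local Notation AH := (smash_space H A).
Local Notation psi := (psi MA).

Let SSa h a : S (S h) · a = h · a.
Proof. exact: (SS_act char0 ssH qtR qcA sepx alphaE). Qed.
Let evφ c u : ev c (φ u) = psi c u.
Proof. exact: (ev_phi MA sepx alphaE). Qed.

(** Distribute S(h_2) over the product; the factor on the right becomes
S(h_2)h_1.b by S^2 = 1, which collapses. *)
Lemma act_mul_anti h y b : \sw_(p, q <- D h) (S q · (y * (p · b))) = (S h · y) * b.
Proof.
transitivity (\sw_(p, q <- D h) \sw_(c, d <- D q) ((S d · y) * ((S (S p * c)) · b))).
  apply: eq_tlift => p q; rewrite act_mul.
  rewrite (swS HH q (fun u v => (u · y) * (v · (p · b)))); [|lin|lin].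
  by apply: eq_tlift => c d; rewrite antipodeM actM SSa.
sw0 by (symmetry; refine (swA _ _ _); lin).
sw 1 by (refine (sw_antil (F := fun z => (S q · y) * (S z · b)) _ _); [lin|by []]).
refine (etrans (sw_counitl (F := fun z => (S z · y) * (S 1 · b)) _ _) _); [lin|by []|].
by rewrite antipode1 act1.
Qed.

Lemma anti_act_mul h y z : \sw_(p, q <- D h) (S p · ((q · y) * z)) = y * (S h · z).
Proof.
transitivity (\sw_(p, q <- D h) \sw_(c, d <- D p) (((S d * q) · y) * (S c · z))).
  apply: eq_tlift => p q; rewrite act_mul.
  rewrite (swS HH p (fun u v => (u · (q · y)) * (v · z))); [|lin|lin].
  by apply: eq_tlift => c d; rewrite actM.
sw0 by (refine (swA _ _ _); lin).
sw 1 by (refine (sw_antil (F := fun w => (w · y) * (S p · z)) _ _); [lin|by []]).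
refine (etrans (sw_counitr (F := fun w => (1 · y) * (S w · z)) _ _) _); [lin|by []|].
by rewrite act1.
Qed.

(** The form of the product of A # H from which multiplicativity of phi can be read
off: the operator of uv is that of v after that of u. *)
Lemma psi_mul c a h b g : psi c (smash_mul MA (a \ox h) (b \ox g)) =
  \sw_(h1, h2 <- D h) \sw_(g1, g2 <- D g) ((S g1 · ((S h1 · (c * a)) * b)) \ox (h2 * g2)).
Proof.
have l1 := @lin_psi k H HH A MA c.
rewrite /smash_mul !tliftB; try lin.
rewrite (tlift_push _ _ l1).
transitivity (\sw_(p, q <- D h) \sw_(h1, h2 <- D q) \sw_(g1, g2 <- D g)
  ((S g1 · (S h1 · ((c * a) * (p · b)))) \ox (h2 * g2))).
  apply: eq_tlift => p q; rewrite psiE.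
  rewrite (swM _ q g (fun u v => (S u · (c * (a * (p · b)))) \ox v)); [|lin|lin].
  by do 2 (apply: eq_tlift => ? ?); rewrite antipodeM actM mulrA.
sw0 by (symmetry; refine (swA _ _ _); lin).
apply: eq_tlift => p q; rewrite tliftC [RHS](eq_tlift _ (fun g1 g2 => erefl _)).
apply: eq_tlift => g1 g2; rewrite -act_mul_anti tlift_lfun tlift_tensl.
by [].
Qed.

Lemma phi_mul u v : φ (smash_mul MA u v) = B_mul (φ u) (φ v).
Proof.
apply: ev_inj => c; rewrite evφ ev_mul evφ.
have l1 := @lin_psi k H HH A MA; have l1' := @lin_psi_l k H HH A MA.
transitivity (\sw_(p, h <- psi c u) \sw_(q, g <- psi p v) (q \ox (h * g))); last first.
  by apply: eq_tlift => p h; rewrite evφ.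
move: u; apply: lin_tens_eq => [||a h]; [by rewrite /smash_mul; lin | by lin |].
move: v; apply: lin_tens_eq => [||b g]; [by rewrite /smash_mul; lin | by lin |].
rewrite psi_mul psiE tlift_tlift; apply: eq_tlift => h1 h2.
rewrite tliftB; try lin.
rewrite psiE tlift_tlift; apply: eq_tlift => g1 g2.
by rewrite tliftB //; lin.
Qed.

Lemma phi_one : φ (smash_one H A) = B_one H x alpha.
Proof.
rewrite /smash_one phiE sw1; [|lin|lin].
by rewrite /B_one; apply: eq_tlift => x1 x2; rewrite antipode1 act1 mulr1.
Qed.

(** Invariance of alpha removes S(h_1), and then the legs of x contract. *)
Lemma phi_counit u : B_counit HH alpha (φ u) = smash_counit HH alpha u.
Proof.
move: u; apply: lin_tens_eq => [||a h]; [by rewrite /B_counit; lin | by rewrite /smash_counit; lin |].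
have lB : linear (B_counit HH alpha) by rewrite /B_counit; lin.
rewrite /smash_counit tliftB; try lin.
rewrite phiE (tlift_push _ _ lB).
transitivity (\sw_(p, q <- D h) (eps q *: (⟨a⟩ * eps p : k^o))).
  apply: eq_tlift => p q; rewrite (tlift_push _ _ lB).
  transitivity (\sw_(x1, x2 <- x) ((eps q * eps p) *: (⟨x1 * a⟩ *: (alpha x2 : k^o)))).
    apply: eq_tlift => x1 x2; rewrite /B_counit !tliftB; try lin; last first.
      by refine (@lin_tliftf _ _ _ _ _ _ _ _); lin.
    rewrite hitlE mul1r (alphaH char0 ssH qtR qcA sepx alphaE) counit_antipode.
    by rewrite -[RHS]/(eps q * eps p * (⟨x1 * a⟩ * ⟨x2⟩)) mulrA; congr (_ * _); rewrite mulrC mulrA.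
  rewrite -tliftZ -[in RHS](dual_rl sepx alphaE a).
  rewrite -[RHS]/(eps q * (⟨_⟩ * eps p)) mulrCA [RHS]mulrC; congr (_ * _ : k).
  rewrite tlift_lfun; symmetry; apply: eq_tlifts => x1 x2; by rewrite linearZ.
refine (etrans (sw_counitr (F := fun z => ⟨a⟩ * eps z : k^o) _ _) _) => //; lin.
Qed.

(** The two halves of the coproduct of f are evaluated at R2^2.e and c and recombine into
the single value of f at (R2^2.e)c. *)
Lemma ev2_Bcomul c e t : ev2 c e (B_comul R MA x t) =
  \sw_(r11, r12 <- R) \sw_(r21, r22 <- R) \sw_(x1, x2 <- x)
  \sw_(p, h <- ev ((r22 · e) * c) t) \sw_(h1, h2 <- D h)
    ((((r12 · x1) * p) \ox (r21 * h1 * r11)) \ox (x2 \ox h2)).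
Proof.
have lE := @lin_ev2 k A H c e; have l1 := @lin_ev_r k A H; have l2 := @lin_ev_l k A H.
move: t; apply: B_ind => [||a h f]; [by rewrite /B_comul; lin | by lin |].
rewrite /B_comul !tliftB; try lin; try exact: lin_dcomul.
transitivity (\sw_(h1, h2 <- D h) \sw_(x1, x2 <- x) \sw_(r11, r12 <- R) \sw_(r21, r22 <- R)
   (f ((r22 · e) * c) *: ((((r12 · x1) * a) \ox (r21 * h1 * r11)) \ox (x2 \ox h2)))).
  rewrite (tlift_push _ _ lE); apply: eq_tlift => h1 h2.
  rewrite (tlift_push _ _ lE).
  sw 1 by (rewrite (tlift_push _ _ lE); refine (eq_tlift _ (fun r s => _));
           rewrite (tlift_push _ _ lE); refine (eq_tlift _ (fun r s => _));
           rewrite (tlift_push _ _ lE); refine (eq_tlift _ (fun r s => _));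
           rewrite ev2E !evE dactE; reflexivity).
  rewrite tliftC; apply: eq_tlift => x1 x2; rewrite tliftC; apply: eq_tlift => r11 r12.
  rewrite tliftC; apply: eq_tlift => r21 r22.
  rewrite -dcomulP (tlift_push (L := fun z : k^o => (z : k) *: _)); last by lin.
  apply: eq_tlift => f1 f2.
  by rewrite (linZ _ _ (@lin_tens_l _ _ _ _)) (linZ _ _ (@lin_tens_r _ _ _ _)) scalerA mulrC.
sw 1 by swC.
sw0 by swC.
apply: eq_tlift => r11 r12.
sw 1 by swC.
sw0 by swC.
apply: eq_tlift => r21 r22; rewrite tliftC; apply: eq_tlift => x1 x2.
rewrite evE (linZ _ _ (@lin_tlift _ _ _ _ _)) tliftB; try lin.
by rewrite tliftZ.
Qed.

(** Invariance of x when S(h) acts on a product with e: the part of the coproduct that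
falls on e is reabsorbed by act_mulS. *)
Lemma swx_anti h e W (F : A -> A -> W) :
  (forall b, linear (fun a => F a b)) -> (forall a, linear (F a)) ->
  \sw_(x1, x2 <- x) F x1 (S h · (e * x2)) = \sw_(x1, x2 <- x) F ((h · x1) * e) x2.
Proof.
move=> l1 l2.
transitivity (\sw_(p, q <- D h) \sw_(x1, x2 <- x) F x1 ((S q · e) * (S p · x2))).
  rewrite tliftC; apply: eq_tlift => x1 x2; rewrite act_mul.
  rewrite (swS HH h (fun u v => (u · e) * (v · x2))); [|lin|lin].
  by rewrite (tlift_push _ _ (l2 _)).
transitivity (\sw_(p, q <- D h) \sw_(x1, x2 <- x) F (p · (x1 * (S q · e))) x2).
  apply: eq_tlift => p q.
  rewrite -(swx_act char0 ssH qtR qcA sepx alphaE p (F := fun u v => F u ((S q · e) * v))); [|lin|lin].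
  by rewrite -(swx_r sepx (S q · e) (F := fun u v => F (p · u) v)) //; lin.
rewrite tliftC; apply: eq_tlift => x1 x2; rewrite act_mulS.
by rewrite (tlift_push _ _ (l1 _)).
Qed.

(** Starting from the coproduct of A # H, the coproduct of R^1 that psi creates is absorbed by
S_act_mulD, and S(h_3) is moved to the first leg of x by swx_anti. Splitting R by the hexagon
axiom then puts a copy of R next to h_2 (x) h_3; quasi-cocommutativity
exchanges the two and anti_act_mul cancels h_1 against h_2. *)
Lemma phi_comul u : B_comul R MA x (φ u) = tmap φ φ (smash_comul R MA x u).
Proof.
apply: ev2_inj => c e; rewrite (ev2_phi MA sepx alphaE).
have l1 := @lin_psi k H HH A MA; have lE := @lin_ev2 k A H c e.
move: u; apply: lin_tens_eq => [||a h]; [by rewrite /B_comul; lin | by rewrite /smash_comul; lin |].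
rewrite ev2_Bcomul.
transitivity (\sw_(r, r' <- R) \sw_(s, s' <- R) \sw_(x1, x2 <- x) \sw_(h1, q <- D h) \sw_(h2, h3 <- D q)
   ((((r' · x1) * (S h1 · (((s' · e) * c) * a))) \ox (s * h2 * r)) \ox (x2 \ox h3))).
  do 3 (apply: eq_tlift => ? ?); rewrite evφ psiE tlift_tlift; apply: eq_tlift => h1 q.
  by rewrite tliftB //; lin.
symmetry.
transitivity (\sw_(p, q <- D h) \sw_(h1, h2 <- D p) \sw_(g1, g2 <- D q) \sw_(x1, x2 <- x)
   \sw_(r, s <- R) \sw_(r1, r2 <- D r)
   (((S h1 · (S r1 · ((c * a) * (s · x1)))) \ox (r2 * h2)) \ox ((S g1 · (e * x2)) \ox g2))).
  transitivity (\sw_(p, q <- D h) \sw_(x1, x2 <- x) \sw_(r, s <- R)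
     \sw_(h1, h2 <- D p) \sw_(g1, g2 <- D q) \sw_(r1, r2 <- D r)
     (((S h1 · (S r1 · ((c * a) * (s · x1)))) \ox (r2 * h2)) \ox ((S g1 · (e * x2)) \ox g2))).
    rewrite /smash_comul tliftB; try lin.
    rewrite tlift_tlift; apply: eq_tlift => p q; rewrite tlift_tlift [RHS]tliftC; apply: eq_tlift => r s.
    rewrite tlift_tlift; apply: eq_tlift => x1 x2; rewrite tliftB; try lin.
    rewrite !psiE.
    rewrite (swM _ r p (fun u v => (S u · (c * (a * (s · x1)))) \ox v)); [|lin|lin].
    rewrite tliftC tlift_tensl; apply: eq_tlift => h1 h2; rewrite tlift_tensr; apply: eq_tlift => g1 g2.
    rewrite tlift_tensl; apply: eq_tlift => r1 r2.
    by rewrite antipodeM actM mulrA.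
  sw 2 by swC.
  sw 1 by swC.
  sw 3 by swC.
  by sw 2 by swC.
(* Absorb the coproduct of r. *)
transitivity (\sw_(p, q <- D h) \sw_(h1, h2 <- D p) \sw_(g1, g2 <- D q) \sw_(x1, x2 <- x) \sw_(r, s <- R)
   (((S h1 · ((s · x1) * (c * a))) \ox (r * h2)) \ox ((S g1 · (e * x2)) \ox g2))).
  do 4 (apply: eq_tlift => ? ?).
  by rewrite (S_act_mulD char0 ssH qtR qcA sepx alphaE _ _
    (F := fun z r => ((S _ · z) \ox (r * _)) \ox _)); [|lin|lin].
(* Move the action of g1 to the first leg of x and split the copy of R that acts on the product. *)
transitivity (\sw_(p, q <- D h) \sw_(h1, h2 <- D p) \sw_(g1, g2 <- D q) \sw_(x1, x2 <- x)
   \sw_(r, r' <- R) \sw_(s, s' <- R)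
   (((S h1 · ((s' · (g1 · x1)) * ((r' · e) * (c * a)))) \ox (r * (s * h2))) \ox (x2 \ox g2))).
  apply: eq_tlift => p q; apply: eq_tlift => h1 h2; apply: eq_tlift => g1 g2.
  rewrite tliftC.
  sw 1 by (refine (swx_anti _ e
    (F := fun u v => ((S _ · ((_ · u) * _)) \ox _) \ox (v \ox _)) _ _); lin).
  sw0 by swC.
  apply: eq_tlift => x1 x2.
  transitivity (\sw_(r, s <- R) \sw_(s1, s2 <- D s)
     (((S h1 · ((s1 · (g1 · x1)) * ((s2 · e) * (c * a)))) \ox (r * h2)) \ox (x2 \ox g2))); last first.
    rewrite (swRr qtR (fun r s t => ((S h1 · ((s · (g1 · x1)) * ((t · e) * (c * a)))) \ox (r * h2)) \ox (x2 \ox g2))); [|lin|lin|lin].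
    by do 2 (apply: eq_tlift => ? ?); rewrite -!mulrA.
  apply: eq_tlift => r s; rewrite (act_mul MA s (g1 · x1) e) tlift_mull tlift_lfun !tlift_tensl.
  by apply: eq_tlift => s1 s2; rewrite !mulrA.
sw0 by (refine (swA (F := fun h1 h2 q => \sw_(g1, g2 <- D q) \sw_(x1, x2 <- x)
   \sw_(r, r' <- R) \sw_(s, s' <- R)
   (((S h1 · ((s' · (g1 · x1)) * ((r' · e) * (c * a)))) \ox (r * (s * h2))) \ox (x2 \ox g2))) _ _ _); lin).
sw 1 by (symmetry; refine (swA _ _ _); lin).
sw 2 by swC.
sw 3 by swC.
sw 4 by swC.
(* Quasi-cocommutativity at u. *)
transitivity (\sw_(h1, q <- D h) \sw_(u, h4 <- D q) \sw_(x1, x2 <- x) \sw_(r, r' <- R)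
   \sw_(s, s' <- R) \sw_(h2, h3 <- D u)
   (((S h1 · ((h2 · (s' · x1)) * ((r' · e) * (c * a)))) \ox (r * (h3 * s))) \ox (x2 \ox h4))).
  apply: eq_tlift => h1 q; apply: eq_tlift => u h4; apply: eq_tlift => x1 x2; apply: eq_tlift => r r'.
  transitivity (\sw_(s, s' <- R) \sw_(h2, h3 <- D u)
     (((S h1 · ((((s' * h3) · x1)) * ((r' · e) * (c * a)))) \ox (r * (s * h2))) \ox (x2 \ox h4))).
    by do 2 (apply: eq_tlift => ? ?); rewrite actM.
  rewrite (swR_comm qtR u (fun y z => ((S h1 · ((z · x1) * ((r' · e) * (c * a)))) \ox (r * y)) \ox (x2 \ox h4))); [|lin|lin].
  by do 2 (apply: eq_tlift => ? ?); rewrite actM.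
sw 4 by swC.
sw 3 by swC.
sw 2 by swC.
sw 1 by (refine (swA (F := fun h2 h3 h4 => \sw_(x1, x2 <- x) \sw_(r, r' <- R) \sw_(s, s' <- R)
   (((S p · ((h2 · (s' · x1)) * ((r' · e) * (c * a)))) \ox (r * (h3 * s))) \ox (x2 \ox h4))) _ _ _); lin).
sw0 by (symmetry; refine (swA _ _ _); lin).
sw 1 by swC.
sw 2 by swC.
sw 3 by swC.
sw 4 by swC.
(* S(h1) cancels against h2. *)
transitivity (\sw_(p, q <- D h) \sw_(h2, h3 <- D q) \sw_(x1, x2 <- x) \sw_(r, r' <- R) \sw_(s, s' <- R)
   ((((s' · x1) * (S p · ((r' · e) * (c * a)))) \ox (r * (h2 * s))) \ox (x2 \ox h3))).
  do 5 (apply: eq_tlift => ? ?).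
  by rewrite -anti_act_mul !tlift_tensl.
sw 3 by swC.
sw 2 by swC.
sw 1 by swC.
sw0 by swC.
sw 3 by swC.
sw 2 by swC.
sw 1 by swC.
sw 3 by swC.
sw 2 by swC.
by do 5 (apply: eq_tlift => ? ?); rewrite !mulrA.
Qed.

(** On the side of A # H, S_act_mulD leaves (R^2.a)(h_2.c) (x) S(h_1)R^1. On the side of B,
duality removes both copies of x, and the action of the second copy of R on a product
is split by the hexagon axiom. Quasi-cocommutativity at S(h) brings two copies of R into the
position of swR_id_anti, where they cancel. *)
Lemma phi_anti u : φ (smash_antipode R MA u) = B_antipode R MA x alpha (φ u).
Proof.
apply: ev_inj => c; rewrite evφ.
have l1 := @lin_psi k H HH A MA c; have l2 := @lin_ev_r k A H c.
have lB : linear (B_antipode R MA x alpha) by rewrite /B_antipode; lin.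
move: u; apply: lin_tens_eq => [||a h]; [by rewrite /smash_antipode /smash_mul; lin | by lin |].
transitivity (\sw_(h1, h2 <- D h) \sw_(r, s <- R) (((s · a) * (h2 · c)) \ox (S h1 * r))).
  rewrite /smash_antipode tliftB; try (by rewrite /smash_mul; lin).
  rewrite (tlift_push _ _ l1).
  transitivity (\sw_(r, s <- R) \sw_(h1, h2 <- D h) \sw_(g1, g2 <- D r)
     ((S g1 · ((h2 · c) * (s · a))) \ox (S h1 * g2))).
    apply: eq_tlift => r s; rewrite psi_mul.
    rewrite (swS HH h (fun u v => \sw_(g1, g2 <- D r) ((S g1 · ((S u · (c * 1)) * (s · a))) \ox (v * g2)))); [|lin|lin].
    by do 2 (apply: eq_tlift => ? ?); rewrite mulr1 SSa.
  rewrite tliftC; apply: eq_tlift => h1 h2.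
  by rewrite (S_act_mulD char0 ssH qtR qcA sepx alphaE _ _ (F := fun z r => z \ox (S h1 * r))); [|lin|lin].
symmetry; rewrite phiE (tlift_push _ _ lB) (tlift_push _ _ l2).
transitivity (\sw_(h1, h2 <- D h) \sw_(r11, r12 <- R) \sw_(r21, r22 <- R)
   ((S r22 · (a * (h1 · (S r12 · c)))) \ox (r11 * S (r21 * h2)))).
  apply: eq_tlift => h1 h2; rewrite (tlift_push _ _ lB) (tlift_push _ _ l2).
  transitivity (\sw_(y1, y2 <- x) \sw_(x1, x2 <- x) \sw_(r11, r12 <- R) \sw_(r21, r22 <- R)
     ((⟨(r22 · x1) * y2⟩ * ⟨y1 * (a * (h1 · (S r12 · c)))⟩) *: (x2 \ox (r11 * S (r21 * h2))))).
    apply: eq_tlift => y1 y2; rewrite /B_antipode !tliftB; try lin; try exact: lin_dact_l; last first.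
      by refine (lin_comp (f := hitr alpha) _ _); [exact: lin_hitr_r | lin].
    rewrite (tlift_push _ _ l2); apply: eq_tlift => x1 x2.
    rewrite (tlift_push _ _ l2); apply: eq_tlift => r11 r12.
    rewrite (tlift_push _ _ l2); apply: eq_tlift => r21 r22.
    rewrite linZ // evE dactE hitlE hitrE scalerA; congr (_ * _ *: _).
    by rewrite !(adjH char0 ssH qtR qcA sepx alphaE) SSa mulrA.
  sw0 by swC.
  sw 1 by swC.
  sw 2 by swC.
  sw0 by swC.
  sw 1 by swC.
  apply: eq_tlift => r11 r12; apply: eq_tlift => r21 r22.
  move: (a * _) => z; move: (r11 * _) => g.
  transitivity (\sw_(x1, x2 <- x) (⟨(r22 · x1) * z⟩ *: (x2 \ox g))).
    apply: eq_tlift => x1 x2; rewrite -[in RHS](dual_rl sepx alphaE z).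
    rewrite (tlift_push (L := fun z : A => ⟨(r22 · x1) * z⟩ *: (x2 \ox g))); last by lin.
    by apply: eq_tlift => y1 y2; rewrite -scalerAr linearZ mulrC.
  rewrite -[in RHS](dual_rl sepx alphaE (S r22 · z)) tlift_tensl; apply: eq_tlift => x1 x2.
  by rewrite (adjH char0 ssH qtR qcA sepx alphaE) (linZ _ _ (@lin_tens_l _ _ _ _)).
transitivity (\sw_(h1, h2 <- D h) \sw_(r11, r12 <- R) \sw_(r21, r22 <- R)
   ((r22 · (a * (h1 · (S r12 · c)))) \ox (r11 * (S h2 * r21)))).
  do 2 (apply: eq_tlift => ? ?).
  rewrite -(swR_SS qtR (fun u v => (v · (a * (_ · (S _ · c)))) \ox (_ * (S _ * u)))); [|lin|lin].
  by do 1 (apply: eq_tlift => ? ?); rewrite antipodeM.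
transitivity (\sw_(h1, h2 <- D h) \sw_(r, s <- R) \sw_(r1, s1 <- R) \sw_(r2, s2 <- R)
   (((s2 · a) * (s1 · (h1 · (S s · c)))) \ox (r * (S h2 * (r1 * r2))))).
  apply: eq_tlift => h1 h2; apply: eq_tlift => r s.
  rewrite -(swRr qtR (fun u v w => ((v · a) * (w · (h1 · (S s · c)))) \ox (r * (S h2 * u)))); [|lin|lin|lin].
  by apply: eq_tlift => r1 s1; rewrite act_mul tlift_tensl.
sw 2 by swC.
sw 1 by swC.
sw0 by swC.
rewrite [RHS]tliftC; apply: eq_tlift => r2 s2.
transitivity (\sw_(u, v <- D (S h)) \sw_(r, s <- R) \sw_(r1, s1 <- R)
   (((s2 · a) * ((s1 * S (s * v)) · c)) \ox ((r * u) * (r1 * r2)))).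
  rewrite (swS HH h (fun u v => \sw_(r, s <- R) \sw_(r1, s1 <- R)
    (((s2 · a) * ((s1 * S (s * v)) · c)) \ox ((r * u) * (r1 * r2))))); [|lin|lin].
  by do 3 (apply: eq_tlift => ? ?); rewrite antipodeM !actM SSa !mulrA.
sw 1 by swC.
sw0 by swC.
sw 1 by swC.
transitivity (\sw_(r1, s1 <- R) \sw_(r, s <- R) \sw_(u, v <- D (S h))
   (((s2 · a) * ((s1 * S (u * s)) · c)) \ox ((v * r) * (r1 * r2)))).
  apply: eq_tlift => r1 s1.
  by rewrite (swR_comm qtR (S h) (fun y z => ((s2 · a) * ((s1 * S z) · c)) \ox (y * (r1 * r2)))); [|lin|lin].
sw 1 by swC.
sw0 by swC.
sw 1 by swC.
transitivity (\sw_(u, v <- D (S h)) (((s2 · a) * (S u · c)) \ox (v * r2))).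
  apply: eq_tlift => u v.
  transitivity (\sw_(r, s <- R) \sw_(r1, s1 <- R)
     (((s2 · a) * (((s1 * S s) * S u) · c)) \ox (v * ((r * r1) * r2)))).
    by do 2 (apply: eq_tlift => ? ?); rewrite antipodeM !mulrA.
  rewrite (swR_id_anti qtR (fun y z => ((s2 · a) * ((z * S u) · c)) \ox (v * (y * r2)))); [|lin|lin].
  by rewrite !mul1r.
rewrite (swS HH h (fun u v => ((s2 · a) * (S u · c)) \ox (v * r2))); [|lin|lin].
by apply: eq_tlift => h1 h2; rewrite SSa.
Qed.

(** Both legs of R split by the coproduct: four copies of R. *)
Lemma swR4 W (F : H -> H -> H -> H -> W) :
  (forall q u v, linear (fun p => F p q u v)) -> (forall p u v, linear (fun q => F p q u v)) ->
  (forall p q v, linear (fun u => F p q u v)) -> (forall p q u, linear (fun v => F p q u v)) ->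
  \sw_(r, s <- R) \sw_(r1, r2 <- D r) \sw_(s1, s2 <- D s) F r1 r2 s1 s2 =
  \sw_(a, a' <- R) \sw_(b, b' <- R) \sw_(u, u' <- R) \sw_(v, v' <- R)
    F (a * b) (u * v) (b' * v') (a' * u').
Proof.
move=> l1 l2 l3 l4.
rewrite (swRl qtR (fun p q s => \sw_(s1, s2 <- D s) F p q s1 s2)); [|lin|lin|lin].
transitivity (\sw_(p, p' <- R) \sw_(q, q' <- R) \sw_(p1, p2 <- D p') \sw_(q1, q2 <- D q')
   F p q (p1 * q1) (p2 * q2)).
  by do 2 (apply: eq_tlift => ? ?); rewrite swM.
sw 1 by swC.
sw0 by (refine (swRr qtR (fun p p1 p2 => \sw_(q, q' <- R) \sw_(q1, q2 <- D q')
   F p q (p1 * q1) (p2 * q2)) _ _ _); lin).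
do 2 (apply: eq_tlift => ? ?).
by rewrite (swRr qtR (fun q q1 q2 => F _ q (_ * q1) (_ * q2))); [|lin|lin|lin].
Qed.

Lemma smash_comul1 W (G : AH -> AH -> W) :
  (forall v, linear (fun u => G u v)) -> (forall u, linear (G u)) ->
  tlift G (smash_comul R MA x (smash_one H A)) =
  \sw_(s1, s2 <- R) \sw_(x1, x2 <- x) G ((s2 · x1) \ox s1) (x2 \ox 1).
Proof.
move=> l1 l2; rewrite /smash_comul /smash_one tliftB; try lin.
rewrite sw1; [|lin|lin].
rewrite tlift_tlift; apply: eq_tlift => s1 s2; rewrite tlift_tlift; apply: eq_tlift => x1 x2.
by rewrite tliftB // mul1r mulr1.
Qed.

Lemma smash_mul1 a h g : smash_mul MA (a \ox h) (1 \ox g) = a \ox (h * g).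
Proof.
rewrite /smash_mul !tliftB; try lin.
refine (sw_counitl (F := fun z => a \ox (z * g)) _ _); [lin|move=> p q].
by rewrite act_one -scalerAr mulr1 (linZ _ _ (@lin_tens_l _ _ _ _)).
Qed.

(** This lemma and the next treat the two factors of the R-matrix of A # H: the copy of R
inside the coproduct of 1 is absorbed by S_act_mulD. *)
Lemma psi_Rl c b h y : \sw_(t1, t2 <- R) psi c (smash_mul MA (b \ox h) ((t2 · y) \ox t1)) =
  \sw_(t1, t2 <- R) \sw_(h1, h2 <- D h) (((t2 · y) * (S h1 · (c * b))) \ox (h2 * t1)).
Proof.
sw 1 by (refine (psi_mul _ _ _ _ _)).
sw0 by swC.
rewrite [RHS]tliftC; apply: eq_tlift => h1 h2.
by rewrite (S_act_mulD char0 ssH qtR qcA sepx alphaE _ _ (F := fun z r => z \ox (h2 * r))); [|lin|lin].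
Qed.

Lemma psi_Rr e b r y : \sw_(s1, s2 <- R)
    psi e (smash_mul MA ((s2 · b) \ox (s1 * r)) (y \ox 1)) =
  \sw_(s1, s2 <- R) \sw_(r1, r2 <- D r) (((S r1 · ((s2 · b) * e)) * y) \ox (s1 * r2)).
Proof.
transitivity (\sw_(s1, s2 <- R) \sw_(p, q <- D s1) \sw_(r1, r2 <- D r)
   (((S r1 · (S p · (e * (s2 · b)))) * y) \ox (q * r2))).
  apply: eq_tlift => s1 s2; rewrite psi_mul.
  rewrite (swM HH s1 r (fun u v => \sw_(g1, g2 <- D 1) ((S g1 · ((S u · (e * (s2 · b))) * y)) \ox (v * g2)))); [|lin|lin].
  do 2 (apply: eq_tlift => ? ?); rewrite sw1; [|lin|lin].
  by rewrite antipode1 act1 mulr1 antipodeM actM.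
sw 1 by swC.
sw0 by swC.
rewrite [RHS]tliftC; apply: eq_tlift => r1 r2.
by rewrite (S_act_mulD char0 ssH qtR qcA sepx alphaE _ _ (F := fun z t => ((S r1 · z) * y) \ox (t * r2))); [|lin|lin].
Qed.

Lemma ev2_phi_R c e : ev2 c e (tmap φ φ (smash_R R MA x)) =
  \sw_(x1, x2 <- x) \sw_(y1, y2 <- x) \sw_(r, r' <- R) \sw_(t1, t2 <- R) \sw_(p1, p2 <- D r)
  \sw_(s1, s2 <- R) \sw_(q1, q2 <- D r')
   ((((t2 · y1) * (S p1 · (c * x2))) \ox (p2 * t1)) \ox
    (((S q1 · ((s2 · x1) * e)) * y2) \ox (s1 * q2))).
Proof.
rewrite (ev2_phi MA sepx alphaE).
have lp := @lin_psi k H HH A MA.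
rewrite /smash_R tlift_tlift.
have lm2 : forall u, linear (smash_mul MA u) by move=> ?; rewrite /smash_mul; lin.
have lm1 : forall v, linear (fun u => smash_mul MA u v) by move=> ?; rewrite /smash_mul; lin.
rewrite smash_comul1; [|lin|lin].
transitivity (\sw_(s1, s2 <- R) \sw_(x1, x2 <- x) \sw_(t1, t2 <- R) \sw_(y1, y2 <- x) \sw_(r, r' <- R)
  (psi c (smash_mul MA (x2 \ox r) ((t2 · y1) \ox t1)) \ox
   psi e (smash_mul MA ((s2 · x1) \ox (s1 * r')) (y2 \ox 1)))).
  do 2 (apply: eq_tlift => ? ?); rewrite tlift_tlift smash_comul1; [|lin|lin].
  do 2 (apply: eq_tlift => ? ?); rewrite tlift_tlift; apply: eq_tlift => r r'.
  rewrite tliftB; try lin.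
  by rewrite !smash_mul1 mul1r.
sw0 by swC.
sw 1 by swC.
sw 2 by swC.
sw 1 by swC.
sw 3 by swC.
sw 2 by swC.
apply: eq_tlift => x1 x2; apply: eq_tlift => y1 y2; apply: eq_tlift => r r'.
transitivity ((\sw_(t1, t2 <- R) psi c (smash_mul MA (x2 \ox r) ((t2 · y1) \ox t1))) \ox
   (\sw_(s1, s2 <- R) psi e (smash_mul MA ((s2 · x1) \ox (s1 * r')) (y2 \ox 1)))).
  by rewrite tlift_tensl; apply: eq_tlift => t1 t2; rewrite tlift_tensr.
rewrite psi_Rl psi_Rr tlift_tensl; apply: eq_tlift => t1 t2.
rewrite tlift_tensl; apply: eq_tlift => p1 p2.
rewrite tlift_tensr; apply: eq_tlift => s1 s2.
by rewrite tlift_tensr.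
Qed.

(** The Mueger condition at S(R^1).z, with one copy of R cancelled. *)
Lemma mueger_sw : in_mueger_center R MA -> forall z W (F : A -> H -> W),
  (forall h, linear (fun a => F a h)) -> (forall a, linear (F a)) ->
  \sw_(r, s <- R) F (S r · z) s = \sw_(r, s <- R) F (s · z) r.
Proof.
move=> mu z W F l1 l2.
transitivity (\sw_(v, v' <- R) \sw_(r, r' <- R) \sw_(u, u' <- R) 
   F (((u' * r) * S v) · z) (u * (r' * v'))).
  apply: eq_tlift => v v'.
  have e := congr1 (tlift (fun a h => F a (h * v'))) (mu (S v · z)).
  rewrite tliftB in e; try lin.
  rewrite mul1r in e; rewrite -e tlift_tlift; apply: eq_tlift => r r'.
  rewrite tlift_tlift; apply: eq_tlift => u u'; rewrite tliftB; try lin.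
  by rewrite [in RHS]actM -[u * r' * v']mulrA.
sw 1 by swC.
sw0 by swC.
apply: eq_tlift => u u'; rewrite tliftC.
transitivity (\sw_(r, r' <- R) \sw_(v, v' <- R) F ((u' * (r * S v)) · z) (u * (r' * v'))).
  by do 2 (apply: eq_tlift => ? ?); rewrite -!mulrA.
rewrite (swR_invr qtR (fun p q => F ((u' * p) · z) (u * q))); [|lin|lin].
by rewrite !mulr1.
Qed.

(** Both sides are compared as operators. Two pairs of copies of R cancel by swR_id_anti, one copy is absorbed
by quantum commutativity, and one is turned around by the Mueger condition before
it can cancel; the three that remain are those of R_B. *)
Lemma phi_R : in_mueger_center R MA -> tmap φ φ (smash_R R MA x) = B_R R MA x alpha.
Proof.
move=> mu; apply: ev2_inj => c e; rewrite ev2_phi_R (ev2_BR R MA sepx alphaE).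
sw 3 by swC.
sw 4 by swC.
sw 5 by swC.
sw 3 by swC.
sw 2 by swC.
sw 1 by swC.
sw0 by swC.
sw 2 by swC.
sw 3 by swC.
sw 4 by swC.
sw 1 by swC.
sw 2 by swC.
sw 3 by swC.
(* Move the left factor of y2 to y1, then split the copy t of R, whose second leg acts on a product. *)
transitivity (\sw_(s1, s2 <- R) \sw_(r, r' <- R) \sw_(p1, p2 <- D r) \sw_(q1, q2 <- D r')
  \sw_(x1, x2 <- x) \sw_(y1, y2 <- x) \sw_(t1, t2 <- R) \sw_(v1, v2 <- R)
  ((((((v2 · y1) * (t2 · (S q1 · ((s2 · x1) * e)))) * (S p1 · (c * x2))) \ox (p2 * (t1 * v1))) \ox
    (y2 \ox (s1 * q2))))).
  apply: eq_tlift => s1 s2; apply: eq_tlift => r r'; apply: eq_tlift => p1 p2.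
  apply: eq_tlift => q1 q2; apply: eq_tlift => x1 x2.
  move: (S q1 · _) => b; move: (S p1 · _) => z; move: (s1 * q2) => g.
  rewrite tliftC [RHS]tliftC.
  transitivity (\sw_(t1, t2 <- R) \sw_(y1, y2 <- x)
    ((((t2 · (y1 * b)) * z) \ox (p2 * t1)) \ox (y2 \ox g))).
    apply: eq_tlift => t1 t2.
    by rewrite (swx_r sepx b (F := fun u v => (((t2 · u) * z) \ox (p2 * t1)) \ox (v \ox g))); [|lin|lin].
  rewrite tliftC [RHS]tliftC; apply: eq_tlift => y1 y2.
  rewrite -(swRr qtR (fun u v w => ((((v · y1) * (w · b)) * z) \ox (p2 * u)) \ox (y2 \ox g))); [|lin|lin|lin].
  by apply: eq_tlift => t1 t2; rewrite act_mul tlift_mull !tlift_tensl.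
(* Carry s2 from the first leg of x to the second. *)
transitivity (\sw_(s1, s2 <- R) \sw_(r, r' <- R) \sw_(p1, p2 <- D r) \sw_(q1, q2 <- D r')
  \sw_(x1, x2 <- x) \sw_(y1, y2 <- x) \sw_(t1, t2 <- R) \sw_(v1, v2 <- R)
  ((((((v2 · y1) * (t2 · (S q1 · (x1 * e)))) * (S p1 · (c * (S s2 · x2)))) \ox (p2 * (t1 * v1))) \ox
    (y2 \ox (s1 * q2))))).
  apply: eq_tlift => s1 s2; apply: eq_tlift => r r'; apply: eq_tlift => p1 p2.
  apply: eq_tlift => q1 q2.
  rewrite -(swx_act char0 ssH qtR qcA sepx alphaE s2
    (F := fun x1 x2 => \sw_(y1, y2 <- x) \sw_(t1, t2 <- R) \sw_(v1, v2 <- R)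
  ((((((v2 · y1) * (t2 · (S q1 · (x1 * e)))) * (S p1 · (c * x2))) \ox (p2 * (t1 * v1))) \ox
    (y2 \ox (s1 * q2)))))); [by []|lin|lin].
(* Split the copy r of R, both of whose legs appear through their coproducts. *)
transitivity (\sw_(s1, s2 <- R) \sw_(a, a' <- R) \sw_(b, b' <- R) \sw_(u, u' <- R) \sw_(d, d' <- R)
  \sw_(x1, x2 <- x) \sw_(y1, y2 <- x) \sw_(t1, t2 <- R) \sw_(v1, v2 <- R)
  ((((((v2 · y1) * (t2 · (S (b' * d') · (x1 * e)))) * (S (a * b) · (c * (S s2 · x2)))) \ox
     ((u * d) * (t1 * v1))) \ox
    (y2 \ox (s1 * (a' * u')))))).
  apply: eq_tlift => s1 s2.
  rewrite (swR4 (F := fun p1 p2 q1 q2 => \sw_(x1, x2 <- x) \sw_(y1, y2 <- x) \sw_(t1, t2 <- R) \sw_(v1, v2 <- R)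
  ((((((v2 · y1) * (t2 · (S q1 · (x1 * e)))) * (S p1 · (c * (S s2 · x2)))) \ox (p2 * (t1 * v1))) \ox
    (y2 \ox (s1 * q2)))))); [by []|lin|lin|lin|lin].
sw 4 by swC.
sw 5 by swC.
(* The copies d and t cancel. *)
transitivity (\sw_(s1, s2 <- R) \sw_(a, a' <- R) \sw_(b, b' <- R) \sw_(u, u' <- R)
  \sw_(x1, x2 <- x) \sw_(y1, y2 <- x) \sw_(v1, v2 <- R)
  ((((((v2 · y1) * (S b' · (x1 * e))) * (S b · (S a · (c * (S s2 · x2))))) \ox
     (u * v1)) \ox (y2 \ox (s1 * (a' * u')))))).
  apply: eq_tlift => s1 s2; apply: eq_tlift => a a'; apply: eq_tlift => b b'.
  apply: eq_tlift => u u'; apply: eq_tlift => x1 x2; apply: eq_tlift => y1 y2.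
  transitivity (\sw_(d, d' <- R) \sw_(t1, t2 <- R) \sw_(v1, v2 <- R)
  ((((((v2 · y1) * ((t2 * S d') · (S b' · (x1 * e)))) * (S b · (S a · (c * (S s2 · x2))))) \ox
     (u * ((d * t1) * v1))) \ox
    (y2 \ox (s1 * (a' * u')))))).
    by do 3 (apply: eq_tlift => ? ?); rewrite !antipodeM !actM !mulrA.
  rewrite (swR_id_anti qtR (fun p q => \sw_(v1, v2 <- R)
  ((((((v2 · y1) * (q · (S b' · (x1 * e)))) * (S b · (S a · (c * (S s2 · x2))))) \ox
     (u * (p * v1))) \ox
    (y2 \ox (s1 * (a' * u'))))))); [|lin|lin].
  by apply: eq_tlift => v1 v2; rewrite act1 mul1r.
sw 2 by swC.
sw 3 by swC.
sw 4 by swC.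
sw 5 by swC.
(* The copy b reverses the product of its two arguments. *)
transitivity (\sw_(s1, s2 <- R) \sw_(a, a' <- R) \sw_(u, u' <- R)
  \sw_(x1, x2 <- x) \sw_(y1, y2 <- x) \sw_(v1, v2 <- R)
  ((((v2 · y1) * ((S a · (c * (S s2 · x2))) * (x1 * e))) \ox
     (u * v1)) \ox (y2 \ox (s1 * (a' * u'))))).
  apply: eq_tlift => s1 s2; apply: eq_tlift => a a'.
  apply: eq_tlift => u u'; apply: eq_tlift => x1 x2; apply: eq_tlift => y1 y2.
  apply: eq_tlift => v1 v2.
  rewrite (swR_SS qtR (fun (b b' : H) => ((((v2 · y1) * (b' · (x1 * e))) * (b · (S a · (c * (S s2 · x2))))) \ox
     (u * v1)) \ox (y2 \ox (s1 * (a' * u'))))); [|lin|lin].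
  rewrite (qcA (S a · _)) tlift_mulr !tlift_tensl.
  by apply: eq_tlift => b b'; rewrite -!mulrA.
sw 1 by swC.
sw 2 by swC.
sw 3 by swC.
sw 4 by swC.
(* Exchange the legs of the copy a, then split it along the product on which it acts. *)
transitivity (\sw_(s1, s2 <- R) \sw_(u, u' <- R)
  \sw_(x1, x2 <- x) \sw_(y1, y2 <- x) \sw_(v1, v2 <- R) \sw_(a, a' <- R) \sw_(d, d' <- R)
  ((((v2 · y1) * (((d' · c) * ((a' * S s2) · x2)) * (x1 * e))) \ox
     (u * v1)) \ox (y2 \ox ((s1 * a) * (d * u'))))).
  apply: eq_tlift => s1 s2.
  apply: eq_tlift => u u'; apply: eq_tlift => x1 x2; apply: eq_tlift => y1 y2.
  apply: eq_tlift => v1 v2.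
  rewrite (mueger_sw mu (c * (S s2 · x2)) (F := fun z (a' : H) => (((v2 · y1) * (z * (x1 * e))) \ox
     (u * v1)) \ox (y2 \ox (s1 * (a' * u'))))); [|lin|lin].
  transitivity (\sw_(a, a' <- R) \sw_(d1, d2 <- D a') ((((v2 · y1) * (((d1 · c) * (d2 · (S s2 · x2))) * (x1 * e))) \ox
     (u * v1)) \ox (y2 \ox (s1 * (a * u'))))).
    by apply: eq_tlift => a a'; rewrite act_mul tlift_mull tlift_mulr !tlift_tensl.
  rewrite (swRr qtR (fun (a d1 d2 : H) => (((v2 · y1) * (((d1 · c) * (d2 · (S s2 · x2))) * (x1 * e))) \ox
     (u * v1)) \ox (y2 \ox (s1 * (a * u'))))); [|lin|lin|lin].
  by do 2 (apply: eq_tlift => ? ?); rewrite actM !mulrA.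
sw0 by swC.
sw 1 by swC.
sw 2 by swC.
sw 3 by swC.
(* The copies s and a cancel. *)
transitivity (\sw_(u, u' <- R) \sw_(x1, x2 <- x) \sw_(y1, y2 <- x) \sw_(v1, v2 <- R) \sw_(d, d' <- R)
  ((((v2 · y1) * ((d' · c) * (x2 * x1) * e)) \ox (u * v1)) \ox (y2 \ox (d * u')))).
  apply: eq_tlift => u u'; apply: eq_tlift => x1 x2; apply: eq_tlift => y1 y2.
  apply: eq_tlift => v1 v2.
  rewrite (swR_id_anti qtR (fun p q => \sw_(d, d' <- R)
  ((((v2 · y1) * (((d' · c) * (q · x2)) * (x1 * e))) \ox
     (u * v1)) \ox (y2 \ox (p * (d * u')))))); [|lin|lin].
  by apply: eq_tlift => d d'; rewrite act1 mul1r !mulrA.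
sw 1 by swC.
sw 2 by swC.
sw 3 by swC.
(* The legs of x meet and multiply to 1. *)
transitivity (\sw_(u, u' <- R) \sw_(y1, y2 <- x) \sw_(v1, v2 <- R) \sw_(d, d' <- R)
  ((((v2 · y1) * ((d' · c) * e)) \ox (u * v1)) \ox (y2 \ox (d * u')))).
  do 4 (apply: eq_tlift => ? ?).
  rewrite (swx_sym sepx (F := fun x1 x2 => ((_ * ((_ · c) * (x2 * x1) * e)) \ox _) \ox _)); [|lin|lin].
  rewrite -(tlift_push (L := fun z => ((_ * ((_ · c) * z * e)) \ox _) \ox _)); last by lin.
  by rewrite (sep1 sepx) mulr1.
sw0 by swC.
sw 2 by swC.
by sw 1 by swC.
Qed.

End PhiMap.

(** * Membership of R_B in the image of phi and the structure of phi *)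

Theorem proposition3p10
  (k : fieldType) (char0 : [pchar k] =i pred0)
  (H : falgType k) (HH : hopf_algebra H) (ssH : semisimple H)
  (R : tensor H H) (qtR : quasitriangular HH R)
  (A : falgType k) (MA : module_algebra HH A) (qcA : quantum_commutative R MA)
  (x : tensor A A) (sepx : symmetric_separability_idempotent x)
  (alpha : 'Hom(A, k^o))
  (alphaE : \sw_(x1, x2 <- x) (alpha x1 *: x2) = 1) :
  let phi := phi MA x alpha in
  (B_R R MA x alpha \in tensv (limg phi) (limg phi) <-> in_mueger_center R MA) /\
  (in_mueger_center R MA ->
     qtwh_map (smash R MA x alpha) (B_algebra R MA x alpha) phi).
Proof.
move=> phi0; have mR := phi_R char0 ssH qtR qcA sepx alphaE.
split; first split; first exact: (mueger_of_mem qtR sepx alphaE).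
  move/mR => <-; rewrite /tmap; apply: tlift_mem => u v.
  by apply: mem_tensv; apply: memv_img; apply: memvf.
move=> mu; split => /=.
- exact: (phi_mul char0 ssH qtR qcA sepx alphaE).
- exact: phi_one.
- exact: (phi_comul char0 ssH qtR qcA sepx alphaE).
- exact: (phi_counit char0 ssH qtR qcA sepx alphaE).
- exact: (phi_anti char0 ssH qtR qcA sepx alphaE).
- exact: mR.
Qed.
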